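(* Let $\psi$ be a Ma-Minda function. Let $h$ be analytic in $\mathbb{D}$ with $h(0)=0$, $h'(0)\ne0$. Suppose that $h$ satisfies $$\Re\left(1+\frac{zh''(z)}{h'(z)}\right)\ge-\frac12\quad(z\in\mathbb{D})$$ and $$\frac1z\int_0^zh(t)\,dt\prec\frac{\psi(z)-1}{\psi(z)}.$$ If $f\in\mathcal{A}$, then $$\frac{f(z)f''(z)}{(f'(z))^2}\prec h(z)\quad\text{implies}\quad f\in\mathcal{S}^*(\psi).$$
   Context: $\mathbb{D}=\{z:|z|<1\}$. $\mathcal{A}$ is the class of analytic functions $f(z)=z+\sum_{k\ge2}a_kz^k$ in $\mathbb{D}$. $\prec$ denotes subordination. A Ma-Minda function is a function $\psi$ analytic and univalent in $\mathbb{D}$ with $\Re\psi(z)>0$, $\psi(0)=1$, $\psi'(0)>0$ and $\psi(\mathbb{D})$ symmetric about the real axis. $\mathcal{S}^*(\psi)=\{f\in\mathcal{A}:zf'(z)/f(z)\prec\psi(z)\}$. *)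

(* Defs.v *)
From Stdlib Require Export Reals.
From Coquelicot Require Export Coquelicot.
Open Scope R_scope.
Open Scope C_scope.

Definition unit_disk (z : C) : Prop := Cmod z < 1.

(* Complex differentiability at every point of the open unit disk. *)
Definition analytic (f : C -> C) : Prop :=
  forall z : C, unit_disk z -> @ex_derive C_AbsRing C_NormedModule f z.

Definition univalent (f : C -> C) : Prop :=
  forall z1 z2 : C, unit_disk z1 -> unit_disk z2 -> f z1 = f z2 -> z1 = z2.

Definition subordinate (F G : C -> C) : Prop :=
  exists w : C -> C,
    analytic w /\ w 0 = 0 /\
    (forall z : C, unit_disk z -> Cmod (w z) < 1) /\
    (forall z : C, unit_disk z -> F z = G (w z)).

(* [F] is the function N/D on the disk, read as usual in complex analysis:
   it is analytic, the removable singularities of N/D being filled in.  Such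
   an [F] exists only if every zero of D in the disk is removable, and it is
   then unique on the disk when D is analytic and not identically zero. *)
Definition analytic_quotient (N D F : C -> C) : Prop :=
  analytic F /\
  forall z : C, unit_disk z -> D z <> 0 -> F z = N z / D z.

(* N/D is subordinate to G.  Totalized division is thus never evaluated at a
   zero of D. *)
Definition quotient_subordinate (N D G : C -> C) : Prop :=
  exists F : C -> C, analytic_quotient N D F /\ subordinate F G.

Definition class_A (f : C -> C) : Prop :=
  analytic f /\
  exists a : nat -> C,
    a 0%nat = 0 /\ a 1%nat = 1 /\
    forall z : C, unit_disk z ->
      @is_pseries C_AbsRing C_NormedModule a z (f z).

Definition ma_minda (psi : C -> C) : Prop :=
  analytic psi /\
  univalent psi /\
  (forall z : C, unit_disk z -> (0 < Re (psi z))%R) /\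
  psi 0 = 1 /\
  (Im (C_derive psi 0) = 0%R /\ (0 < Re (C_derive psi 0))%R) /\
  (forall z : C, unit_disk z ->
     exists z' : C, unit_disk z' /\ psi z' = Cconj (psi z)).

(* For f in [class_A] the subordination makes z f'(z)/f(z) analytic in the
   disk, so f has no zero there other than the origin. *)
Definition starlike_class (psi f : C -> C) : Prop :=
  class_A f /\
  quotient_subordinate (fun z => z * C_derive f z) f psi.

(* The integral of h from 0 to z, along the segment t |-> t z. *)
Definition primitive0 (h : C -> C) (z : C) : C :=
  @RInt C_R_CompleteNormedModule (fun t : R => z * h (RtoC t * z)) 0%R 1%R.

(* Main.v *)
Require Import Defs.
From Stdlib Require Import Lra Lia Classical ClassicalEpsilon List.
From Stdlib Require Import FunctionalExtensionality.
Open Scope R_scope.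
Open Scope C_scope.

(** Let F be the function f f''/f'^2, so that F = h(w) with w a Schwarz
    function, and let p(z) = (1/z) int_0^z F and k(z) = (1/z) int_0^z h.
    Since (f/f')' = 1 - F, the quotient f/f' is z (1 - p)
    ([factor_through_quotient]), hence z f'/f = 1/(1 - p).  The hypothesis on
    psi says that k = 1 - 1/psi(s) for a Schwarz function s.  If p = k(v) for a
    Schwarz function v, then z f'/f = psi(s(v)), which is the claim.  So
    everything rests on the subordination of p to k, given that
    p + z p' = h(w) and k + z k' = h.

    The bound -1/2 is what makes k convex ([radial_mean_convex]).  The function
    u = 1 - 2 k'/h' vanishes at 0; at a maximum of |u| on a disk Jack's lemma
    gives z u' = n u with n >= 1, and |u| >= 1 there would force
    Re (1 + z h''/h') <= -n/2, whereas this real part exceeds -1/2: it cannot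
    attain its lower bound, being greater at 0.  Therefore |u| < 1, and this is
    the inequality Re (1 + z k''/k') > 0.

    For a convex k the supporting half-planes of the images of disks yield that
    k(y) + y k'(y) = k(z) + m z k'(z) is impossible for m >= 1 and |y| < |z|
    ([convex_ray_avoids]).  Now put v = k^{-1}(p) as long as p stays in the
    range of k.  At a maximum of |v| on a disk, Jack's lemma gives z v' = m v
    with m >= 1, so h(w(z)) = k(v) + m v k'(v), and the point h(w(z)) is
    k(y) + y k'(y) with y = w(z).  Hence |v(z)| <= |w(z)| <= |z|.  This bound
    keeps v away from the unit circle, so p never leaves the range of k
    ([convex_subordination]).

    The function theory is developed on disks only.  Goursat's theorem gives
    primitives; integrating a primitive over circles gives the mean value
    property and the differentiability of f' ([holomorphic_C_derive]); the
    average of f' over a segment ([divided_difference]) divides out a zero.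
    From these follow the maximum principle, the lemmas of Schwarz and Jack and
    the identity theorem, without power series. *)

(** * Derivatives and integrals of complex functions *)

(** A function of a complex variable is differentiated over the field C, a
    function of a real variable over the real vector space C. *)
Definition is_Cderive (f : C -> C) (z l : C) : Prop :=
  @is_derive C_AbsRing C_NormedModule f z l.

Definition ex_Cderive (f : C -> C) (z : C) : Prop := exists l, is_Cderive f z l.

Definition is_Rderive (g : R -> C) (t : R) (l : C) : Prop :=
  @is_derive R_AbsRing C_R_NormedModule g t l.

Notation path_continuous := (@continuous R_UniformSpace C_UniformSpace).
Notation CInt := (@RInt C_R_CompleteNormedModule).
Notation is_CInt := (@is_RInt C_R_NormedModule).

Lemma is_Cderive_eps f z l : is_Cderive f z l <->
  forall eps : R, 0 < eps -> exists d : R, 0 < d /\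
    forall y, Cmod (y - z) < d ->
      Cmod (f y - f z - l * (y - z)) <= eps * Cmod (y - z).
Proof.
split.
- intros [_ H] eps He.
  destruct (H z (fun P HP => HP) (mkposreal eps He)) as [d Hd].
  exists d; split; [apply d|]. intros y Hy.
  specialize (Hd y Hy). simpl in Hd.
  replace (f y - f z - l * (y-z))
    with (minus (minus (f y) (f z)) (scal (minus y z) l)); [exact Hd|].
  unfold minus, scal, plus, opp; simpl. unfold mult; simpl. ring.
- intros H. split.
  + apply (is_linear_scal_l (K:=C_AbsRing) (V:=C_NormedModule) l).
  + intros x Hx.
    rewrite <- (@is_filter_lim_locally_unique C_AbsRing (AbsRing_NormedModule C_AbsRing) z x Hx).
    intros eps. destruct (H eps (cond_pos eps)) as [d [Hd0 Hd]].
    exists (mkposreal d Hd0). intros y Hy. specialize (Hd y Hy).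
    replace (f y - f z - l * (y-z))
      with (minus (minus (f y) (f z)) (scal (minus y z) l)) in Hd; [exact Hd|].
    unfold minus, scal, plus, opp; simpl. unfold mult; simpl. ring.
Qed.

(** The field C has round balls and the module C has square ones, so that the
    derivatives for the two structures are distinct notions; both amount to the
    same estimate on norms. *)
Lemma is_Cderive_AbsRing f z l :
  @is_derive C_AbsRing (AbsRing_NormedModule C_AbsRing) f z l <-> is_Cderive f z l.
Proof.
split; intros [_ H]; (split; [|exact H]).
- apply (is_linear_scal_l (K:=C_AbsRing) (V:=C_NormedModule) l).
- apply (is_linear_scal_l (K:=C_AbsRing) (V:=AbsRing_NormedModule C_AbsRing) l).
Qed.

Lemma is_Cderive_eq f z l l' : is_Cderive f z l -> l = l' -> is_Cderive f z l'.
Proof. intros H <-; exact H. Qed.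

Lemma is_Cderive_const c z : is_Cderive (fun _ => c) z (RtoC 0).
Proof. exact (@is_derive_const C_AbsRing C_NormedModule c z). Qed.

Lemma is_Cderive_id z : is_Cderive (fun x => x) z (RtoC 1).
Proof. apply is_Cderive_AbsRing. exact (@is_derive_id C_AbsRing z). Qed.

Lemma is_Cderive_plus (f g : C -> C) z a b :
  is_Cderive f z a -> is_Cderive g z b -> is_Cderive (fun x => f x + g x) z (a + b).
Proof. exact (@is_derive_plus C_AbsRing _ f g z a b). Qed.

Lemma is_Cderive_minus (f g : C -> C) z a b :
  is_Cderive f z a -> is_Cderive g z b -> is_Cderive (fun x => f x - g x) z (a - b).
Proof. exact (@is_derive_minus C_AbsRing _ f g z a b). Qed.

Lemma is_Cderive_mult (f g : C -> C) z a b :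
  is_Cderive f z a -> is_Cderive g z b ->
  is_Cderive (fun x => f x * g x) z (a * g z + f z * b).
Proof.
unfold is_Cderive; rewrite <- !is_Cderive_AbsRing. intros Hf Hg.
exact (@is_derive_mult C_AbsRing f g z a b Hf Hg Cmult_comm).
Qed.

Lemma is_Cderive_comp (f g : C -> C) z a b :
  is_Cderive f (g z) a -> is_Cderive g z b -> is_Cderive (fun x => f (g x)) z (b * a).
Proof.
rewrite <- (is_Cderive_AbsRing g). exact (@is_derive_comp C_AbsRing _ f g z a b).
Qed.

Lemma is_Cderive_ext_loc (f g : C -> C) z l d : 0 < d ->
  (forall y, Cmod (y - z) < d -> f y = g y) -> is_Cderive f z l -> is_Cderive g z l.
Proof.
intros Hd H. rewrite !is_Cderive_eps. intros Hf eps He.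
destruct (Hf eps He) as [d' [Hd' H']].
exists (Rmin d d'). split; [now apply Rmin_pos|]. intros y Hy.
assert (Hz : Cmod (z - z) < d) by (replace (z - z) with (RtoC 0) by ring; rewrite Cmod_0; lra).
rewrite <- (H y), <- (H z).
- apply H'. pose proof (Rmin_r d d'); lra.
- exact Hz.
- pose proof (Rmin_l d d'); lra.
Qed.

Lemma is_Cderive_ext (f g : C -> C) z l :
  (forall y, f y = g y) -> is_Cderive f z l -> is_Cderive g z l.
Proof. intros H. apply (is_Cderive_ext_loc f g z l 1); [lra|auto]. Qed.

Lemma is_Cderive_continuous f z l : is_Cderive f z l ->
  forall eps, 0 < eps -> exists d, 0 < d /\ forall y, Cmod (y - z) < d -> Cmod (f y - f z) < eps.
Proof.
rewrite is_Cderive_eps. intros H eps He.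
destruct (H 1 Rlt_0_1) as [d [Hd H']].
assert (Hl := Cmod_ge_0 l).
assert (Hp : 0 < eps / (Cmod l + 2)) by (apply Rdiv_lt_0_compat; lra).
exists (Rmin d (eps / (Cmod l + 2))). split; [now apply Rmin_pos|]. intros y Hy.
assert (H1 := H' y (Rlt_le_trans _ _ _ Hy (Rmin_l _ _))).
assert (H2 := Rlt_le_trans _ _ _ Hy (Rmin_r _ _)).
replace (f y - f z) with ((f y - f z - l * (y - z)) + l * (y - z)) by ring.
eapply Rle_lt_trans; [apply Cmod_triangle|]. rewrite Cmod_mult.
apply (Rmult_lt_compat_r (Cmod l + 2)) in H2; [|lra].
replace (eps / (Cmod l + 2) * (Cmod l + 2))%R with eps in H2 by (field; lra).
pose proof (Cmod_ge_0 (y - z)). nra.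
Qed.

Lemma Cmod_le_minus x y : Cmod x <= Cmod y + Cmod (x - y).
Proof. replace x with (y + (x - y)) at 1 by ring. apply Cmod_triangle. Qed.

Lemma Cmod_minus_sym x y : Cmod (x - y) = Cmod (y - x).
Proof. replace (x - y) with (- (y - x)) by ring. apply Cmod_opp. Qed.

Lemma Cmod_lt_neq (x y : C) : Cmod (y - x) < Cmod x -> y <> 0.
Proof.
intros H ->. replace (0 - x) with (- x) in H by ring. rewrite Cmod_opp in H. lra.
Qed.

Lemma is_Cderive_inv (z : C) : z <> 0 -> is_Cderive (fun x => / x) z (- / (z * z)).
Proof.
intros Hz. rewrite is_Cderive_eps. intros eps He.
assert (Hm := proj1 (Cmod_gt_0 z) Hz).
set (m := Cmod z) in *.
assert (Hp : 0 < eps * (m * m * m) / 2) by (apply Rdiv_lt_0_compat; [|lra]; repeat apply Rmult_lt_0_compat; lra).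
exists (Rmin (m/2) (eps * (m * m * m) / 2)). split; [apply Rmin_pos; lra|].
intros y Hy.
assert (H1 := Rlt_le_trans _ _ _ Hy (Rmin_l _ _)).
assert (H2 := Rlt_le_trans _ _ _ Hy (Rmin_r _ _)).
assert (Hy0 : y <> 0) by (apply (Cmod_lt_neq z); fold m; lra).
assert (Hym : m / 2 <= Cmod y).
{ assert (H := Cmod_le_minus z y). rewrite Cmod_minus_sym in H. fold m in H. lra. }
replace (/ y - / z - - / (z * z) * (y - z)) with ((y - z) * (y - z) / (z * z * y)) by (field; auto).
rewrite Cmod_div by (repeat apply Cmult_neq_0; auto). rewrite !Cmod_mult. fold m.
set (a := Cmod (y - z)) in *. assert (0 <= a) by apply Cmod_ge_0.
set (b := Cmod y) in *.
assert (Hmb : m * m * m / 2 <= m * m * b) by nra.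
apply Rle_div_l; [nra|].
assert (a * a <= a * (eps * (m * m * m) / 2)) by nra.
assert (eps * a * (m * m * m / 2) <= eps * a * (m * m * b))%R by (apply Rmult_le_compat_l; nra).
nra.
Qed.

Lemma is_Cderive_div (f g : C -> C) z a b : g z <> 0 ->
  is_Cderive f z a -> is_Cderive g z b ->
  is_Cderive (fun x => f x / g x) z ((a * g z - f z * b) / (g z * g z)).
Proof.
intros Hg Hf Hg'.
eapply is_Cderive_eq.
apply is_Cderive_mult; [exact Hf|].
apply (is_Cderive_comp (fun x => / x)); [now apply is_Cderive_inv|exact Hg'].
simpl. field. auto.
Qed.

Lemma is_Rderive_eps (f : R -> C) t l : is_Rderive f t l <->
  forall eps : R, 0 < eps -> exists d : R, 0 < d /\
    forall s, Rabs (s - t) < d ->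
      Cmod (f s - f t - l * RtoC (s - t)) <= eps * Rabs (s - t).
Proof.
assert (E : forall s, f s - f t - l * RtoC (s - t) =
  @minus C_R_NormedModule (minus (f s) (f t)) (scal (minus s t : R) l)).
{ intros s. apply injective_projections; unfold minus, scal, plus, opp; simpl;
  unfold scal, prod_scal; simpl; unfold mult, plus, opp; simpl; ring. }
split.
- intros [_ H] eps He.
  destruct (H t (fun P HP => HP) (mkposreal eps He)) as [d Hd].
  exists d; split; [apply d|]. intros y Hy.
  specialize (Hd y Hy). rewrite E, Cmod_norm. exact Hd.
- intros H. split.
  + apply (is_linear_scal_l (K:=R_AbsRing) (V:=C_R_NormedModule) l).
  + intros x Hx.
    rewrite <- (@is_filter_lim_locally_unique R_AbsRing (AbsRing_NormedModule R_AbsRing) t x Hx).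
    intros eps. destruct (H eps (cond_pos eps)) as [d [Hd0 Hd]].
    exists (mkposreal d Hd0). intros y Hy. specialize (Hd y Hy).
    rewrite E, Cmod_norm in Hd. exact Hd.
Qed.

Lemma path_continuous_eps (g : R -> C) t : path_continuous g t <->
  forall eps : R, 0 < eps -> exists d : R, 0 < d /\
    forall s, Rabs (s - t) < d -> Cmod (g s - g t) < eps.
Proof.
split.
- intros H eps He.
  destruct (proj1 (filterlim_locally_ball_norm (U:=C_R_NormedModule) (F:=locally t) g (g t)) H (mkposreal eps He)) as [d Hd].
  exists d; split; [apply d|]. intros s Hs. rewrite Cmod_norm. exact (Hd s Hs).
- intros H. apply (proj2 (filterlim_locally_ball_norm (U:=C_R_NormedModule) (F:=locally t) g (g t))).
  intros eps. destruct (H eps (cond_pos eps)) as [d [Hd0 Hd]]. exists (mkposreal d Hd0). intros s Hs.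
  specialize (Hd s Hs). rewrite Cmod_norm in Hd. exact Hd.
Qed.

Lemma path_continuous_components (g : R -> C) t :
  continuous (fun s => Re (g s)) t -> continuous (fun s => Im (g s)) t -> path_continuous g t.
Proof.
intros H1 H2 P [eps HP].
specialize (H1 (ball (Re (g t)) eps) (locally_ball _ eps)).
specialize (H2 (ball (Im (g t)) eps) (locally_ball _ eps)).
unfold filtermap in *. apply (filter_imp (F:=locally t) (fun x => ball (Re (g t)) eps (Re (g x)) /\ ball (Im (g t)) eps (Im (g x)))).
- intros x [A B]. apply HP. split; assumption.
- exact (filter_and (F:=locally t) _ _ H1 H2).
Qed.

Lemma path_continuous_Re (g : R -> C) t : path_continuous g t -> continuous (fun s => Re (g s)) t.
Proof. intros H. apply (continuous_comp g Re); [exact H|]. apply continuous_fst. Qed.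

Lemma path_continuous_Im (g : R -> C) t : path_continuous g t -> continuous (fun s => Im (g s)) t.
Proof. intros H. apply (continuous_comp g Im); [exact H|]. apply continuous_snd. Qed.

Lemma path_continuous_plus (f g : R -> C) t :
  path_continuous f t -> path_continuous g t -> path_continuous (fun s => f s + g s) t.
Proof. exact (@continuous_plus _ R_AbsRing C_R_NormedModule f g t). Qed.

Lemma path_continuous_const c t : path_continuous (fun _ => c) t.
Proof. apply continuous_const. Qed.

Lemma path_continuous_RtoC (g : R -> R) t : continuous g t -> path_continuous (fun s => RtoC (g s)) t.
Proof.
intros H. apply path_continuous_components; simpl; [exact H|apply continuous_const].
Qed.

Lemma path_continuous_mult (f g : R -> C) t :
  path_continuous f t -> path_continuous g t -> path_continuous (fun s => f s * g s) t.
Proof.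
intros Hf Hg.
pose proof (path_continuous_Re _ _ Hf). pose proof (path_continuous_Im _ _ Hf).
pose proof (path_continuous_Re _ _ Hg). pose proof (path_continuous_Im _ _ Hg).
apply path_continuous_components; simpl.
- apply (continuous_minus (V:=R_NormedModule)
   (fun s => (Re (f s) * Re (g s))%R) (fun s => (Im (f s) * Im (g s))%R));
  apply (continuous_mult (K:=R_AbsRing)); assumption.
- apply (continuous_plus (V:=R_NormedModule)
   (fun s => (Re (f s) * Im (g s))%R) (fun s => (Im (f s) * Re (g s))%R));
  apply (continuous_mult (K:=R_AbsRing)); assumption.
Qed.

Lemma path_continuous_comp f c t :
  ex_Cderive f (c t) -> path_continuous c t -> path_continuous (fun s => f (c s)) t.
Proof.
intros [l Hl]. rewrite !path_continuous_eps. intros Hc eps He.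
destruct (is_Cderive_continuous _ _ _ Hl eps He) as [d [Hd H]].
destruct (Hc d Hd) as [d' [Hd' H']]. exists d'; split; auto.
Qed.

Lemma Cmod_le_Re_Im w : Cmod w <= Rabs (Re w) + Rabs (Im w).
Proof.
replace w with (RtoC (Re w) + Ci * RtoC (Im w)) at 1.
- eapply Rle_trans; [apply Cmod_triangle|]. rewrite Cmod_mult, Cmod_Ci, !Cmod_R. lra.
- destruct w as [w1 w2]; unfold Ci, RtoC, Cmult, Cplus; simpl; f_equal; ring.
Qed.

Lemma is_Rderive_components (g : R -> C) t a b :
  is_derive (fun s => Re (g s)) t a -> is_derive (fun s => Im (g s)) t b ->
  is_Rderive g t (a, b).
Proof.
intros [_ H1] [_ H2]. rewrite is_Rderive_eps. intros eps He.
assert (Hp : 0 < eps / 2) by lra.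
destruct (H1 t (fun P HP => HP) (mkposreal _ Hp)) as [d1 Hd1].
destruct (H2 t (fun P HP => HP) (mkposreal _ Hp)) as [d2 Hd2].
exists (Rmin d1 d2). split; [apply Rmin_pos; apply cond_pos|].
intros s Hs.
specialize (Hd1 s (Rlt_le_trans _ _ _ Hs (Rmin_l _ _))).
specialize (Hd2 s (Rlt_le_trans _ _ _ Hs (Rmin_r _ _))).
change (Rabs (Re (g s) - Re (g t) - (s - t) * a) <= eps / 2 * Rabs (s - t)) in Hd1.
change (Rabs (Im (g s) - Im (g t) - (s - t) * b) <= eps / 2 * Rabs (s - t)) in Hd2.
eapply Rle_trans; [apply Cmod_le_Re_Im|].
replace (Re (g s - g t - (a, b) * RtoC (s - t))) with (Re (g s) - Re (g t) - (s - t) * a)%R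
  by (simpl; unfold Re; ring).
replace (Im (g s - g t - (a, b) * RtoC (s - t))) with (Im (g s) - Im (g t) - (s - t) * b)%R
  by (simpl; unfold Im; ring).
lra.
Qed.

Lemma is_Rderive_continuous (c : R -> C) t l : is_Rderive c t l -> path_continuous c t.
Proof. intros H. apply (ex_derive_continuous (K:=R_AbsRing) (V:=C_R_NormedModule)). now exists l. Qed.

Lemma is_Rderive_comp f (c : R -> C) t l m :
  is_Cderive f (c t) l -> is_Rderive c t m -> is_Rderive (fun s => f (c s)) t (l * m).
Proof.
intros Hf Hc. assert (Hcc := is_Rderive_continuous _ _ _ Hc).
rewrite path_continuous_eps in Hcc.
rewrite is_Cderive_eps in Hf. rewrite is_Rderive_eps in Hc |- *.
intros eps He.
assert (Hl := Cmod_ge_0 l). assert (Hm := Cmod_ge_0 m).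
assert (P1 : 0 < eps / (2 * (Cmod m + 1))) by (apply Rdiv_lt_0_compat; lra).
assert (P2 : 0 < eps / (2 * (Cmod l + 1))) by (apply Rdiv_lt_0_compat; lra).
destruct (Hf _ P1) as [d1 [Hd1 H1]].
destruct (Hc _ P2) as [d2 [Hd2 H2]].
destruct (Hc 1 Rlt_0_1) as [d4 [Hd4 H4]].
destruct (Hcc d1 Hd1) as [d3 [Hd3 H3]].
exists (Rmin d2 (Rmin d3 d4)). split; [repeat apply Rmin_pos; auto|].
intros s Hs.
pose proof (Rmin_l d2 (Rmin d3 d4)). pose proof (Rmin_r d2 (Rmin d3 d4)).
pose proof (Rmin_l d3 d4). pose proof (Rmin_r d3 d4).
specialize (H3 s ltac:(lra)). specialize (H1 _ H3). specialize (H2 s ltac:(lra)).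
specialize (H4 s ltac:(lra)).
replace (f (c s) - f (c t) - l * m * RtoC (s - t)) with
  ((f (c s) - f (c t) - l * (c s - c t)) + l * (c s - c t - m * RtoC (s - t))) by ring.
eapply Rle_trans; [apply Cmod_triangle|]. rewrite (Cmod_mult l).
set (e := Rabs (s - t)) in *. assert (0 <= e) by apply Rabs_pos.
assert (Hmv : Cmod (c s - c t) <= (Cmod m + 1) * e).
{ replace (c s - c t) with ((c s - c t - m * RtoC (s - t)) + m * RtoC (s - t)) by ring.
  eapply Rle_trans; [apply Cmod_triangle|]. rewrite Cmod_mult, Cmod_R. fold e. lra. }
assert (E1 : eps / (2 * (Cmod m + 1)) * Cmod (c s - c t) <= eps / 2 * e).
{ replace (eps / 2 * e)%R with (eps / (2 * (Cmod m + 1)) * ((Cmod m + 1) * e))%R by (field; lra).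
  apply Rmult_le_compat_l; lra. }
assert (E2 : Cmod l * Cmod (c s - c t - m * RtoC (s - t)) <= eps / 2 * e).
{ apply Rle_trans with (Cmod l * (eps / (2 * (Cmod l + 1)) * e))%R.
  - apply Rmult_le_compat_l; lra.
  - replace (eps / 2 * e)%R with ((Cmod l + 1) * (eps / (2 * (Cmod l + 1)) * e))%R by (field; lra).
    apply Rmult_le_compat_r; [|lra]. apply Rmult_le_pos; lra. }
lra.
Qed.

Lemma is_Rderive_line a b t : is_Rderive (fun s => a + RtoC s * b) t b.
Proof.
rewrite is_Rderive_eps. intros eps He. exists 1. split; [lra|]. intros s _.
rewrite RtoC_minus.
replace (a + s * b - (a + t * b) - b * (s - t)) with (RtoC 0) by ring.
rewrite Cmod_0. apply Rmult_le_pos; [lra|apply Rabs_pos].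
Qed.

Lemma is_Rderive_mult_l c (g : R -> C) t l : is_Rderive g t l -> is_Rderive (fun s => c * g s) t (c * l).
Proof.
intros H. refine (is_Rderive_comp (fun x => c * x) g t c l _ H).
eapply is_Cderive_eq.
- apply is_Cderive_mult; [apply is_Cderive_const|apply is_Cderive_id].
- simpl; ring.
Qed.

Lemma is_CInt_correct (g : R -> C) a b : (forall t, Rmin a b <= t <= Rmax a b -> path_continuous g t) ->
  is_CInt g a b (CInt g a b).
Proof.
intros H. apply (@RInt_correct C_R_CompleteNormedModule).
apply (@ex_RInt_continuous C_R_CompleteNormedModule). exact H.
Qed.

Lemma CInt_unique g a b l : is_CInt g a b l -> CInt g a b = l.
Proof. apply (@is_RInt_unique C_R_CompleteNormedModule). Qed.

Lemma is_CInt_components (g : R -> C) a b l : is_CInt g a b l <->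
  is_RInt (fun t => Re (g t)) a b (Re l) /\ is_RInt (fun t => Im (g t)) a b (Im l).
Proof.
split.
- intros H; split.
  + exact (@is_RInt_fct_extend_fst R_NormedModule R_NormedModule g a b l H).
  + exact (@is_RInt_fct_extend_snd R_NormedModule R_NormedModule g a b l H).
- intros [H1 H2]. rewrite (surjective_pairing l).
  exact (@is_RInt_fct_extend_pair R_NormedModule R_NormedModule g a b _ _ H1 H2).
Qed.

(** The integral is linear over R by construction; for a complex factor the two
    components get mixed. *)
Lemma is_CInt_mult_l c g a b l : is_CInt g a b l -> is_CInt (fun t => c * g t) a b (c * l).
Proof.
rewrite !is_CInt_components. intros [H1 H2]. split; simpl.
- apply (is_RInt_minus (V:=R_NormedModule) (fun t => (Re c * Re (g t))%R) (fun t => (Im c * Im (g t))%R));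
  now apply (is_RInt_scal (V:=R_NormedModule)).
- apply (is_RInt_plus (V:=R_NormedModule) (fun t => (Re c * Im (g t))%R) (fun t => (Im c * Re (g t))%R));
  now apply (is_RInt_scal (V:=R_NormedModule)).
Qed.

Lemma is_CInt_minus f g a b l m : is_CInt f a b l -> is_CInt g a b m ->
  is_CInt (fun t => f t - g t) a b (l - m).
Proof. exact (@is_RInt_minus C_R_NormedModule f g a b l m). Qed.

Lemma is_CInt_const c a b : is_CInt (fun _ => c) a b (RtoC (b - a) * c).
Proof.
rewrite <- scal_R_Cmult. exact (@is_RInt_const C_R_NormedModule a b c).
Qed.

Lemma is_CInt_derive (f df : R -> C) a b :
  (forall t, Rmin a b <= t <= Rmax a b -> is_Rderive f t (df t)) ->
  (forall t, Rmin a b <= t <= Rmax a b -> path_continuous df t) ->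
  is_CInt df a b (f b - f a).
Proof. exact (@is_RInt_derive C_R_CompleteNormedModule f df a b). Qed.

Lemma is_CInt_bound g a b l M : a <= b -> (forall t, a <= t <= b -> Cmod (g t) <= M) ->
  is_CInt g a b l -> Cmod l <= (b - a) * M.
Proof.
intros Hab Hg H. rewrite Cmod_norm.
apply (@norm_RInt_le_const C_R_NormedModule g a b l M Hab); [|exact H].
intros t Ht. rewrite <- Cmod_norm. auto.
Qed.

Lemma is_CInt_ext (f g : R -> C) a b l : (forall t, Rmin a b < t < Rmax a b -> f t = g t) ->
  is_CInt f a b l -> is_CInt g a b l.
Proof. exact (@is_RInt_ext C_R_NormedModule f g a b l). Qed.

(** * Compactness *)

Definition closed_set (K : C -> Prop) : Prop :=
  forall z, ~ K z -> exists d, 0 < d /\ forall y, Cmod (y - z) < d -> ~ K y.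

(** A point outside K receives a radius that keeps its disk away from K, and the
    bounding square of K is compact.  In a finite subcover of the square every
    disk that meets K is therefore centred in K. *)
Lemma compact_cover (K : C -> Prop) (r : R) (Q : C -> R -> Prop) :
  closed_set K -> (forall z, K z -> Cmod z <= r) ->
  (forall c, K c -> exists d, 0 < d /\ Q c d) ->
  exists l : list (C * R),
    (forall c d, In (c, d) l -> K c /\ 0 < d /\ Q c d) /\
    forall z, K z -> exists c d, In (c, d) l /\ Cmod (z - c) < d.
Proof.
intros HKc HKr HQ.
assert (Hd : forall c, exists d : posreal,
  (K c -> Q c d) /\ (~ K c -> forall y, Cmod (y - c) < d -> ~ K y)).
{ intros c. destruct (classic (K c)) as [Hc|Hc].
  - destruct (HQ c Hc) as [d [Hd H]]. exists (mkposreal d Hd). simpl. tauto.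
  - destruct (HKc c Hc) as [d [Hd H]]. exists (mkposreal d Hd). simpl. tauto. }
set (rad := fun c => proj1_sig (constructive_indefinite_description _ (Hd c))).
assert (Hrad : forall c, (K c -> Q c (rad c)) /\ (~ K c -> forall y, Cmod (y - c) < rad c -> ~ K y)).
{ intros c. exact (proj2_sig (constructive_indefinite_description _ (Hd c))). }
set (delta := fun p : Tn 2 R => mkposreal (rad (fst p, fst (snd p)) / 2) (is_pos_div_2 _)).
apply NNPP. intros Hno.
apply (compactness_list 2 (-r, (-r, tt))%R (r, (r, tt)) delta). intros [l Hl]. apply Hno.
exists (map (fun c => (c, pos (rad c)))
  (filter (fun c => if excluded_middle_informative (K c) then true else false)
    (map (fun p : Tn 2 R => (fst p, fst (snd p))) l))).
split.
- intros c d Hin. apply in_map_iff in Hin. destruct Hin as [c' [E Hin]].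
  injection E as <- <-. apply filter_In in Hin. destruct Hin as [_ Hin].
  destruct (excluded_middle_informative (K c')) as [Hc|]; [|discriminate].
  split; [exact Hc|]. split; [apply cond_pos|]. apply Hrad, Hc.
- intros z Hz. specialize (Hl (fst z, (snd z, tt))).
  assert (Hb : bounded_n 2 (-r, (-r, tt))%R (r, (r, tt)) (fst z, (snd z, tt))).
  { assert (H := HKr z Hz). assert (H1 := Rmax_Cmod z).
    assert (H2 := Rmax_l (Rabs (fst z)) (Rabs (snd z))).
    assert (H3 := Rmax_r (Rabs (fst z)) (Rabs (snd z))).
    assert (E1 : Rabs (fst z) <= r) by lra. assert (E2 : Rabs (snd z) <= r) by lra.
    apply Rabs_le_between in E1. apply Rabs_le_between in E2.
    simpl. repeat split; lra. }
  destruct (Hl Hb) as [[u [v []]] [Hin [_ Hclose]]]. simpl in Hclose.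
  destruct Hclose as [H1 [H2 _]].
  set (c := (u, v) : C) in *.
  assert (Hzc : Cmod (z - c) < rad c).
  { eapply Rle_lt_trans; [apply Cmod_le_Re_Im|].
    change (Re (z - c)) with (fst z - u)%R. change (Im (z - c)) with (snd z - v)%R.
    lra. }
  assert (Hc : K c).
  { apply NNPP. intros Hc. exact (proj2 (Hrad c) Hc z Hzc Hz). }
  exists c, (rad c). split; [|exact Hzc].
  apply in_map_iff. exists c. split; [reflexivity|]. apply filter_In. split.
  + apply in_map_iff. exists (u, (v, tt)). auto.
  + destruct (excluded_middle_informative (K c)); tauto.
Qed.

Definition closed_disk (r : R) (z : C) : Prop := Cmod z <= r.

Lemma closed_closed_disk r : closed_set (closed_disk r).
Proof.
intros z Hz. unfold closed_disk in *. exists (Cmod z - r)%R. split; [lra|].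
intros y Hy. assert (H := Cmod_le_minus z y). rewrite Cmod_minus_sym in H. lra.
Qed.

(** If no value were maximal, each point of K would have a neighbourhood on which
    V stays below some value of V.  Among the finitely many values that belong
    to a finite subcover, the largest would be smaller than itself. *)
Lemma extreme_value (K : C -> Prop) (r : R) (V : C -> R) (k0 : C) :
  closed_set K -> (forall z, K z -> Cmod z <= r) -> K k0 ->
  (forall z, K z -> forall eps, 0 < eps ->
    exists d, 0 < d /\ forall y, K y -> Cmod (y - z) < d -> Rabs (V y - V z) < eps) ->
  exists m, K m /\ forall z, K z -> V z <= V m.
Proof.
intros HKc HKr Hk0 HV. apply NNPP. intros Hno.
assert (Hgt : forall c, K c -> exists c', K c' /\ V c < V c').
{ intros c Hc. apply NNPP. intros H. apply Hno. exists c. split; [exact Hc|].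
  intros z Hz. apply Rnot_lt_le. intros Hlt. apply H. now exists z. }
destruct (compact_cover K r
  (fun c d => exists c', K c' /\ forall y, K y -> Cmod (y - c) < d -> V y < V c') HKc HKr)
  as [l [Hl1 Hl2]].
{ intros c Hc. destruct (Hgt c Hc) as [c' [Hc' Hlt]].
  destruct (HV c Hc (V c' - V c)%R ltac:(lra)) as [d [Hd H]].
  exists d. split; [exact Hd|]. exists c'. split; [exact Hc'|]. intros y Hy Hyc.
  specialize (H y Hy Hyc). apply Rabs_lt_between in H. lra. }
assert (Hm : exists m, K m /\ forall c d, In (c, d) l ->
  forall y, K y -> Cmod (y - c) < d -> V y < V m).
{ clear Hl2. induction l as [|[c d] l IH].
  - exists k0. split; [exact Hk0|]. intros c d [].
  - destruct IH as [m [Hm1 Hm2]]. { intros; apply Hl1; now right. }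
    destruct (Hl1 c d (or_introl eq_refl)) as [_ [_ [c' [Hc' H]]]].
    destruct (Rle_dec (V m) (V c')) as [Hle|Hle].
    + exists c'. split; [exact Hc'|]. intros c1 d1 [E|Hin] y Hy Hyc.
      * injection E as <- <-. auto.
      * apply Rlt_le_trans with (V m); eauto.
    + exists m. split; [exact Hm1|]. intros c1 d1 [E|Hin] y Hy Hyc.
      * injection E as <- <-. specialize (H y Hy Hyc). lra.
      * eauto. }
destruct Hm as [m [Hm1 Hm2]]. destruct (Hl2 m Hm1) as [c [d [Hin Hmc]]].
specialize (Hm2 c d Hin m Hm1 Hmc). lra.
Qed.

Definition continuous_at (f : C -> C) (z : C) : Prop :=
  forall eps, 0 < eps -> exists d, 0 < d /\ forall y, Cmod (y - z) < d -> Cmod (f y - f z) < eps.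

(** Only one of the two points has to lie in the disk, which spares the use of a
    larger disk for points near the boundary. *)
Lemma uniform_continuity (r : R) (f : C -> C) :
  (forall z, Cmod z <= r -> continuous_at f z) ->
  forall eps, 0 < eps -> exists d, 0 < d /\
    forall z y, Cmod z <= r -> Cmod (y - z) < d -> Cmod (f y - f z) < eps.
Proof.
intros Hf eps He.
destruct (compact_cover (closed_disk r) r
  (fun c d => forall y, Cmod (y - c) < 2 * d -> Cmod (f y - f c) < eps / 2)
  (closed_closed_disk r) (fun z H => H)) as [l [Hl1 Hl2]].
{ intros c Hc. destruct (Hf c Hc (eps / 2)%R ltac:(lra)) as [d [Hd H]].
  exists (d / 2)%R. split; [lra|]. intros y Hy. apply H. lra. }
assert (Hd : exists d, 0 < d /\ forall c d', In (c, d') l -> d <= d').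
{ clear Hl2. induction l as [|[c d'] l IH].
  - exists 1%R. split; [lra|]. intros c d' [].
  - destruct IH as [d [Hd H]]. { intros; apply Hl1; now right. }
    destruct (Hl1 c d' (or_introl eq_refl)) as [_ [Hd' _]].
    exists (Rmin d d'). split; [now apply Rmin_pos|].
    intros c1 d1 [E|Hin].
    + injection E as <- <-. apply Rmin_r.
    + apply Rle_trans with d; [apply Rmin_l|eauto]. }
destruct Hd as [d [Hd H]]. exists d. split; [exact Hd|]. intros z y Hz Hy.
destruct (Hl2 z Hz) as [c [d' [Hin Hzc]]].
destruct (Hl1 c d' Hin) as [_ [Hd' HQ]]. specialize (H c d' Hin).
assert (H1 := HQ z ltac:(lra)).
assert (H2 : Cmod (f y - f c) < eps / 2).
{ apply HQ. replace (y - c) with ((y - z) + (z - c)) by ring.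
  eapply Rle_lt_trans; [apply Cmod_triangle|]. lra. }
replace (f y - f z) with ((f y - f c) + - (f z - f c)) by ring.
eapply Rle_lt_trans; [apply Cmod_triangle|]. rewrite Cmod_opp. lra.
Qed.

(** * Integrals over segments *)

Definition holomorphic (rho : R) (f : C -> C) : Prop := forall z, Cmod z < rho -> ex_Cderive f z.

Lemma ex_Cderive_C_derive f z : ex_Cderive f z -> is_Cderive f z (C_derive f z).
Proof. apply (C_derive_correct f z z). Qed.

Lemma ex_Cderive_continuous_at f z : ex_Cderive f z -> continuous_at f z.
Proof. intros [l Hl] eps. now apply (is_Cderive_continuous f z l). Qed.

Definition segment_point (a b : C) (t : R) : C := a + RtoC t * (b - a).

Lemma Cmod_segment_point_minus a b c r t : 0 <= t <= 1 ->
  Cmod (a - c) <= r -> Cmod (b - c) <= r -> Cmod (segment_point a b t - c) <= r.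
Proof.
intros Ht Ha Hb. unfold segment_point.
replace (a + t * (b - a) - c) with (RtoC (1 - t) * (a - c) + RtoC t * (b - c))
  by (rewrite RtoC_minus; ring).
eapply Rle_trans; [apply Cmod_triangle|]. rewrite !Cmod_mult, !Cmod_R.
rewrite !Rabs_pos_eq by lra. nra.
Qed.

Lemma Cmod_segment_point a b r t : 0 <= t <= 1 ->
  Cmod a <= r -> Cmod b <= r -> Cmod (segment_point a b t) <= r.
Proof.
intros Ht Ha Hb. replace (segment_point a b t) with (segment_point a b t - 0) by ring.
apply Cmod_segment_point_minus; auto; now replace (a - 0) with a by ring; replace (b - 0) with b by ring.
Qed.

Lemma is_Rderive_segment_point a b t : is_Rderive (segment_point a b) t (b - a).
Proof. apply is_Rderive_line. Qed.

Lemma segment_point_continuous a b t : path_continuous (segment_point a b) t.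
Proof. exact (is_Rderive_continuous _ _ _ (is_Rderive_segment_point a b t)). Qed.

Lemma path_continuous_comp_at f c t :
  continuous_at f (c t) -> path_continuous c t -> path_continuous (fun s => f (c s)) t.
Proof.
intros Hf. rewrite !path_continuous_eps. intros Hc eps He.
destruct (Hf eps He) as [d [Hd H]].
destruct (Hc d Hd) as [d' [Hd' H']]. exists d'; split; auto.
Qed.

Definition segment_integral (f : C -> C) (a b : C) : C :=
  (b - a) * CInt (fun t => f (segment_point a b t)) 0 1.

(** An affine change of parameter.  Reversal and bisection of a segment are the
    cases of the parameter intervals (1, 0), (0, 1/2) and (1/2, 1). *)
Lemma segment_integral_part f a b s t : 0 <= s <= 1 -> 0 <= t <= 1 ->
  (forall u, 0 <= u <= 1 -> continuous_at f (segment_point a b u)) ->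
  segment_integral f (segment_point a b s) (segment_point a b t) =
  (b - a) * CInt (fun u => f (segment_point a b u)) s t.
Proof.
intros Hs Ht Hf. unfold segment_integral.
set (g := fun u => f (segment_point a b u)).
assert (Hg : is_CInt g s t (CInt g s t)).
{ apply is_CInt_correct. intros u Hu. apply path_continuous_comp_at.
  - apply Hf. revert Hu. apply Rmin_case; apply Rmax_case; lra.
  - apply segment_point_continuous. }
assert (E := @is_RInt_comp_lin C_R_NormedModule g (t - s)%R s 0 1 (CInt g s t)).
replace ((t - s) * 0 + s)%R with s in E by ring.
replace ((t - s) * 1 + s)%R with t in E by ring.
specialize (E Hg).
assert (Ep : forall u, segment_point (segment_point a b s) (segment_point a b t) u
  = segment_point a b ((t - s) * u + s)).
{ intros u. unfold segment_point. rewrite RtoC_plus, RtoC_mult, RtoC_minus. ring. }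
assert (E1 : is_CInt (fun u => RtoC (t - s) *
    f (segment_point (segment_point a b s) (segment_point a b t) u)) 0 1 (CInt g s t)).
{ refine (is_CInt_ext _ _ _ _ _ _ E). intros u _. rewrite Ep. exact (scal_R_Cmult _ _). }
apply CInt_unique in E1. rewrite <- E1.
replace (segment_point a b t - segment_point a b s) with ((b - a) * RtoC (t - s))
  by (unfold segment_point; rewrite RtoC_minus; ring).
rewrite <- Cmult_assoc. f_equal. symmetry. apply CInt_unique.
apply is_CInt_mult_l. apply is_CInt_correct. intros u Hu.
rewrite Rmin_left, Rmax_right in Hu by lra.
apply path_continuous_comp_at; [|apply segment_point_continuous].
rewrite Ep. apply Hf. nra.
Qed.

Lemma segment_point_0 a b : segment_point a b 0 = a.
Proof. unfold segment_point. ring. Qed.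

Lemma segment_point_1 a b : segment_point a b 1 = b.
Proof. unfold segment_point. ring. Qed.

Definition midpoint (a b : C) : C := segment_point a b (1 / 2).

Lemma segment_path_continuous f a b t : 0 <= t <= 1 ->
  (forall u, 0 <= u <= 1 -> continuous_at f (segment_point a b u)) ->
  path_continuous (fun u => f (segment_point a b u)) t.
Proof.
intros Ht H. apply path_continuous_comp_at; [auto|apply segment_point_continuous].
Qed.

Lemma is_CInt_segment f a b s t : 0 <= s <= 1 -> 0 <= t <= 1 ->
  (forall u, 0 <= u <= 1 -> continuous_at f (segment_point a b u)) ->
  is_CInt (fun u => f (segment_point a b u)) s t (CInt (fun u => f (segment_point a b u)) s t).
Proof.
intros Hs Ht H. apply is_CInt_correct. intros u Hu. apply segment_path_continuous; [|exact H].
revert Hu. apply Rmin_case; apply Rmax_case; lra.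
Qed.

Lemma segment_integral_swap f a b :
  (forall u, 0 <= u <= 1 -> continuous_at f (segment_point a b u)) ->
  segment_integral f b a = - segment_integral f a b.
Proof.
intros H.
assert (E1 := segment_integral_part f a b 1 0 ltac:(lra) ltac:(lra) H).
rewrite segment_point_0, segment_point_1 in E1. rewrite E1. unfold segment_integral.
rewrite (CInt_unique _ 1 0 (- CInt (fun u => f (segment_point a b u)) 0 1)); [ring|].
apply (@is_RInt_swap C_R_NormedModule). apply is_CInt_segment; auto; lra.
Qed.

Lemma segment_integral_midpoint f a b :
  (forall u, 0 <= u <= 1 -> continuous_at f (segment_point a b u)) ->
  segment_integral f a b =
  segment_integral f a (midpoint a b) + segment_integral f (midpoint a b) b.
Proof.
intros H. unfold midpoint.
assert (E1 := segment_integral_part f a b 0 (1/2) ltac:(lra) ltac:(lra) H).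
assert (E2 := segment_integral_part f a b (1/2) 1 ltac:(lra) ltac:(lra) H).
rewrite segment_point_0 in E1. rewrite segment_point_1 in E2. rewrite E1, E2.
rewrite <- Cmult_plus_distr_l. unfold segment_integral. f_equal. apply CInt_unique.
apply (@is_RInt_Chasles C_R_NormedModule _ 0 (1/2) 1); apply is_CInt_segment; auto; lra.
Qed.

Lemma segment_integral_derive F f a b :
  (forall u, 0 <= u <= 1 -> is_Cderive F (segment_point a b u) (f (segment_point a b u))) ->
  (forall u, 0 <= u <= 1 -> continuous_at f (segment_point a b u)) ->
  segment_integral f a b = F b - F a.
Proof.
intros HF Hf. unfold segment_integral.
assert (E : is_CInt (fun u => f (segment_point a b u) * (b - a)) 0 1
  (F (segment_point a b 1) - F (segment_point a b 0))).
{ apply (is_CInt_derive (fun u => F (segment_point a b u))); intros t Ht;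
  rewrite Rmin_left, Rmax_right in Ht by lra.
  - apply is_Rderive_comp; [auto|apply is_Rderive_segment_point].
  - apply path_continuous_mult; [now apply segment_path_continuous|apply path_continuous_const]. }
rewrite segment_point_0, segment_point_1 in E.
rewrite <- (CInt_unique _ _ _ _ E). symmetry. apply CInt_unique.
eapply is_CInt_ext; [intros u _; apply Cmult_comm|].
apply is_CInt_mult_l. apply is_CInt_segment; auto; lra.
Qed.

Lemma segment_integral_bound f a b M :
  (forall u, 0 <= u <= 1 -> continuous_at f (segment_point a b u)) ->
  (forall u, 0 <= u <= 1 -> Cmod (f (segment_point a b u)) <= M) ->
  Cmod (segment_integral f a b) <= Cmod (b - a) * M.
Proof.
intros H HM. unfold segment_integral. rewrite Cmod_mult.
apply Rmult_le_compat_l; [apply Cmod_ge_0|].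
replace M with ((1 - 0) * M)%R by ring.
apply (is_CInt_bound (fun u => f (segment_point a b u))); [lra|exact HM|].
apply is_CInt_segment; auto; lra.
Qed.

Lemma segment_integral_minus f g a b :
  (forall u, 0 <= u <= 1 -> continuous_at f (segment_point a b u)) ->
  (forall u, 0 <= u <= 1 -> continuous_at g (segment_point a b u)) ->
  segment_integral (fun z => f z - g z) a b = segment_integral f a b - segment_integral g a b.
Proof.
intros Hf Hg. unfold segment_integral.
rewrite (CInt_unique _ 0 1 (CInt (fun u => f (segment_point a b u)) 0 1
  - CInt (fun u => g (segment_point a b u)) 0 1)); [ring|].
apply is_CInt_minus; apply is_CInt_segment; auto; lra.
Qed.

(** * Goursat's theorem and primitives *)

Definition triangle_integral (f : C -> C) (a b c : C) : C :=
  segment_integral f a b + segment_integral f b c + segment_integral f c a.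

(** The number [size] only bounds the sides from above, so that bisection halves
    it exactly. *)
Record triangle := Triangle { vertex_a : C; vertex_b : C; vertex_c : C; size : R }.

Definition subtriangle (T T' : triangle) : Prop :=
  let mab := midpoint (vertex_a T) (vertex_b T) in
  let mbc := midpoint (vertex_b T) (vertex_c T) in
  let mca := midpoint (vertex_c T) (vertex_a T) in
  let s := (size T / 2)%R in
  T' = Triangle (vertex_a T) mab mca s \/ T' = Triangle mab (vertex_b T) mbc s \/
  T' = Triangle mca mbc (vertex_c T) s \/ T' = Triangle mab mbc mca s.

Definition triangle_in (r : R) (T : triangle) : Prop :=
  Cmod (vertex_a T) <= r /\ Cmod (vertex_b T) <= r /\ Cmod (vertex_c T) <= r /\
  Cmod (vertex_a T - vertex_b T) <= size T /\ Cmod (vertex_b T - vertex_c T) <= size T /\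
  Cmod (vertex_c T - vertex_a T) <= size T.

Lemma midpoint_eq a b : midpoint a b = a + 1 / 2 * (b - a).
Proof. unfold midpoint, segment_point. now rewrite RtoC_div by lra. Qed.

Lemma subtriangle_in r T T' : triangle_in r T -> subtriangle T T' ->
  triangle_in r T' /\ size T' = (size T / 2)%R /\ Cmod (vertex_a T' - vertex_a T) <= size T.
Proof.
destruct T as [a b c s]; unfold triangle_in, subtriangle; simpl.
intros (Ha & Hb & Hc & Hab & Hbc & Hca).
assert (Hs : 0 <= s) by (eapply Rle_trans; [apply Cmod_ge_0|apply Hab]).
assert (M : forall x y, Cmod x <= r -> Cmod y <= r -> Cmod (midpoint x y) <= r).
{ intros; apply Cmod_segment_point; auto; lra. }
assert (half : forall x y, Cmod x <= s -> y = x / 2 -> Cmod y <= s / 2).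
{ intros x y Hx ->. rewrite Cmod_div by (injection; lra).
  rewrite Cmod_R, Rabs_pos_eq by lra. lra. }
assert (Hba : Cmod (b - a) <= s) by (now rewrite Cmod_minus_sym).
assert (Hcb : Cmod (c - b) <= s) by (now rewrite Cmod_minus_sym).
assert (Hac : Cmod (a - c) <= s) by (now rewrite Cmod_minus_sym).
assert (Haa : Cmod (a - a) <= s) by (replace (a - a) with (RtoC 0) by ring; now rewrite Cmod_0).
assert (Hmab : Cmod (midpoint a b - a) <= s) by (apply Cmod_segment_point_minus; auto; lra).
assert (Hmca : Cmod (midpoint c a - a) <= s) by (apply Cmod_segment_point_minus; auto; lra).
intros [->|[->|[->| ->]]]; simpl; (split; [|split; [reflexivity|auto]]);
  repeat split; auto; rewrite ?midpoint_eq;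
  first
  [ apply (half (a - b)); [assumption|]; field
  | apply (half (b - a)); [assumption|]; field
  | apply (half (b - c)); [assumption|]; field
  | apply (half (c - b)); [assumption|]; field
  | apply (half (a - c)); [assumption|]; field
  | apply (half (c - a)); [assumption|]; field ].
Qed.

Lemma triangle_integral_split f r rho a b c : r < rho -> holomorphic rho f ->
  Cmod a <= r -> Cmod b <= r -> Cmod c <= r ->
  let mab := midpoint a b in let mbc := midpoint b c in let mca := midpoint c a in
  triangle_integral f a b c =
  triangle_integral f a mab mca + triangle_integral f mab b mbc +
  triangle_integral f mca mbc c + triangle_integral f mab mbc mca.
Proof.
intros Hrho Hf Ha Hb Hc mab mbc mca.
assert (Hcont : forall x y, Cmod x <= r -> Cmod y <= r ->
  forall u, 0 <= u <= 1 -> continuous_at f (segment_point x y u)).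
{ intros x y Hx Hy u Hu. apply ex_Cderive_continuous_at. apply Hf.
  apply Rle_lt_trans with r; [now apply Cmod_segment_point|exact Hrho]. }
assert (M : forall x y, Cmod x <= r -> Cmod y <= r -> Cmod (midpoint x y) <= r).
{ intros; apply Cmod_segment_point; auto; lra. }
assert (Hab : Cmod mab <= r) by (now apply M).
assert (Hbc : Cmod mbc <= r) by (now apply M).
assert (Hca : Cmod mca <= r) by (now apply M).
unfold triangle_integral.
rewrite (segment_integral_midpoint f a b), (segment_integral_midpoint f b c),
  (segment_integral_midpoint f c a) by auto.
fold mab mbc mca.
rewrite (segment_integral_swap f mab mca), (segment_integral_swap f mbc mab),
  (segment_integral_swap f mca mbc) by auto.
ring.
Qed.

Lemma half_pow_small s eps : 0 <= s -> 0 < eps -> exists n : nat, s * (1 / 2) ^ n < eps.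
Proof.
intros Hs He. destruct (pow_lt_1_zero (1/2) ltac:(rewrite Rabs_pos_eq; lra) (eps / (s + 1))) as [N HN].
{ apply Rdiv_lt_0_compat; lra. }
exists N. specialize (HN N (le_n N)).
assert (0 <= (1/2)^N)%R by (apply pow_le; lra).
rewrite Rabs_pos_eq in HN by assumption.
apply (Rmult_lt_compat_r (s + 1)) in HN; [|lra].
replace (eps / (s + 1) * (s + 1))%R with eps in HN by (field; lra). nra.
Qed.

Lemma geometric_Cauchy_limit (u : nat -> C) (s : R) : 0 <= s ->
  (forall n, Cmod (u (S n) - u n) <= s * (1 / 2) ^ n) ->
  exists c, forall n, Cmod (u n - c) <= 2 * (s * (1 / 2) ^ n).
Proof.
intros Hs Hu.
assert (Hk : forall n k, Cmod (u (n + k)%nat - u n) <= 2 * (s * (1/2)^n) - 2 * (s * (1/2)^(n + k))).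
{ intros n k. induction k as [|k IH].
  - rewrite Nat.add_0_r. replace (u n - u n) with (RtoC 0) by ring. rewrite Cmod_0. lra.
  - replace (u (n + S k)%nat - u n) with ((u (S (n + k)) - u (n + k)%nat) + (u (n + k)%nat - u n))
      by (rewrite Nat.add_succ_r; ring).
    eapply Rle_trans; [apply Cmod_triangle|]. specialize (Hu (n + k)%nat).
    rewrite Nat.add_succ_r. simpl. lra. }
assert (Hpos : forall n, 0 <= s * (1/2)^n).
{ intros n. apply Rmult_le_pos; [lra|apply pow_le; lra]. }
assert (Hnm : forall n m, (n <= m)%nat -> Cmod (u m - u n) <= 2 * (s * (1/2)^n)).
{ intros n m Hnm. specialize (Hk n (m - n)%nat). specialize (Hpos m).
  replace (n + (m - n))%nat with m in Hk by lia. lra. }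
assert (HC : forall p : C -> R, (forall x y, (p x - p y)%R = p (x - y)) -> (forall x, Rabs (p x) <= Cmod x) ->
  Cauchy_crit (fun n => p (u n))).
{ intros p Hp1 Hp2 eps He. destruct (half_pow_small (4 * s) eps ltac:(lra) He) as [N HN].
  exists N. intros n m Hn Hm. unfold Rdist. rewrite Hp1.
  eapply Rle_lt_trans; [apply Hp2|].
  replace (u n - u m) with ((u n - u N) + - (u m - u N)) by ring.
  eapply Rle_lt_trans; [apply Cmod_triangle|]. rewrite Cmod_opp.
  assert (A1 := Hnm N n Hn). assert (A2 := Hnm N m Hm). lra. }
destruct (Rcomplete.R_complete _ (HC Re (fun x y => eq_refl) re_le_Cmod)) as [x Hx].
destruct (Rcomplete.R_complete _ (HC Im (fun x y => eq_refl)
  (fun z => Rle_trans _ _ _ (Rmax_r _ _) (Rmax_Cmod z)))) as [y Hy].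
exists (x, y). intros n. apply Rle_plus_epsilon. intros eps He.
destruct (Hx (eps / 2)%R ltac:(lra)) as [N1 H1].
destruct (Hy (eps / 2)%R ltac:(lra)) as [N2 H2].
set (m := (n + N1 + N2)%nat).
specialize (H1 m ltac:(unfold m; lia)). specialize (H2 m ltac:(unfold m; lia)).
replace (u n - (x, y)) with ((u m - (x, y)) + - (u m - u n)) by ring.
eapply Rle_trans; [apply Cmod_triangle|]. rewrite Cmod_opp.
specialize (Hnm n m ltac:(unfold m; lia)).
assert (A := Cmod_le_Re_Im (u m - (x, y))).
change (Re (u m - (x, y))) with (Re (u m) - x)%R in A.
change (Im (u m - (x, y))) with (Im (u m) - y)%R in A.
unfold Rdist in H1, H2. lra.
Qed.

(** The affine approximation of f at c has a primitive, so it contributes nothing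
    to the integral over a closed path; the remainder is at most
    eps * 3 * size on sides of total length at most 3 * size. *)
Lemma triangle_integral_small f r rho c l eps d T : r < rho -> holomorphic rho f -> 0 < eps ->
  (forall y, Cmod (y - c) < d -> Cmod (f y - f c - l * (y - c)) <= eps * Cmod (y - c)) ->
  triangle_in r T -> Cmod (vertex_a T - c) <= 2 * size T -> 3 * size T < d ->
  Cmod (triangle_integral f (vertex_a T) (vertex_b T) (vertex_c T)) <= 9 * eps * (size T * size T).
Proof.
destruct T as [p q w s]; unfold triangle_in; simpl.
intros Hrho Hf Heps Hd (Hp & Hq & Hw & Hpq & Hqw & Hwp) Hpc Hs.
assert (Hs0 : 0 <= s) by (eapply Rle_trans; [apply Cmod_ge_0|apply Hpq]).
assert (P : Cmod (p - c) <= 3 * s) by lra.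
assert (Q : Cmod (q - c) <= 3 * s).
{ replace (q - c) with ((p - c) + - (p - q)) by ring.
  eapply Rle_trans; [apply Cmod_triangle|]. rewrite Cmod_opp. lra. }
assert (W : Cmod (w - c) <= 3 * s).
{ replace (w - c) with ((p - c) + (w - p)) by ring.
  eapply Rle_trans; [apply Cmod_triangle|]. lra. }
set (phi := fun z => f c + l * (z - c)).
set (Phi := fun z => f c * z + l / 2 * ((z - c) * (z - c))).
assert (HPhi : forall z, is_Cderive Phi z (phi z)).
{ intros z. unfold Phi, phi. eapply is_Cderive_eq.
  - assert (Hz : is_Cderive (fun z => z - c) z (1 - 0))
      by (apply is_Cderive_minus; [apply is_Cderive_id|apply is_Cderive_const]).
    apply is_Cderive_plus; (apply is_Cderive_mult; [apply is_Cderive_const|]).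
    + apply is_Cderive_id.
    + apply is_Cderive_mult; exact Hz.
  - simpl. field. }
assert (Hphi : forall z, continuous_at phi z).
{ intros z. apply ex_Cderive_continuous_at. exists (0 + (0 * (z - c) + l * (1 - 0))).
  unfold phi. apply is_Cderive_plus; [apply is_Cderive_const|].
  apply (is_Cderive_mult (fun _ => l) (fun z => z - c)); [apply is_Cderive_const|].
  apply is_Cderive_minus; [apply is_Cderive_id|apply is_Cderive_const]. }
assert (Hcont : forall x y, Cmod x <= r -> Cmod y <= r ->
  forall u, 0 <= u <= 1 -> continuous_at f (segment_point x y u)).
{ intros x y Hx Hy u Hu. apply ex_Cderive_continuous_at. apply Hf.
  apply Rle_lt_trans with r; [now apply Cmod_segment_point|exact Hrho]. }
assert (Hcont' : forall x y, Cmod x <= r -> Cmod y <= r ->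
  forall u, 0 <= u <= 1 -> continuous_at (fun z => f z - phi z) (segment_point x y u)).
{ intros x y Hx Hy u Hu. apply ex_Cderive_continuous_at.
  destruct (Hf (segment_point x y u)) as [m Hm].
  { apply Rle_lt_trans with r; [now apply Cmod_segment_point|exact Hrho]. }
  exists (m - (0 + (0 * (segment_point x y u - c) + l * (1 - 0)))).
  apply is_Cderive_minus; [exact Hm|].
  unfold phi. apply is_Cderive_plus; [apply is_Cderive_const|].
  apply (is_Cderive_mult (fun _ => l) (fun z => z - c)); [apply is_Cderive_const|].
  apply is_Cderive_minus; [apply is_Cderive_id|apply is_Cderive_const]. }
assert (Hseg : forall x y, Cmod x <= r -> Cmod y <= r -> Cmod (x - c) <= 3 * s ->
  Cmod (y - c) <= 3 * s -> Cmod (y - x) <= s ->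
  exists e, Cmod e <= 3 * eps * (s * s) /\ segment_integral f x y = Phi y - Phi x + e).
{ intros x y Hx Hy Hxc Hyc Hxy.
  exists (segment_integral (fun z => f z - phi z) x y). split.
  - apply Rle_trans with (Cmod (y - x) * (3 * eps * s))%R.
    + apply segment_integral_bound; [auto|]. intros u Hu.
      assert (Hu' := Cmod_segment_point_minus x y c _ u Hu Hxc Hyc).
      replace (f (segment_point x y u) - phi (segment_point x y u)) with
        (f (segment_point x y u) - f c - l * (segment_point x y u - c)) by (unfold phi; ring).
      eapply Rle_trans; [apply Hd; lra|].
      replace (3 * eps * s)%R with (eps * (3 * s))%R by ring. apply Rmult_le_compat_l; lra.
    + assert (0 <= 3 * eps * s) by (apply Rmult_le_pos; lra). nra.
  - rewrite segment_integral_minus by auto.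
    rewrite (segment_integral_derive Phi phi) by auto. ring. }
unfold triangle_integral.
destruct (Hseg p q) as [e1 [He1 ->]]; auto. { now rewrite Cmod_minus_sym. }
destruct (Hseg q w) as [e2 [He2 ->]]; auto. { now rewrite Cmod_minus_sym. }
destruct (Hseg w p) as [e3 [He3 ->]]; auto. { now rewrite Cmod_minus_sym. }
replace (Phi q - Phi p + e1 + (Phi w - Phi q + e2) + (Phi p - Phi w + e3)) with (e1 + e2 + e3) by ring.
eapply Rle_trans; [apply Cmod_triangle|].
assert (T := Cmod_triangle e1 e2). lra.
Qed.

(** If the integral exceeded eta * size^2, so would the integral over one of the
    four triangles of the bisection, since their bounds add up to the same
    quantity.  The nested triangles shrink to a point, where
    differentiability makes the integral too small. *)
Theorem Goursat f r rho a b c : r < rho -> holomorphic rho f ->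
  Cmod a <= r -> Cmod b <= r -> Cmod c <= r -> triangle_integral f a b c = 0.
Proof.
intros Hrho Hf Ha Hb Hc. apply NNPP. intros Hne.
set (I := fun T => Cmod (triangle_integral f (vertex_a T) (vertex_b T) (vertex_c T))).
set (T0 := Triangle a b c (Cmod (a - b) + Cmod (b - c) + Cmod (c - a))).
assert (HI : 0 < I T0) by (apply Cmod_gt_0; exact Hne).
pose proof (Cmod_ge_0 (a - b)). pose proof (Cmod_ge_0 (b - c)). pose proof (Cmod_ge_0 (c - a)).
set (s := size T0). assert (Hs : 0 <= s) by (unfold s; simpl; lra).
(* The summand 1 makes eta * s^2 < I T0 strict, also when s = 0. *)
set (eta := (I T0 / (s * s + 1))%R).
assert (Heta : 0 < eta) by (apply Rdiv_lt_0_compat; nra).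
set (bad := fun T => triangle_in r T /\ eta * (size T * size T) < I T).
assert (Hbad0 : bad T0).
{ split; [unfold triangle_in; simpl; repeat split; auto; lra|].
  fold s. assert (E : (eta * (s * s + 1) = I T0)%R) by (unfold eta; field; nra). nra. }
assert (Hnext : forall T, bad T -> exists T', subtriangle T T' /\ bad T').
{ intros T [HT1 HT2]. apply NNPP. intros Hn.
  assert (Hle : forall T', subtriangle T T' -> I T' <= eta * (size T / 2 * (size T / 2))).
  { intros T' HT'. apply Rnot_lt_le. intros Hlt. apply Hn. exists T'. split; [exact HT'|].
    destruct (subtriangle_in r T T' HT1 HT') as [A1 [A2 _]]. split; [exact A1|].
    now rewrite A2. }
  assert (Hsum : I T <= 4 * (eta * (size T / 2 * (size T / 2)))).
  { unfold I at 1. destruct HT1 as (A1 & A2 & A3 & _).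
    rewrite (triangle_integral_split f r rho) by assumption.
    assert (B1 := Hle _ (or_introl eq_refl)).
    assert (B2 := Hle _ (or_intror (or_introl eq_refl))).
    assert (B3 := Hle _ (or_intror (or_intror (or_introl eq_refl)))).
    assert (B4 := Hle _ (or_intror (or_intror (or_intror eq_refl)))).
    unfold I in B1, B2, B3, B4. simpl in B1, B2, B3, B4.
    eapply Rle_trans; [apply Cmod_triangle|].
    eapply Rle_trans; [apply Rplus_le_compat_r, Cmod_triangle|].
    eapply Rle_trans; [apply Rplus_le_compat_r, Rplus_le_compat_r, Cmod_triangle|].
    lra. }
  nra. }
set (next := fun T => match excluded_middle_informative (bad T) with
  | left H => proj1_sig (constructive_indefinite_description _ (Hnext T H))
  | right _ => T end).
assert (Hnext' : forall T, bad T -> subtriangle T (next T) /\ bad (next T)).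
{ intros T HT. unfold next. destruct (excluded_middle_informative (bad T)) as [H'|H']; [|tauto].
  exact (proj2_sig (constructive_indefinite_description _ (Hnext T H'))). }
set (Ts := fun n => Nat.iter n next T0).
assert (HTs : forall n, bad (Ts n) /\ size (Ts n) = (s * (1/2)^n)%R).
{ induction n as [|n [IH1 IH2]].
  - split; [exact Hbad0|]. simpl. fold T0. unfold s. simpl. ring.
  - destruct (Hnext' _ IH1) as [A1 A2]. split; [exact A2|].
    destruct (subtriangle_in r _ _ (proj1 IH1) A1) as [_ [B _]].
    change (Ts (S n)) with (next (Ts n)). rewrite B, IH2. simpl. lra. }
destruct (geometric_Cauchy_limit (fun n => vertex_a (Ts n)) s Hs) as [z Hz].
{ intros n. destruct (HTs n) as [A1 A2]. rewrite <- A2.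
  destruct (Hnext' _ A1) as [B1 _].
  exact (proj2 (proj2 (subtriangle_in r _ _ (proj1 A1) B1))). }
assert (HzR : Cmod z < rho).
{ destruct (half_pow_small (2 * s) (rho - r) ltac:(lra) ltac:(lra)) as [n Hn].
  specialize (Hz n). destruct (HTs n) as [[[A1 _] _] _].
  assert (A2 := Cmod_le_minus z (vertex_a (Ts n))). rewrite Cmod_minus_sym in A2. lra. }
destruct (Hf z HzR) as [l Hl]. rewrite is_Cderive_eps in Hl.
destruct (Hl (eta / 9)%R ltac:(lra)) as [d [Hd Hd']].
destruct (half_pow_small (3 * s) d ltac:(lra) Hd) as [n Hn].
destruct (HTs n) as [[A1 A2] A3].
assert (A4 := triangle_integral_small f r rho z l (eta / 9) d (Ts n) Hrho Hf ltac:(lra) Hd' A1).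
rewrite A3 in A4. specialize (A4 (Hz n) ltac:(lra)).
fold (I (Ts n)) in A4. rewrite A3 in A2. lra.
Qed.

Lemma segment_in_disk rho a b u : Cmod a < rho -> Cmod b < rho -> 0 <= u <= 1 ->
  Cmod (segment_point a b u) < rho.
Proof.
intros Ha Hb Hu. apply Rle_lt_trans with (Rmax (Cmod a) (Cmod b)).
- apply Cmod_segment_point; [exact Hu|apply Rmax_l|apply Rmax_r].
- now apply Rmax_lub_lt.
Qed.

Lemma exists_between a b : a < b -> exists c, a < c < b.
Proof. intros H. exists ((a + b) / 2)%R. lra. Qed.

(** By Goursat's theorem the difference of the radial integrals up to y and up to
    z is the integral over the segment from z to y. *)
Theorem has_primitive rho f : holomorphic rho f ->
  forall z, Cmod z < rho -> is_Cderive (segment_integral f 0) z (f z).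
Proof.
intros Hf z Hz. rewrite is_Cderive_eps. intros eps He.
assert (Hcont : forall x, Cmod x < rho -> continuous_at f x).
{ intros x Hx. apply ex_Cderive_continuous_at. auto. }
destruct (Hcont z Hz eps He) as [d [Hd Hfd]].
destruct (exists_between _ _ Hz) as [r [Hr1 Hr2]].
exists (Rmin d (r - Cmod z)). split; [apply Rmin_pos; lra|]. intros y Hy.
assert (Hy1 := Rlt_le_trans _ _ _ Hy (Rmin_l _ _)).
assert (Hy2 := Rlt_le_trans _ _ _ Hy (Rmin_r _ _)).
assert (Hyr : Cmod y <= r) by (pose proof (Cmod_le_minus y z); lra).
assert (H0r : Cmod 0 <= r) by (rewrite Cmod_0; pose proof (Cmod_ge_0 z); lra).
assert (Hseg : forall a b, Cmod a <= r -> Cmod b <= r ->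
  forall u, 0 <= u <= 1 -> continuous_at f (segment_point a b u)).
{ intros a b Ha Hb u Hu. apply Hcont. apply segment_in_disk; auto; lra. }
assert (E := Goursat f r rho 0 z y Hr2 Hf H0r ltac:(lra) Hyr).
unfold triangle_integral in E. rewrite (segment_integral_swap f 0 y) in E by auto.
replace (segment_integral f 0 y - segment_integral f 0 z - f z * (y - z)) with
  (segment_integral f z y - segment_integral (fun _ => f z) z y).
- rewrite <- segment_integral_minus.
  + rewrite Rmult_comm. apply segment_integral_bound.
    * intros u Hu. apply ex_Cderive_continuous_at.
      destruct (Hf (segment_point z y u)) as [l Hl]. { apply segment_in_disk; auto; lra. }
      exists (l - 0). apply is_Cderive_minus; [exact Hl|apply is_Cderive_const].
    * intros u Hu. left. apply Hfd. eapply Rle_lt_trans; [|exact Hy1].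
      apply Cmod_segment_point_minus; [exact Hu| |apply Rle_refl].
      replace (z - z) with (RtoC 0) by ring. rewrite Cmod_0. apply Cmod_ge_0.
  + apply Hseg; lra.
  + intros u Hu. apply ex_Cderive_continuous_at. exists (RtoC 0). apply is_Cderive_const.
- rewrite (segment_integral_derive (fun x => f z * x) (fun _ => f z)).
  + replace (segment_integral f z y) with
      (segment_integral f 0 z + segment_integral f z y + - segment_integral f 0 y
       - segment_integral f 0 z + segment_integral f 0 y) by ring.
    rewrite E. ring.
  + intros u Hu. eapply is_Cderive_eq.
    * apply is_Cderive_mult; [apply is_Cderive_const|apply is_Cderive_id].
    * simpl. ring.
  + intros u Hu. apply ex_Cderive_continuous_at. exists (RtoC 0). apply is_Cderive_const.
Qed.

Lemma derive_segment_estimate F f a b l eps :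
  (forall u, 0 <= u <= 1 -> is_Cderive F (segment_point a b u) (f (segment_point a b u))) ->
  (forall u, 0 <= u <= 1 -> continuous_at f (segment_point a b u)) ->
  (forall u, 0 <= u <= 1 -> Cmod (f (segment_point a b u) - l) <= eps) ->
  Cmod (F b - F a - l * (b - a)) <= eps * Cmod (b - a).
Proof.
intros HF Hf Hl. rewrite <- (segment_integral_derive F f a b HF Hf).
assert (Hc : forall u, 0 <= u <= 1 -> continuous_at (fun _ => l) (segment_point a b u)).
{ intros u Hu. apply ex_Cderive_continuous_at. exists (RtoC 0). apply is_Cderive_const. }
assert (E : segment_integral (fun _ => l) a b = l * (b - a)).
{ rewrite (segment_integral_derive (fun x => l * x) (fun _ => l)); auto; [ring|].
  intros u Hu. eapply is_Cderive_eq.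
  - apply is_Cderive_mult; [apply is_Cderive_const|apply is_Cderive_id].
  - simpl. ring. }
rewrite <- E, <- segment_integral_minus by auto.
rewrite Rmult_comm. apply segment_integral_bound; [|exact Hl].
intros u Hu e He. destruct (Hf u Hu e He) as [d [Hd H]]. exists d. split; [exact Hd|].
intros y Hy. replace (f y - l - (f (segment_point a b u) - l)) with (f y - f (segment_point a b u)) by ring. auto.
Qed.

(** * Integrals depending on a complex parameter *)

(** Integrals of F(p(t) + z q(t)) g(t) as functions of z.  Three families occur: q
    runs through the unit circle and z is the radius; q = 1 and z is the centre
    of a circle; q(t) = t and z is the end of a segment.  In all of them |q| and
    |g| are at most 1. *)
Section ParameterIntegral.
Context (a b r rho : R) (p q g : R -> C).
Hypothesis Hab : a <= b.
Hypothesis Hrho : r < rho.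
Hypothesis Hp : forall t, path_continuous p t.
Hypothesis Hq : forall t, path_continuous q t.
Hypothesis Hg : forall t, path_continuous g t.
Hypothesis Hq1 : forall t, a <= t <= b -> Cmod (q t) <= 1.
Hypothesis Hg1 : forall t, a <= t <= b -> Cmod (g t) <= 1.

Definition param_point (z : C) (t : R) := p t + z * q t.

Lemma param_point_continuous z t : path_continuous (param_point z) t.
Proof.
apply path_continuous_plus; [apply Hp|]. apply path_continuous_mult; [apply path_continuous_const|apply Hq].
Qed.

Lemma param_integrable f h z : (forall x, Cmod x < rho -> continuous_at f x) ->
  (forall t, path_continuous h t) ->
  (forall t, a <= t <= b -> Cmod (param_point z t) < rho) ->
  is_CInt (fun t => f (param_point z t) * h t) a b (CInt (fun t => f (param_point z t) * h t) a b).
Proof.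
intros Hf Hh Hz. apply is_CInt_correct. intros t Ht. rewrite Rmin_left, Rmax_right in Ht by lra.
apply path_continuous_mult; [|apply Hh].
apply path_continuous_comp_at; [auto|apply param_point_continuous].
Qed.

Lemma param_point_minus y z t : param_point y t - param_point z t = (y - z) * q t.
Proof. unfold param_point. ring. Qed.

Lemma Cmod_param_point_minus y z t : a <= t <= b ->
  Cmod (param_point y t - param_point z t) <= Cmod (y - z).
Proof.
intros Ht. rewrite param_point_minus, Cmod_mult. pose proof (Hq1 t Ht). pose proof (Cmod_ge_0 (y - z)). nra.
Qed.

Lemma param_integral_continuous f z : (forall x, Cmod x < rho -> continuous_at f x) ->
  (forall t, a <= t <= b -> Cmod (param_point z t) <= r) ->
  continuous_at (fun z => CInt (fun t => f (param_point z t) * g t) a b) z.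
Proof.
intros Hf Hz eps He.
assert (He' : 0 < eps / (b - a + 1)) by (apply Rdiv_lt_0_compat; lra).
destruct (uniform_continuity r f (fun x Hx => Hf x (Rle_lt_trans _ _ _ Hx Hrho)) _ He')
  as [d [Hd H]].
exists (Rmin d (rho - r)). split; [apply Rmin_pos; lra|]. intros y Hy.
assert (Hy1 := Rlt_le_trans _ _ _ Hy (Rmin_l _ _)).
assert (Hy2 := Rlt_le_trans _ _ _ Hy (Rmin_r _ _)).
assert (HzR : forall t, a <= t <= b -> Cmod (param_point z t) < rho).
{ intros t Ht. specialize (Hz t Ht). lra. }
assert (HyR : forall t, a <= t <= b -> Cmod (param_point y t) < rho).
{ intros t Ht. specialize (Hz t Ht). pose proof (Cmod_param_point_minus y z t Ht).
  pose proof (Cmod_le_minus (param_point y t) (param_point z t)). lra. }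
apply Rle_lt_trans with ((b - a) * (eps / (b - a + 1)))%R.
- eapply is_CInt_bound; [exact Hab| |apply is_CInt_minus; apply param_integrable; auto].
  intros t Ht. simpl.
  replace (f (param_point y t) * g t - f (param_point z t) * g t) with
    ((f (param_point y t) - f (param_point z t)) * g t) by ring.
  rewrite Cmod_mult. pose proof (Hg1 t Ht).
  assert (Cmod (f (param_point y t) - f (param_point z t)) < eps / (b - a + 1)).
  { apply H; [auto|]. pose proof (Cmod_param_point_minus y z t Ht). lra. }
  pose proof (Cmod_ge_0 (f (param_point y t) - f (param_point z t))).
  pose proof (Cmod_ge_0 (g t)). nra.
- apply (Rmult_lt_reg_r (b - a + 1)); [lra|].
  replace ((b - a) * (eps / (b - a + 1)) * (b - a + 1))%R with ((b - a) * eps)%R by (field; lra). nra.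
Qed.

(** The difference quotients of F converge uniformly on the disk of radius r,
    because f is uniformly continuous there. *)
Lemma param_integral_derive F f z :
  (forall x, Cmod x < rho -> is_Cderive F x (f x)) ->
  (forall x, Cmod x < rho -> continuous_at f x) ->
  (forall t, a <= t <= b -> Cmod (param_point z t) <= r) ->
  is_Cderive (fun z => CInt (fun t => F (param_point z t) * g t) a b) z
    (CInt (fun t => f (param_point z t) * (q t * g t)) a b).
Proof.
intros HF Hf Hz. rewrite is_Cderive_eps. intros eps He.
assert (He' : 0 < eps / (b - a + 1)) by (apply Rdiv_lt_0_compat; lra).
destruct (uniform_continuity r f (fun x Hx => Hf x (Rle_lt_trans _ _ _ Hx Hrho)) _ He')
  as [d [Hd H]].
exists (Rmin d (rho - r)). split; [apply Rmin_pos; lra|]. intros y Hy.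
assert (Hy1 := Rlt_le_trans _ _ _ Hy (Rmin_l _ _)).
assert (Hy2 := Rlt_le_trans _ _ _ Hy (Rmin_r _ _)).
assert (HzR : forall t, a <= t <= b -> Cmod (param_point z t) < rho).
{ intros t Ht. specialize (Hz t Ht). lra. }
assert (HyR : forall t, a <= t <= b -> Cmod (param_point y t) < rho).
{ intros t Ht. specialize (Hz t Ht). pose proof (Cmod_param_point_minus y z t Ht).
  pose proof (Cmod_le_minus (param_point y t) (param_point z t)). lra. }
assert (HFc : forall x, Cmod x < rho -> continuous_at F x).
{ intros x Hx. apply ex_Cderive_continuous_at. exists (f x). auto. }
apply Rle_trans with ((b - a) * (eps / (b - a + 1) * Cmod (y - z)))%R.
- eapply is_CInt_bound; [exact Hab| |].
  2: { apply is_CInt_minus; [apply is_CInt_minus; apply param_integrable; auto|].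
    rewrite Cmult_comm. apply is_CInt_mult_l. apply param_integrable; auto.
    intros t. apply path_continuous_mult; auto. }
  intros t Ht. simpl.
  replace (F (param_point y t) * g t - F (param_point z t) * g t
      - (y - z) * (f (param_point z t) * (q t * g t))) with
    ((F (param_point y t) - F (param_point z t)
      - f (param_point z t) * (param_point y t - param_point z t)) * g t)
    by (rewrite param_point_minus; ring).
  rewrite Cmod_mult. pose proof (Hg1 t Ht). pose proof (Cmod_param_point_minus y z t Ht) as Hyz.
  assert (E : Cmod (F (param_point y t) - F (param_point z t)
      - f (param_point z t) * (param_point y t - param_point z t))
      <= eps / (b - a + 1) * Cmod (param_point y t - param_point z t)).
  { apply (derive_segment_estimate F f).
    - intros u Hu. apply HF. apply segment_in_disk; auto.
    - intros u Hu. apply Hf. apply segment_in_disk; auto.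
    - intros u Hu. left. apply H; [auto|]. eapply Rle_lt_trans; [|exact Hy1].
      apply Cmod_segment_point_minus; [exact Hu| |exact Hyz].
      replace (param_point z t - param_point z t) with (RtoC 0) by ring.
      rewrite Cmod_0. apply Cmod_ge_0. }
  pose proof (Cmod_ge_0 (g t)).
  pose proof (Cmod_ge_0 (F (param_point y t) - F (param_point z t)
      - f (param_point z t) * (param_point y t - param_point z t))).
  apply Rle_trans with (eps / (b - a + 1) * Cmod (param_point y t - param_point z t))%R; [nra|].
  apply Rmult_le_compat_l; lra.
- rewrite <- Rmult_assoc. apply Rmult_le_compat_r; [apply Cmod_ge_0|].
  apply (Rmult_le_reg_r (b - a + 1)); [lra|].
  replace ((b - a) * (eps / (b - a + 1)) * (b - a + 1))%R with ((b - a) * eps)%R by (field; lra). nra.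
Qed.
End ParameterIntegral.

(** * Circle integrals and the derivative of a holomorphic function *)

Definition cis (t : R) : C := (cos t, sin t).

Lemma Cmod_cis t : Cmod (cis t) = 1%R.
Proof.
unfold Cmod, cis. simpl fst. simpl snd.
replace (cos t ^ 2 + sin t ^ 2)%R with 1%R; [apply sqrt_1|].
rewrite <- (sin2_cos2 t). unfold Rsqr. ring.
Qed.

Lemma cis_neq_0 t : cis t <> 0.
Proof. apply Cmod_gt_0. rewrite Cmod_cis. lra. Qed.

Lemma is_Rderive_cis t : is_Rderive cis t (Ci * cis t).
Proof.
replace (Ci * cis t) with ((- sin t)%R, cos t)
  by (unfold Ci, cis, Cmult; simpl; f_equal; ring).
apply is_Rderive_components; simpl; auto_derive; auto; ring.
Qed.

Lemma cis_continuous t : path_continuous cis t.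
Proof. exact (is_Rderive_continuous _ _ _ (is_Rderive_cis t)). Qed.

Lemma cis_0 : cis 0 = 1.
Proof. unfold cis. now rewrite cos_0, sin_0. Qed.

Lemma cis_2PI : cis (2 * PI) = 1.
Proof. unfold cis. now rewrite cos_2PI, sin_2PI. Qed.

Lemma inv_cis_continuous t : path_continuous (fun t => / cis t) t.
Proof.
apply (path_continuous_comp Cinv cis); [|apply cis_continuous].
eexists. apply is_Cderive_inv, cis_neq_0.
Qed.

Lemma Cmod_inv_cis t : Cmod (/ cis t) = 1%R.
Proof. rewrite Cmod_inv, Cmod_cis by apply cis_neq_0. apply Rinv_1. Qed.

Lemma derive_zero_segment Q a b :
  (forall u, 0 <= u <= 1 -> is_Cderive Q (segment_point a b u) (RtoC 0)) -> Q a = Q b.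
Proof.
intros H.
assert (E := derive_segment_estimate Q (fun _ => RtoC 0) a b 0 0 H).
rewrite Rmult_0_l in E.
assert (E' : Cmod (Q b - Q a - 0 * (b - a)) <= 0).
{ apply E.
  - intros u Hu. apply ex_Cderive_continuous_at. exists (RtoC 0). apply is_Cderive_const.
  - intros u Hu. replace (RtoC 0 - 0) with (RtoC 0) by ring. rewrite Cmod_0. lra. }
assert (E2 : Q b - Q a - 0 * (b - a) = 0).
{ apply Cmod_eq_0. pose proof (Cmod_ge_0 (Q b - Q a - 0 * (b - a))). lra. }
symmetry. apply Ceq_minus. rewrite <- E2. ring.
Qed.

Lemma two_PI_pos : 0 < 2 * PI.
Proof. pose proof PI_RGT_0. lra. Qed.

(** The moment of F' = f on the circle of radius z about a is
    int F(a + z e^{it}) e^{-it} dt.  Its derivative in z is the mean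
    int f(a + z e^{it}) dt.  Integration by parts in t shows that it also equals
    z times this mean.  Hence moment(z)/z is constant along rays, and its value
    is found at z = 0. *)
Section CircleIntegrals.
Context (rho : R) (F f : C -> C) (a : C).
Hypothesis HF : forall x, Cmod x < rho -> is_Cderive F x (f x).
Hypothesis Hf : forall x, Cmod x < rho -> continuous_at f x.

Let point := param_point (fun _ => a) cis.
Let moment (z : C) : C := CInt (fun t => F (point z t) * / cis t) 0 (2 * PI).
Let mean (z : C) : C := CInt (fun t => f (point z t) * (cis t * / cis t)) 0 (2 * PI).

Lemma Cmod_circle_point z t : Cmod (point z t) <= Cmod a + Cmod z.
Proof.
unfold point, param_point. eapply Rle_trans; [apply Cmod_triangle|].
rewrite Cmod_mult, Cmod_cis. lra.
Qed.

Lemma circle_moment_derive z : Cmod a + Cmod z < rho -> is_Cderive moment z (mean z).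
Proof.
intros Hz. pose proof two_PI_pos.
apply (param_integral_derive 0 (2 * PI) (Cmod a + Cmod z) rho); auto; try lra.
- intros; apply path_continuous_const.
- apply cis_continuous.
- apply inv_cis_continuous.
- intros; rewrite Cmod_cis; lra.
- intros; rewrite Cmod_inv_cis; lra.
- intros; apply Cmod_circle_point.
Qed.

(** The integrand of i (z mean - moment) is the derivative of
    F(a + z e^{it}) / e^{it}, which takes the same value at 0 and 2 pi. *)
Lemma circle_moment_eq_mean z : Cmod a + Cmod z < rho -> moment z = z * mean z.
Proof.
intros Hz. pose proof two_PI_pos as Hpi.
assert (Hpt : forall t, Cmod (point z t) < rho).
{ intros t. eapply Rle_lt_trans; [apply Cmod_circle_point|exact Hz]. }
assert (HFc : forall x, Cmod x < rho -> continuous_at F x).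
{ intros x Hx. apply ex_Cderive_continuous_at. exists (f x). auto. }
assert (HJ : is_CInt (fun t => F (point z t) * / cis t) 0 (2 * PI) (moment z)).
{ apply (param_integrable 0 (2 * PI) rho); auto; try lra.
  - intros; apply path_continuous_const.
  - apply cis_continuous.
  - apply inv_cis_continuous. }
assert (HM : is_CInt (fun t => f (point z t) * (cis t * / cis t)) 0 (2 * PI) (mean z)).
{ apply (param_integrable 0 (2 * PI) rho); auto; try lra.
  - intros; apply path_continuous_const.
  - apply cis_continuous.
  - intros. apply path_continuous_mult; [apply cis_continuous|apply inv_cis_continuous]. }
assert (HD := is_CInt_minus _ _ _ _ _ _ (is_CInt_mult_l z _ _ _ _ HM) HJ).
assert (HE : is_CInt (fun t => (z * (f (point z t) * (cis t * / cis t)) - F (point z t) * / cis t))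
  0 (2 * PI) (F (point z (2*PI)) * / cis (2*PI) * (- Ci) - F (point z 0) * / cis 0 * (- Ci))).
{ apply (is_CInt_derive (fun t => F (point z t) * / cis t * (- Ci))).
  - intros t _.
    assert (H := is_Rderive_comp (fun w => F (a + z * w) * / w * (- Ci)) cis t
      (((f (a + z * cis t) * z) * / cis t + F (a + z * cis t) * (- / (cis t * cis t))) * (- Ci))
      (Ci * cis t)).
    match goal with |- is_Rderive _ _ ?l =>
      match type of H with _ -> _ -> is_Rderive _ _ ?l' => replace l with l' end end.
    + apply H; [|apply is_Rderive_cis]. eapply is_Cderive_eq.
      * apply is_Cderive_mult; [|apply is_Cderive_const].
        apply is_Cderive_mult; [|apply is_Cderive_inv, cis_neq_0].
        apply (is_Cderive_comp F (fun w => a + z * w)); [apply HF, Hpt|].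
        apply is_Cderive_plus; [apply is_Cderive_const|].
        apply is_Cderive_mult; [apply is_Cderive_const|apply is_Cderive_id].
      * simpl. ring.
    + unfold point, param_point. pose proof (cis_neq_0 t).
      assert (Hi : Ci * Ci = - (1)) by (unfold Ci, Cmult, Copp; simpl; unfold RtoC; f_equal; ring).
      transitivity (- (Ci * Ci) * (z * f (a + z * cis t) - F (a + z * cis t) / cis t)).
      * field. auto.
      * rewrite Hi. field. auto.
  - intros t _.
    assert (P : forall t, path_continuous (point z) t).
    { apply param_point_continuous; intros; [apply path_continuous_const|apply cis_continuous]. }
    assert (Q : forall g, (forall x, Cmod x < rho -> continuous_at g x) -> path_continuous (fun t => g (point z t)) t).
    { intros g Hg. apply path_continuous_comp_at; auto. }
    assert (N := inv_cis_continuous t).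
    apply (path_continuous_plus (fun t => z * (f (point z t) * (cis t * / cis t)))
      (fun t => - (F (point z t) * / cis t))).
    + repeat apply path_continuous_mult; auto; try apply path_continuous_const; apply cis_continuous.
    + apply (path_continuous_comp Copp (fun t => F (point z t) * / cis t)).
      * exists (0 - 1). apply (is_Cderive_ext (fun x => 0 - x)); [intros; ring|].
        apply is_Cderive_minus; [apply is_Cderive_const|apply is_Cderive_id].
      * apply path_continuous_mult; auto. }
apply CInt_unique in HD. apply CInt_unique in HE. rewrite HD in HE.
unfold point, param_point in HE. rewrite cis_0, cis_2PI in HE.
symmetry. apply Ceq_minus. rewrite HE. ring.
Qed.

Lemma circle_moment_value z : Cmod a + Cmod z < rho -> moment z = RtoC (2 * PI) * f a * z.
Proof.
intros Hz.
destruct (classic (z = 0)) as [->|Hz0].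
{ rewrite circle_moment_eq_mean by (rewrite Cmod_0 in *; lra). ring. }
assert (Hzp := proj1 (Cmod_gt_0 z) Hz0).
assert (HM0 : mean 0 = RtoC (2 * PI) * f a).
{ unfold mean. apply CInt_unique.
  replace (RtoC (2 * PI)) with (RtoC (2 * PI - 0)) by (f_equal; ring).
  eapply is_CInt_ext; [|apply is_CInt_const].
  intros t _. unfold point, param_point. rewrite Cinv_r by apply cis_neq_0.
  replace (a + 0 * cis t) with a by ring. ring. }
assert (HJ0 : moment 0 = 0) by (rewrite circle_moment_eq_mean by (rewrite Cmod_0; lra); ring).
assert (HD := circle_moment_derive 0 ltac:(rewrite Cmod_0; lra)).
rewrite is_Cderive_eps in HD. rewrite HJ0, HM0 in HD.
assert (Hray : forall s, 0 < s <= 1 -> moment (RtoC s * z) = RtoC s * moment z).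
{ intros s Hs.
  assert (Hnz : forall u, 0 <= u <= 1 -> segment_point (RtoC s * z) z u <> 0).
  { intros u Hu. unfold segment_point.
    replace (s * z + u * (z - s * z)) with (RtoC (s + u * (1 - s)) * z)
      by (rewrite RtoC_plus, RtoC_mult, RtoC_minus; ring).
    apply Cmult_neq_0; [|exact Hz0]. apply Cmod_gt_0. rewrite Cmod_R. apply Rabs_pos_lt. nra. }
  assert (E : moment (RtoC s * z) / (RtoC s * z) = moment z / z).
  { apply (derive_zero_segment (fun w => moment w / w)). intros u Hu.
    assert (Hin : Cmod a + Cmod (segment_point (RtoC s * z) z u) < rho).
    { apply Rle_lt_trans with (Cmod a + Cmod z)%R; [|exact Hz]. apply Rplus_le_compat_l.
      apply Cmod_segment_point; [exact Hu| |lra].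
      rewrite Cmod_mult, Cmod_R, Rabs_pos_eq by lra. nra. }
    eapply is_Cderive_eq.
    - apply is_Cderive_div; [auto|now apply circle_moment_derive|apply is_Cderive_id].
    - simpl. rewrite circle_moment_eq_mean by assumption. field. auto. }
  assert (Hs0 : RtoC s <> 0) by (apply Cmod_gt_0; rewrite Cmod_R; apply Rabs_pos_lt; lra).
  replace (moment (RtoC s * z)) with (moment (RtoC s * z) / (RtoC s * z) * (RtoC s * z)) by (field; auto).
  rewrite E. field. auto. }
apply Ceq_minus. apply Cmod_eq_0. apply Rle_antisym; [|apply Cmod_ge_0].
apply Rle_plus_epsilon. intros eps He. rewrite Rplus_0_l.
destruct (HD (eps / Cmod z)%R ltac:(now apply Rdiv_lt_0_compat)) as [d [Hd H]].
assert (Hsd : exists s, 0 < s <= 1 /\ s * Cmod z < d).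
{ exists (Rmin 1 (d / (2 * Cmod z))).
  assert (0 < d / (2 * Cmod z)) by (apply Rdiv_lt_0_compat; lra).
  split; [split; [apply Rmin_pos; lra|apply Rmin_l]|].
  apply Rle_lt_trans with (d / (2 * Cmod z) * Cmod z)%R.
  - apply Rmult_le_compat_r; [lra|apply Rmin_r].
  - replace (d / (2 * Cmod z) * Cmod z)%R with (d / 2)%R by (field; lra). lra. }
destruct Hsd as [s [Hs Hsd]].
assert (Hm : Cmod (RtoC s * z - 0) = (s * Cmod z)%R).
{ replace (RtoC s * z - 0) with (RtoC s * z) by ring. rewrite Cmod_mult, Cmod_R, Rabs_pos_eq by lra. ring. }
specialize (H (RtoC s * z)). rewrite Hm in H. specialize (H Hsd).
rewrite Hray in H by exact Hs.
replace (RtoC s * moment z - 0 - RtoC (2 * PI) * f a * (RtoC s * z - 0)) with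
  (RtoC s * (moment z - RtoC (2 * PI) * f a * z)) in H by ring.
rewrite Cmod_mult, Cmod_R, Rabs_pos_eq in H by lra.
replace (eps / Cmod z * (s * Cmod z))%R with (s * eps)%R in H by (field; lra).
apply (Rmult_le_reg_l s); lra.
Qed.

Lemma circle_mean_value (z : C) : z <> 0 -> Cmod a + Cmod z < rho -> mean z = RtoC (2 * PI) * f a.
Proof.
intros Hz0 Hz.
assert (E := circle_moment_value z Hz). rewrite circle_moment_eq_mean in E by exact Hz.
replace (mean z) with (z * mean z / z) by (field; auto).
rewrite E. field. auto.
Qed.

End CircleIntegrals.

Lemma holomorphic_continuous_at rho f : holomorphic rho f -> forall x, Cmod x < rho -> continuous_at f x.
Proof. intros Hf x Hx. apply ex_Cderive_continuous_at. auto. Qed.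

(** The circle integrals need a function with continuous derivative, which a
    primitive of f is. *)
Theorem mean_value_property rho f a z : holomorphic rho f -> Cmod a + Cmod z < rho ->
  is_CInt (fun t => f (a + z * cis t)) 0 (2 * PI) (RtoC (2 * PI) * f a).
Proof.
intros Hf Hz. pose proof two_PI_pos.
destruct (classic (z = 0)) as [->|Hz0].
{ replace (RtoC (2 * PI)) with (RtoC (2 * PI - 0)) by (f_equal; ring).
  eapply is_CInt_ext; [|apply is_CInt_const].
  intros t _. simpl. now replace (a + 0 * cis t) with a by ring. }
rewrite <- (circle_mean_value rho (segment_integral f 0) f a (has_primitive rho f Hf)
  (holomorphic_continuous_at rho f Hf) z Hz0 Hz).
eapply is_CInt_ext; [|apply (param_integrable 0 (2 * PI) rho)].
- intros t _. simpl. unfold param_point. rewrite Cinv_r by apply cis_neq_0. ring.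
- lra.
- intros; apply path_continuous_const.
- apply cis_continuous.
- now apply holomorphic_continuous_at.
- intros. apply path_continuous_mult; [apply cis_continuous|apply inv_cis_continuous].
- intros. eapply Rle_lt_trans; [apply Cmod_circle_point|exact Hz].
Qed.

(** Cauchy's formula for the first derivative.  The centre a occurs on the right
    only inside F, so the formula can be differentiated once more in a. *)
Lemma derivative_formula rho (F f : C -> C) : (forall x, Cmod x < rho -> is_Cderive F x (f x)) ->
  (forall x, Cmod x < rho -> continuous_at f x) ->
  forall a z : C, z <> 0 -> Cmod a + Cmod z < rho ->
  f a = / (RtoC (2 * PI) * z) *
    CInt (fun t => F (param_point (fun t => z * cis t) (fun _ => 1) a t) * / cis t) 0 (2 * PI).
Proof.
intros HF Hf a z Hz0 Hz. pose proof two_PI_pos.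
assert (E := circle_moment_value rho F f a HF Hf z Hz).
assert (E' : (fun t => F (param_point (fun t => z * cis t) (fun _ => 1) a t) * / cis t) =
  (fun t => F (param_point (fun _ => a) cis z t) * / cis t)).
{ apply FunctionalExtensionality.functional_extensionality. intros t. unfold param_point.
  do 2 f_equal. ring. }
rewrite E', E. field. split; [exact Hz0|].
apply Cmod_gt_0. rewrite Cmod_R. apply Rabs_pos_lt. lra.
Qed.

Lemma Cmod_one_le : Cmod 1 <= 1.
Proof. rewrite Cmod_1. lra. Qed.

(** Differentiate the formula for f under the integral sign. *)
Lemma derivative_C1 rho (F f : C -> C) : (forall x, Cmod x < rho -> is_Cderive F x (f x)) ->
  (forall x, Cmod x < rho -> continuous_at f x) ->
  forall a, Cmod a < rho -> ex_Cderive f a /\ continuous_at (C_derive f) a.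
Proof.
intros HF Hf a Ha. pose proof two_PI_pos.
set (r := ((rho - Cmod a) / 4)%R). assert (Hr : 0 < r) by (unfold r; lra).
assert (Hr0 : RtoC r <> 0) by (apply Cmod_gt_0; rewrite Cmod_R; apply Rabs_pos_lt; lra).
assert (Hrm : Cmod (RtoC r) = r) by (rewrite Cmod_R; apply Rabs_pos_eq; lra).
set (p := fun t => RtoC r * cis t). set (q := fun _ : R => RtoC 1).
set (K := / (RtoC (2 * PI) * RtoC r)).
set (D := fun x => K * CInt (fun t => f (param_point p q x t) * (q t * / cis t)) 0 (2 * PI)).
assert (Hpc : forall t, path_continuous p t).
{ intros t. apply path_continuous_mult; [apply path_continuous_const|apply cis_continuous]. }
assert (Hqc : forall t, path_continuous q t) by (intros; apply path_continuous_const).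
assert (Hq1 : forall t, 0 <= t <= 2 * PI -> Cmod (q t) <= 1) by (intros; apply Cmod_one_le).
assert (Hpt : forall x t, Cmod (x - a) < r -> Cmod (param_point p q x t) <= Cmod a + 2 * r).
{ intros x t Hx. unfold param_point, p, q. eapply Rle_trans; [apply Cmod_triangle|].
  rewrite !Cmod_mult, Cmod_cis, Hrm, Cmod_1. pose proof (Cmod_le_minus x a). lra. }
assert (Hder : forall x, Cmod (x - a) < r -> is_Cderive f x (D x)).
{ intros x Hx.
  apply (is_Cderive_ext_loc (fun y => K * CInt (fun t => F (param_point p q y t) * / cis t) 0 (2 * PI))
    f x _ (r - Cmod (x - a))); [lra| |].
  - intros y Hy. symmetry. apply (derivative_formula rho F f HF Hf y (RtoC r) Hr0).
    rewrite Hrm. replace y with (a + (x - a) + (y - x)) by ring.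
    assert (T1 := Cmod_triangle (a + (x - a)) (y - x)). assert (T2 := Cmod_triangle a (x - a)).
    unfold r in *. lra.
  - eapply is_Cderive_eq.
    + apply is_Cderive_mult; [apply is_Cderive_const|].
      apply (param_integral_derive 0 (2 * PI) (Cmod a + 2 * r) rho p q) with (f := f); auto; try lra.
      * unfold r; lra.
      * apply inv_cis_continuous.
      * intros; rewrite Cmod_inv_cis; lra.
    + unfold D. simpl. ring. }
assert (Haa : Cmod (a - a) < r) by (replace (a - a) with (RtoC 0) by ring; rewrite Cmod_0; lra).
split; [exists (D a); auto|].
assert (HDc : continuous_at D a).
{ assert (Hc : continuous_at (fun x => CInt (fun t => f (param_point p q x t) * (q t * / cis t)) 0 (2 * PI)) a).
  { apply (param_integral_continuous 0 (2 * PI) (Cmod a + 2 * r) rho p q); auto; try lra.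
    - unfold r; lra.
    - intros. apply path_continuous_mult; [auto|apply inv_cis_continuous].
    - intros. unfold q. rewrite Cmod_mult, Cmod_1, Cmod_inv_cis. lra. }
  intros eps He.
  destruct (Hc (eps / (Cmod K + 1))%R) as [d [Hd H']].
  { apply Rdiv_lt_0_compat; [lra|]. pose proof (Cmod_ge_0 K). lra. }
  exists d. split; [exact Hd|]. intros y Hy. specialize (H' y Hy).
  unfold D. match goal with |- Cmod (K * ?u - K * ?v) < _ =>
    replace (K * u - K * v) with (K * (u - v)) by ring end.
  rewrite Cmod_mult. pose proof (Cmod_ge_0 K).
  apply (Rmult_lt_compat_r (Cmod K + 1)) in H'; [|lra].
  replace (eps / (Cmod K + 1) * (Cmod K + 1))%R with eps in H' by (field; lra).
  match goal with |- Cmod K * Cmod ?u < _ => pose proof (Cmod_ge_0 u) end. nra. }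
intros eps He. destruct (HDc eps He) as [d [Hd H']].
exists (Rmin d r). split; [now apply Rmin_pos|]. intros y Hy.
rewrite (is_C_derive_unique f y (D y) (Hder y (Rlt_le_trans _ _ _ Hy (Rmin_r _ _)))),
  (is_C_derive_unique f a (D a) (Hder a Haa)).
apply H'. eapply Rlt_le_trans; [exact Hy|apply Rmin_l].
Qed.

(** The previous lemma is used twice: for a primitive of f it shows that f' is
    continuous, and then for f itself it shows that f' is differentiable. *)
Theorem holomorphic_C_derive rho f : holomorphic rho f -> holomorphic rho (C_derive f).
Proof.
intros Hf a Ha.
assert (H1 := derivative_C1 rho _ f (has_primitive rho f Hf) (holomorphic_continuous_at rho f Hf)).
apply (derivative_C1 rho f (C_derive f)); [| |exact Ha].
- intros x Hx. apply ex_Cderive_C_derive. auto.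
- intros x Hx. apply H1, Hx.
Qed.

(** * Divided differences *)

(** The average of g' over the segment from c to y: it is (g(y) - g(c))/(y - c) for
    y different from c, and holomorphic in y without exception. *)
Definition divided_difference (g : C -> C) (c y : C) : C :=
  CInt (fun t => C_derive g (segment_point c y t)) 0 1.

Lemma divided_difference_spec rho g c y : holomorphic rho g -> Cmod c < rho -> Cmod y < rho ->
  g y = g c + (y - c) * divided_difference g c y.
Proof.
intros Hg Hc Hy.
assert (E : segment_integral (C_derive g) c y = g y - g c).
{ apply segment_integral_derive; intros u Hu.
  - apply ex_Cderive_C_derive, Hg. now apply segment_in_disk.
  - apply (holomorphic_continuous_at rho); [now apply holomorphic_C_derive|now apply segment_in_disk]. }
unfold segment_integral in E. fold (divided_difference g c y) in E. rewrite E. ring.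
Qed.

Lemma divided_difference_diag g c : divided_difference g c c = C_derive g c.
Proof.
unfold divided_difference. apply CInt_unique.
replace (C_derive g c) with (RtoC (1 - 0) * C_derive g c) by (rewrite Rminus_0_r; ring).
eapply is_CInt_ext; [|apply is_CInt_const]. intros t _. simpl. f_equal.
unfold segment_point. ring.
Qed.

Lemma holomorphic_divided_difference rho g c : holomorphic rho g -> Cmod c < rho ->
  holomorphic rho (divided_difference g c).
Proof.
intros Hg Hc y Hy.
set (p := fun t : R => RtoC (1 - t) * c). set (q := fun t : R => RtoC t).
destruct (exists_between (Rmax (Cmod c) (Cmod y)) rho) as [r [Hr1 Hr2]]; [now apply Rmax_lub_lt|].
assert (Hpt : forall z t, param_point p q z t = segment_point c z t).
{ intros z t. unfold param_point, p, q, segment_point. rewrite RtoC_minus. ring. }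
assert (Hqc : forall t, path_continuous q t).
{ intros t. apply path_continuous_RtoC. apply continuous_id. }
assert (Hpc : forall t, path_continuous p t).
{ intros t. apply path_continuous_mult; [|apply path_continuous_const].
  apply path_continuous_RtoC. apply (ex_derive_continuous (K:=R_AbsRing) (V:=R_NormedModule)).
  auto_derive. auto. }
eexists.
apply (is_Cderive_ext (fun z => CInt (fun t => C_derive g (param_point p q z t) * 1) 0 1)).
- intros z. unfold divided_difference. apply (@RInt_ext C_R_CompleteNormedModule).
  intros t _. rewrite Hpt. apply Cmult_1_r.
- apply (param_integral_derive 0 1 r rho p q) with (f := C_derive (C_derive g)); auto.
  + lra.
  + intros; apply path_continuous_const.
  + intros t Ht. unfold q. rewrite Cmod_R, Rabs_pos_eq; lra.
  + intros; apply Cmod_one_le.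
  + intros x Hx. apply ex_Cderive_C_derive. now apply (holomorphic_C_derive rho).
  + apply holomorphic_continuous_at. now apply holomorphic_C_derive, holomorphic_C_derive.
  + intros t Ht. rewrite Hpt. apply Cmod_segment_point; auto;
    pose proof (Rmax_l (Cmod c) (Cmod y)); pose proof (Rmax_r (Cmod c) (Cmod y)); lra.
Qed.

(** * The maximum principle and Schwarz's lemma *)

Lemma ex_Cderive_mult_l c f z : ex_Cderive f z -> ex_Cderive (fun x => c * f x) z.
Proof.
intros [l Hl]. eexists. apply is_Cderive_mult; [apply is_Cderive_const|exact Hl].
Qed.

Lemma Re_le_Cmod z : Re z <= Cmod z.
Proof. eapply Rle_trans; [apply Rle_abs|apply re_le_Cmod]. Qed.

Lemma Cmod_sqr_Re_Im z : (Cmod z * Cmod z = Re z * Re z + Im z * Im z)%R.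
Proof. pose proof (Cmod2_alt z) as H. simpl in H. lra. Qed.

Lemma closed_disk_extreme r V : 0 <= r ->
  (forall z, Cmod z <= r -> forall eps, 0 < eps ->
    exists d, 0 < d /\ forall y, Cmod (y - z) < d -> Rabs (V y - V z) < eps) ->
  exists m, Cmod m <= r /\ forall z, Cmod z <= r -> V z <= V m.
Proof.
intros Hr HV. apply (extreme_value (closed_disk r) r V 0).
- apply closed_closed_disk.
- auto.
- unfold closed_disk. now rewrite Cmod_0.
- intros z Hz eps He. destruct (HV z Hz eps He) as [d [Hd H]]. exists d. auto.
Qed.

(** Add eps |z|^2 to the real part, with eps so small that the boundary still
    cannot compete with z0.  At a maximum m of the sum, inside the disk, the
    holomorphic function G(z) = g(z) + 2 eps conj(m) z satisfies
    Re G <= Re G(m) - eps s^2 on the circle of radius s about m.  This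
    contradicts the mean value property. *)
Theorem maximum_principle_Re r (g : C -> C) M :
  (forall z, Cmod z <= r -> ex_Cderive g z) ->
  (forall z, Cmod z = r -> Re (g z) <= M) ->
  forall z, Cmod z <= r -> Re (g z) <= M.
Proof.
intros Hg HM z0 Hz0. apply Rnot_lt_le. intros Hlt.
assert (Hz0r : Cmod z0 < r).
{ destruct (Rle_lt_or_eq_dec _ _ Hz0) as [H|H]; [exact H|]. specialize (HM z0 H). lra. }
assert (Hr : 0 < r) by (pose proof (Cmod_ge_0 z0); lra).
set (eps := ((Re (g z0) - M) / (2 * (r * r)))%R).
assert (Heps : 0 < eps) by (apply Rdiv_lt_0_compat; nra).
assert (Hepsr : (eps * (r * r) = (Re (g z0) - M) / 2)%R) by (unfold eps; field; lra).
set (V := fun z : C => (Re (g z) + eps * (Cmod z * Cmod z))%R).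
destruct (closed_disk_extreme r V) as [m [Hm HVm]]; [lra| |].
{ intros z Hz e He.
  destruct (ex_Cderive_continuous_at g z (Hg z Hz) (e / 2)%R ltac:(lra)) as [d [Hd H]].
  assert (He2 : 0 < e / (2 * (eps * (2 * r + 1)))) by (apply Rdiv_lt_0_compat; nra).
  exists (Rmin d (Rmin 1 (e / (2 * (eps * (2 * r + 1)))))).
  split; [repeat apply Rmin_pos; lra|]. intros y Hy.
  assert (Hy1 := Rlt_le_trans _ _ _ Hy (Rmin_l _ _)).
  assert (Hy2 := Rlt_le_trans _ _ _ (Rlt_le_trans _ _ _ Hy (Rmin_r _ _)) (Rmin_l _ _)).
  assert (Hy3 := Rlt_le_trans _ _ _ (Rlt_le_trans _ _ _ Hy (Rmin_r _ _)) (Rmin_r _ _)).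
  unfold V.
  replace (Re (g y) + eps * (Cmod y * Cmod y) - (Re (g z) + eps * (Cmod z * Cmod z)))%R with
    (Re (g y - g z) + eps * ((Cmod y - Cmod z) * (Cmod y + Cmod z)))%R by (simpl; unfold Re; ring).
  eapply Rle_lt_trans; [apply Rabs_triang|].
  assert (A1 : Rabs (Re (g y - g z)) < e / 2) by (eapply Rle_lt_trans; [apply re_le_Cmod|auto]).
  assert (A2 : Rabs (Cmod y - Cmod z) <= Cmod (y - z)).
  { apply Rabs_le. pose proof (Cmod_le_minus y z). pose proof (Cmod_le_minus z y) as E.
    rewrite (Cmod_minus_sym z y) in E. lra. }
  assert (A3 : Rabs (Cmod y + Cmod z) <= 2 * r + 1).
  { rewrite Rabs_pos_eq by (pose proof (Cmod_ge_0 y); pose proof (Cmod_ge_0 z); lra).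
    pose proof (Cmod_le_minus y z). lra. }
  rewrite !Rabs_mult, (Rabs_pos_eq eps) by lra.
  assert (A4 : Rabs (Cmod y - Cmod z) * Rabs (Cmod y + Cmod z) <= Cmod (y - z) * (2 * r + 1)).
  { apply Rmult_le_compat; auto; apply Rabs_pos. }
  assert (A5 : eps * (Cmod (y - z) * (2 * r + 1)) < e / 2).
  { apply Rlt_le_trans with (eps * (e / (2 * (eps * (2 * r + 1))) * (2 * r + 1)))%R.
    - apply Rmult_lt_compat_l; [lra|]. apply Rmult_lt_compat_r; lra.
    - right. field. lra. }
  assert (eps * (Rabs (Cmod y - Cmod z) * Rabs (Cmod y + Cmod z)) <= eps * (Cmod (y - z) * (2 * r + 1)))
    by (apply Rmult_le_compat_l; lra).
  lra. }
assert (Hmr : Cmod m < r).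
{ destruct (Rle_lt_or_eq_dec _ _ Hm) as [H|H]; [exact H|]. specialize (HM m H).
  specialize (HVm z0 Hz0). unfold V in HVm. rewrite H in HVm.
  pose proof (Cmod_ge_0 z0). nra. }
set (s := ((r - Cmod m) / 2)%R). assert (Hs : 0 < s) by (unfold s; lra).
assert (Hsm : Cmod (RtoC s) = s) by (rewrite Cmod_R; apply Rabs_pos_eq; lra).
set (G := fun z : C => g z + RtoC (2 * eps) * Cconj m * z).
assert (HG : holomorphic r G).
{ intros z Hz. destruct (Hg z (Rlt_le _ _ Hz)) as [l Hl]. eexists.
  apply is_Cderive_plus; [exact Hl|].
  apply is_Cderive_mult; [apply is_Cderive_const|apply is_Cderive_id]. }
assert (Hmean := mean_value_property r G m s HG ltac:(rewrite Hsm; unfold s; lra)).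
apply is_CInt_components in Hmean. destruct Hmean as [Hmean _].
assert (Hle : forall t, Re (G (m + s * cis t)) <= Re (G m) - eps * (s * s)).
{ intros t. set (w := s * cis t).
  assert (Hw : Cmod w = s) by (unfold w; rewrite Cmod_mult, Cmod_cis, Hsm; ring).
  assert (Hmw : Cmod (m + w) <= r) by (pose proof (Cmod_triangle m w); unfold s in *; lra).
  specialize (HVm _ Hmw). unfold V in HVm. rewrite !Cmod_sqr_Re_Im in HVm.
  assert (Hw2 := Cmod_sqr_Re_Im w). rewrite Hw in Hw2.
  replace (Re (G (m + w))) with (Re (g (m + w)%C) + 2 * eps * (Re m * (Re m + Re w) + Im m * (Im m + Im w)))%R
    by (unfold G; simpl; unfold Re, Im; ring).
  replace (Re (G m)) with (Re (g m) + 2 * eps * (Re m * Re m + Im m * Im m))%R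
    by (unfold G; simpl; unfold Re, Im; ring).
  replace (Re (m + w)) with (Re m + Re w)%R in HVm by reflexivity.
  replace (Im (m + w)) with (Im m + Im w)%R in HVm by reflexivity.
  rewrite Hw2. nra. }
pose proof two_PI_pos as Hpi.
assert (Hfin := is_RInt_le _ _ 0 (2 * PI) _ _ ltac:(lra) Hmean
  (is_RInt_const 0 (2 * PI) (Re (G m) - eps * (s * s))%R) (fun t _ => Hle t)).
rewrite re_scal_l in Hfin. unfold scal in Hfin. simpl in Hfin. unfold mult in Hfin. simpl in Hfin.
assert (0 < eps * (s * s)) by (apply Rmult_lt_0_compat; nra). nra.
Qed.

(** Rotate g so that g(a) becomes positive. *)
Theorem maximum_principle r (g : C -> C) M :
  (forall z, Cmod z <= r -> ex_Cderive g z) ->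
  (forall z, Cmod z = r -> Cmod (g z) <= M) ->
  forall z, Cmod z <= r -> Cmod (g z) <= M.
Proof.
intros Hg HM a Ha.
destruct (classic (g a = 0)) as [E|Hne].
{ rewrite E, Cmod_0.
  assert (Hr : 0 <= r) by (pose proof (Cmod_ge_0 a); lra).
  specialize (HM (RtoC r)). rewrite Cmod_R, Rabs_pos_eq in HM by exact Hr.
  pose proof (Cmod_ge_0 (g r)). specialize (HM eq_refl). lra. }
assert (Hp := proj1 (Cmod_gt_0 _) Hne).
set (c := RtoC (/ Cmod (g a)) * Cconj (g a)).
assert (Hc : Cmod c = 1%R).
{ unfold c. rewrite Cmod_mult, Cmod_conj, Cmod_R, Rabs_pos_eq.
  - field. lra.
  - left. now apply Rinv_0_lt_compat. }
assert (E : Re (c * g a) = Cmod (g a)).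
{ unfold c. rewrite <- Cmult_assoc, re_scal_l.
  replace (Re (Cconj (g a) * g a)) with (Cmod (g a) * Cmod (g a))%R
    by (rewrite Cmod_sqr_Re_Im; simpl; unfold Re, Im; ring).
  field. lra. }
rewrite <- E. apply (maximum_principle_Re r (fun z => c * g z)); [| |exact Ha].
- intros z Hz. apply ex_Cderive_mult_l. auto.
- intros z Hz. eapply Rle_trans; [apply Re_le_Cmod|]. rewrite Cmod_mult, Hc, Rmult_1_l. auto.
Qed.

(** A step in the direction conj(l) increases the real part at rate |l|^2. *)
Lemma local_max_Re_derive_0 (g : C -> C) (z l : C) d : 0 < d -> is_Cderive g z l ->
  (forall y, Cmod (y - z) < d -> Re (g y) <= Re (g z)) -> l = 0.
Proof.
intros Hd Hl Hmax. apply NNPP. intros Hne.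
assert (Hp := proj1 (Cmod_gt_0 _) Hne).
rewrite is_Cderive_eps in Hl.
destruct (Hl (Cmod l / 2)%R ltac:(lra)) as [d' [Hd' H]].
set (m := Rmin d d'). assert (Hm : 0 < m) by (now apply Rmin_pos).
set (s := (m / (2 * Cmod l))%R). assert (Hs : 0 < s) by (apply Rdiv_lt_0_compat; lra).
set (y := z + RtoC s * Cconj l).
assert (Hyz : y - z = RtoC s * Cconj l) by (unfold y; ring).
assert (Hyzm : Cmod (y - z) = (s * Cmod l)%R).
{ rewrite Hyz, Cmod_mult, Cmod_conj, Cmod_R, Rabs_pos_eq; lra. }
assert (Hsl : (s * Cmod l = m / 2)%R) by (unfold s; field; lra).
assert (Hym : Cmod (y - z) < m) by (rewrite Hyzm; lra).
specialize (Hmax y (Rlt_le_trans _ _ _ Hym (Rmin_l _ _))).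
specialize (H y (Rlt_le_trans _ _ _ Hym (Rmin_r _ _))).
assert (A := re_le_Cmod (g y - g z - l * (y - z))).
assert (E : Re (g y - g z - l * (y - z)) = (Re (g y) - Re (g z) - s * (Cmod l * Cmod l))%R).
{ rewrite Hyz, Cmod_sqr_Re_Im. simpl. unfold Re, Im. ring. }
rewrite E in A. apply Rabs_le_between in A. nra.
Qed.

(** The maximum principle for f(z)/z on the disks of radius r < rho, and then r
    tends to rho. *)
Theorem Schwarz_lemma rho (f : C -> C) M : holomorphic rho f -> f 0 = 0 ->
  (forall z, Cmod z < rho -> Cmod (f z) <= M) ->
  forall z, Cmod z < rho -> Cmod (f z) * rho <= M * Cmod z.
Proof.
intros Hf H0 HM z Hz.
assert (Hrho : 0 < rho) by (pose proof (Cmod_ge_0 z); lra).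
assert (Hz0 : Cmod 0 < rho) by (now rewrite Cmod_0).
assert (HMp : 0 <= M) by (eapply Rle_trans; [apply Cmod_ge_0|apply (HM z Hz)]).
assert (Hspec : forall y, Cmod y < rho -> f y = y * divided_difference f 0 y).
{ intros y Hy. rewrite (divided_difference_spec rho f 0 y) at 1 by auto. rewrite H0. ring. }
assert (Hr : forall r, Cmod z < r < rho -> Cmod (f z) * r <= M * Cmod z).
{ intros r Hr. pose proof (Cmod_ge_0 z).
  assert (E : Cmod (divided_difference f 0 z) <= M / r).
  { apply (maximum_principle r); [| |lra].
    - intros y Hy. apply (holomorphic_divided_difference rho); auto. lra.
    - intros y Hy. assert (E := HM y ltac:(lra)). rewrite Hspec in E by lra.
      rewrite Cmod_mult, Hy in E. apply Rle_div_r; lra. }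
  rewrite Hspec by exact Hz. rewrite Cmod_mult.
  apply Rle_div_r in E; [|lra]. nra. }
apply Rnot_lt_le. intros Hlt. pose proof (Cmod_ge_0 (f z)).
destruct (Rle_lt_or_eq_dec _ _ H) as [Hfz|Hfz].
- assert (M * Cmod z / Cmod (f z) < rho) by (apply Rlt_div_l; lra).
  destruct (exists_between (Rmax (Cmod z) (M * Cmod z / Cmod (f z))) rho) as [r [Hr1 Hr2]];
    [now apply Rmax_lub_lt|].
  assert (Cmod z < r) by (eapply Rle_lt_trans; [apply Rmax_l|exact Hr1]).
  assert (A : M * Cmod z / Cmod (f z) < r) by (eapply Rle_lt_trans; [apply Rmax_r|exact Hr1]).
  apply Rlt_div_l in A; [|lra]. specialize (Hr r ltac:(lra)). lra.
- rewrite <- Hfz in Hlt. pose proof (Cmod_ge_0 z). nra.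
Qed.

(** * Jack's lemma *)

Lemma Cmod_1_minus_le (e : C) t : Re e = 1%R ->
  Cmod (1 - RtoC t * e) <= 1 - t + t * t * (Cmod e * Cmod e) / 2.
Proof.
intros He. set (x := Cmod (1 - RtoC t * e)). assert (Hx : 0 <= x) by apply Cmod_ge_0.
assert (E : (x * x = 1 - 2 * t + t * t * (Cmod e * Cmod e))%R).
{ unfold x. rewrite !Cmod_sqr_Re_Im. rewrite He.
  replace (Re (1 - RtoC t * e)) with (1 - t * Re e)%R by (simpl; unfold Re; ring).
  replace (Im (1 - RtoC t * e)) with (- (t * Im e))%R by (simpl; unfold Im; ring).
  rewrite He. ring. }
pose proof (Rle_0_sqr (x - 1)) as Hs. unfold Rsqr in Hs. nra.
Qed.

(** Moving from 1 into the disk in the direction -(1 + iX) shows that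
    Re (q (1 + iX)) >= 1, for every real X.  This is possible for all X only if
    q is real. *)
Lemma boundary_Schwarz_derivative (phi : C -> C) (q : C) :
  is_Cderive phi (RtoC 1) q -> phi 1 = 1 ->
  (forall s, Cmod s <= 1 -> Cmod (phi s) <= Cmod s) ->
  Im q = 0%R /\ 1 <= Re q.
Proof.
intros Hq H1 Hle. rewrite is_Cderive_eps in Hq.
assert (Hmain : forall X : R, 1 <= Re q - X * Im q).
{ intros X. set (e := (1%R, X) : C). set (m := Cmod e).
  assert (Hm : 1 <= m).
  { pose proof (re_le_Cmod e) as H. change (Re e) with 1%R in H. rewrite Rabs_R1 in H. exact H. }
  apply Rle_plus_epsilon. intros eps He.
  assert (He' : 0 < eps / (2 * m)) by (apply Rdiv_lt_0_compat; lra).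
  destruct (Hq _ He') as [d [Hd H]].
  assert (Ha : 0 < d / (2 * m)) by (apply Rdiv_lt_0_compat; lra).
  assert (Hb : 0 < / (m * m)) by (apply Rinv_0_lt_compat; nra).
  set (t := Rmin (d / (2 * m)) (Rmin (/ (m * m)) (eps * / (m * m)))).
  assert (Ht : 0 < t) by (repeat apply Rmin_pos; auto; apply Rmult_lt_0_compat; auto).
  assert (Ht1 : t <= d / (2 * m)) by apply Rmin_l.
  assert (Ht2 : t <= / (m * m)) by (eapply Rle_trans; [apply Rmin_r|apply Rmin_l]).
  assert (Ht3 : t <= eps * / (m * m)) by (eapply Rle_trans; [apply Rmin_r|apply Rmin_r]).
  assert (Hmm : (/ (m * m) * (m * m) = 1)%R) by (field; lra).
  assert (Ht2' : t * (m * m) <= 1) by (rewrite <- Hmm; apply Rmult_le_compat_r; nra).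
  assert (Ht3' : t * (m * m) <= eps).
  { replace eps with (eps * / (m * m) * (m * m))%R by (rewrite Rmult_assoc, Hmm; ring).
    apply Rmult_le_compat_r; nra. }
  assert (Ht1' : t * m < d).
  { apply Rle_lt_trans with (d / (2 * m) * m)%R; [apply Rmult_le_compat_r; lra|].
    replace (d / (2 * m) * m)%R with (d / 2)%R by (field; lra). lra. }
  set (y := 1 - RtoC t * e).
  assert (Hy : y - 1 = - (RtoC t * e)) by (unfold y; ring).
  assert (Hym : Cmod (y - 1) = (t * m)%R).
  { rewrite Hy, Cmod_opp, Cmod_mult, Cmod_R, Rabs_pos_eq; [reflexivity|lra]. }
  specialize (H y). rewrite Hym in H. specialize (H Ht1').
  assert (Hy2 := Cmod_1_minus_le e t eq_refl). fold y m in Hy2.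
  assert (Hy1 : Cmod y <= 1) by nra.
  specialize (Hle y Hy1).
  assert (A := re_le_Cmod (phi y - phi 1 - q * (y - 1))). apply Rabs_le_between in A.
  rewrite H1, Hy in A, H.
  replace (Re (phi y - 1 - q * - (RtoC t * e))) with (Re (phi y) - 1 + t * (Re q - X * Im q))%R in A
    by (unfold e; simpl; unfold Re, Im; ring).
  pose proof (Re_le_Cmod (phi y)).
  replace (eps / (2 * m) * (t * m))%R with (eps / 2 * t)%R in H by (field; lra).
  assert (t * 1 <= t * (Re q - X * Im q + eps)) by nra.
  apply (Rmult_le_reg_l t); lra. }
assert (H0 := Hmain 0%R).
split; [|lra].
(* This X makes the two terms of Re q - X Im q cancel. *)
assert (Hp := Hmain (Re q / Im q)%R). apply NNPP. intros Hne.
replace (Re q - Re q / Im q * Im q)%R with 0%R in Hp by (field; auto). lra.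
Qed.

(** By Schwarz's lemma, s |-> v(s z0)/v(z0) is bounded by |s| on the unit disk.  It
    has the value 1 at s = 1, and the derivative z0 v'(z0)/v(z0) there. *)
Theorem Jack_lemma rho (v : C -> C) (z0 : C) : holomorphic rho v -> v 0 = 0 ->
  Cmod z0 < rho -> v z0 <> 0 ->
  (forall z, Cmod z <= Cmod z0 -> Cmod (v z) <= Cmod (v z0)) ->
  exists m : R, 1 <= m /\ z0 * C_derive v z0 = RtoC m * v z0.
Proof.
intros Hv Hv0 Hz0 Hvz0 Hmax.
assert (Hz0' : z0 <> 0) by (intros E; apply Hvz0; rewrite E; exact Hv0).
assert (Hr := proj1 (Cmod_gt_0 _) Hz0').
assert (HM := proj1 (Cmod_gt_0 _) Hvz0).
assert (HS : forall z, Cmod z < Cmod z0 -> Cmod (v z) * Cmod z0 <= Cmod (v z0) * Cmod z).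
{ apply (Schwarz_lemma (Cmod z0)).
  - intros z Hz. apply Hv. lra.
  - exact Hv0.
  - intros z Hz. apply Hmax. lra. }
set (q := z0 * C_derive v z0 / v z0).
assert (Hq : is_Cderive (fun s => v (s * z0) / v z0) (RtoC 1) q).
{ eapply is_Cderive_eq.
  - apply is_Cderive_mult; [|apply is_Cderive_const].
    apply (is_Cderive_comp v (fun s => s * z0)).
    + rewrite Cmult_1_l. apply ex_Cderive_C_derive, Hv, Hz0.
    + apply is_Cderive_mult; [apply is_Cderive_id|apply is_Cderive_const].
  - unfold q. simpl. field. auto. }
destruct (boundary_Schwarz_derivative _ q Hq) as [Q1 Q2].
- rewrite Cmult_1_l. field. auto.
- intros s Hs. rewrite Cmod_div by auto.
  apply Rle_div_l; [lra|].
  destruct (Rle_lt_or_eq_dec _ _ Hs) as [Hs1|Hs1].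
  + assert (H := HS (s * z0)). rewrite Cmod_mult in H.
    specialize (H ltac:(nra)). apply (Rmult_le_reg_r (Cmod z0)); nra.
  + rewrite Hs1, Rmult_1_l. apply Hmax. rewrite Cmod_mult, Hs1. lra.
- exists (Re q). split; [exact Q2|].
  replace (RtoC (Re q)) with q.
  + unfold q. field. auto.
  + destruct q as [q1 q2]. simpl in Q1. unfold RtoC. simpl. now rewrite Q1.
Qed.

(** * The identity theorem and local openness *)

(** The function vanishes near 0, so it can be divided by z without end, and each
    division improves the bound of Schwarz's lemma by a factor |z|/r. *)
Theorem identity_theorem rho (f : C -> C) (d : R) : holomorphic rho f -> 0 < d ->
  (forall z, Cmod z < d -> Cmod z < rho -> f z = 0) ->
  forall z, Cmod z < rho -> f z = 0.
Proof.
intros Hf Hd H0 z Hz. apply Cmod_eq_0.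
assert (Hz00 : Cmod 0 = 0%R) by apply Cmod_0.
destruct (exists_between _ _ Hz) as [r [Hr1 Hr2]]. pose proof (Cmod_ge_0 z) as Hzp.
assert (Hpow : forall n (g : C -> C) M, holomorphic rho g ->
  (forall z, Cmod z < d -> Cmod z < rho -> g z = 0) ->
  (forall z, Cmod z < r -> Cmod (g z) <= M) ->
  forall z, Cmod z < r -> Cmod (g z) * r ^ n <= M * Cmod z ^ n).
{ induction n as [|n IH]; intros g M Hg Hg0 HM y Hy.
  - simpl. rewrite !Rmult_1_r. auto.
  - assert (Hg00 : g 0 = 0) by (apply Hg0; rewrite Hz00; lra).
    set (k := divided_difference g 0).
    assert (Hk : holomorphic rho k) by (apply holomorphic_divided_difference; [exact Hg|rewrite Hz00; lra]).
    assert (Hgk : forall x, Cmod x < rho -> g x = x * k x).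
    { intros x Hx. rewrite (divided_difference_spec rho g 0 x) by (rewrite ?Hz00; auto; lra).
      rewrite Hg00. unfold k. ring. }
    (* At 0 the quotient k = g/z is known only as g'(0). *)
    assert (Hk00 : k 0 = 0).
    { unfold k. rewrite divided_difference_diag. apply is_C_derive_unique.
      apply (is_Cderive_ext_loc (fun _ => RtoC 0) g 0 _ (Rmin d rho)).
      - apply Rmin_pos; lra.
      - intros x Hx. replace (x - 0) with x in Hx by ring. symmetry. apply Hg0.
        + eapply Rlt_le_trans; [exact Hx|apply Rmin_l].
        + eapply Rlt_le_trans; [exact Hx|apply Rmin_r].
      - apply is_Cderive_const. }
    assert (HMp : 0 <= M) by (eapply Rle_trans; [apply Cmod_ge_0|apply (HM 0); rewrite Hz00; lra]).
    assert (Hk0 : forall x, Cmod x < d -> Cmod x < rho -> k x = 0).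
    { intros x Hx1 Hx2. destruct (classic (x = 0)) as [->|Hx0]; [exact Hk00|].
      replace (k x) with (x * k x / x) by (field; auto).
      rewrite <- Hgk, Hg0 by auto. unfold Cdiv. ring. }
    assert (HkM : forall x, Cmod x < r -> Cmod (k x) <= M / r).
    { intros x Hx. apply Rle_div_r; [lra|].
      destruct (classic (x = 0)) as [->|Hx0]; [rewrite Hk00, Cmod_0; lra|].
      assert (Hxp := proj1 (Cmod_gt_0 _) Hx0).
      assert (E := Schwarz_lemma r g M (fun u Hu => Hg u (Rlt_trans _ _ _ Hu Hr2)) Hg00 HM x Hx).
      rewrite Hgk, Cmod_mult in E by lra. apply (Rmult_le_reg_l (Cmod x)); lra. }
    assert (E := IH k (M / r)%R Hk Hk0 HkM y Hy).
    rewrite Hgk, Cmod_mult by lra. simpl.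
    replace (M * (Cmod y * Cmod y ^ n))%R with (Cmod y * r * (M / r * Cmod y ^ n))%R by (field; lra).
    replace (Cmod y * Cmod (k y) * (r * r ^ n))%R with (Cmod y * r * (Cmod (k y) * r ^ n))%R by ring.
    apply Rmult_le_compat_l; [|exact E]. apply Rmult_le_pos; [apply Cmod_ge_0|lra]. }
assert (HB : exists M, 0 <= M /\ forall z, Cmod z < r -> Cmod (f z) <= M).
{ destruct (closed_disk_extreme r (fun z => Cmod (f z))) as [m [Hm HVm]]; [lra| |].
  - intros x Hx eps He.
    destruct (holomorphic_continuous_at rho f Hf x ltac:(lra) eps He) as [d' [Hd' H]].
    exists d'. split; [exact Hd'|]. intros y Hy. eapply Rle_lt_trans; [|apply (H y Hy)].
    apply Rabs_le. pose proof (Cmod_le_minus (f y) (f x)). pose proof (Cmod_le_minus (f x) (f y)) as E.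
    rewrite (Cmod_minus_sym (f x)) in E. lra.
  - exists (Cmod (f m)). split; [apply Cmod_ge_0|]. intros y Hy. apply HVm. lra. }
destruct HB as [M [HM0 HM]].
assert (Hq : Rabs (Cmod z / r) < 1).
{ rewrite Rabs_pos_eq by (apply Rdiv_le_0_compat; lra). apply Rlt_div_l; lra. }
apply Rle_antisym; [|apply Cmod_ge_0]. apply Rle_plus_epsilon. intros eps He.
destruct (pow_lt_1_zero _ Hq (eps / (M + 1))%R ltac:(apply Rdiv_lt_0_compat; lra)) as [N HN].
specialize (HN N (le_n N)).
assert (Hp0 : 0 <= (Cmod z / r) ^ N) by (apply pow_le, Rdiv_le_0_compat; lra).
rewrite Rabs_pos_eq in HN by exact Hp0.
assert (E := Hpow N f M Hf H0 HM z Hr1).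
assert (Hrn : 0 < r ^ N) by (apply pow_lt; lra).
assert (E2 : Cmod (f z) <= M * (Cmod z / r) ^ N).
{ apply (Rmult_le_reg_r (r ^ N)); [exact Hrn|].
  replace (M * (Cmod z / r) ^ N * r ^ N)%R with (M * Cmod z ^ N)%R; [exact E|].
  rewrite Rmult_assoc, <- Rpow_mult_distr. do 2 f_equal. field. lra. }
apply (Rmult_lt_compat_r (M + 1)) in HN; [|lra].
replace (eps / (M + 1) * (M + 1))%R with eps in HN by (field; lra). nra.
Qed.

(** For b near k(a) the minimum of |k - b| on a small disk about a is attained
    inside.  If it were not zero, at m say, the function (k(m) - b)/(k - b)
    would have a local maximum of the real part at m, and k'(m) would vanish. *)
Theorem local_open_mapping (k : C -> C) (a : C) (d : R) : 0 < d ->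
  (forall y, Cmod (y - a) < d -> exists l : C, l <> 0 /\ is_Cderive k y l) ->
  exists e, 0 < e /\ forall b, Cmod (b - k a) < e -> exists y, Cmod (y - a) < d /\ k y = b.
Proof.
intros Hd Hk.
assert (Haa : a - a = 0) by ring.
destruct (Hk a) as [l [Hl0 Hl]]; [rewrite Haa, Cmod_0; exact Hd|].
assert (Hlp := proj1 (Cmod_gt_0 _) Hl0).
rewrite is_Cderive_eps in Hl.
destruct (Hl (Cmod l / 2)%R ltac:(lra)) as [d1 [Hd1 H1]].
(* On the circle of radius r about a, |k - k(a)| is at least |l| r / 2, which
   leaves room for a minimum inside as long as |b - k(a)| < |l| r / 4. *)
set (r := (Rmin d d1 / 2)%R).
assert (Hrm : 0 < Rmin d d1) by (now apply Rmin_pos).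
pose proof (Rmin_l d d1). pose proof (Rmin_r d d1).
assert (Hr : 0 < r) by (unfold r; lra).
assert (Hbd : forall y, Cmod (y - a) = r -> Cmod l / 2 * r <= Cmod (k y - k a)).
{ intros y Hy. specialize (H1 y ltac:(unfold r in *; lra)).
  assert (E := Cmod_le_minus (l * (y - a)) (k y - k a)).
  rewrite (Cmod_minus_sym (l * (y - a))), Cmod_mult, Hy in E. rewrite Hy in H1. lra. }
exists (Cmod l / 4 * r)%R. split; [apply Rmult_lt_0_compat; lra|].
intros b Hb.
set (K := fun y => Cmod (y - a) <= r).
destruct (extreme_value K (Cmod a + r) (fun y => (- Cmod (k y - b))%R) a) as [m [Hm Hmin]].
- intros z Hz. exists (Cmod (z - a) - r)%R. unfold K in *. split; [lra|]. intros y Hy Hya.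
  assert (E := Cmod_le_minus (z - a) (y - a)).
  replace (z - a - (y - a)) with (- (y - z)) in E by ring. rewrite Cmod_opp in E. lra.
- intros z Hz. unfold K in Hz. pose proof (Cmod_le_minus z a). lra.
- unfold K. rewrite Haa, Cmod_0. lra.
- intros z Hz eps He. unfold K in Hz. destruct (Hk z ltac:(unfold r in *; lra)) as [lz [_ Hlz]].
  destruct (is_Cderive_continuous _ _ _ Hlz eps He) as [dz [Hdz Hc]].
  exists dz. split; [exact Hdz|]. intros y _ Hy. eapply Rle_lt_trans; [|apply (Hc y Hy)].
  apply Rabs_le. pose proof (Cmod_le_minus (k y - b) (k z - b)) as E1.
  pose proof (Cmod_le_minus (k z - b) (k y - b)) as E2.
  replace (k y - b - (k z - b)) with (k y - k z) in E1 by ring.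
  replace (k z - b - (k y - b)) with (- (k y - k z)) in E2 by ring. rewrite Cmod_opp in E2. lra.
- simpl in Hmin. unfold K in *.
  assert (Hma : Cmod (k m - b) <= Cmod l / 4 * r).
  { assert (E := Hmin a). rewrite Haa, Cmod_0 in E. specialize (E ltac:(lra)).
    rewrite (Cmod_minus_sym (k a)) in E. lra. }
  assert (Hmr : Cmod (m - a) < r).
  { destruct (Rle_lt_or_eq_dec _ _ Hm) as [Hlt|Heq]; [exact Hlt|].
    specialize (Hbd m Heq).
    assert (E := Cmod_triangle (k m - b) (b - k a)).
    replace (k m - b + (b - k a)) with (k m - k a) in E by ring. nra. }
  exists m. split; [unfold r in *; lra|].
  apply NNPP. intros Hne. assert (Hw : k m - b <> 0) by (now apply Cminus_eq_contra).
  assert (Hwp := proj1 (Cmod_gt_0 _) Hw).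
  destruct (Hk m ltac:(unfold r in *; lra)) as [lm [Hlm0 Hlm]].
  assert (Hder : is_Cderive (fun y => (k m - b) / (k y - b)) m
    ((0 * (k m - b) - (k m - b) * (lm - 0)) / ((k m - b) * (k m - b)))).
  { apply (is_Cderive_div (fun _ => k m - b) (fun y => k y - b) m 0 (lm - 0)); [exact Hw|apply is_Cderive_const|].
    apply is_Cderive_minus; [exact Hlm|apply is_Cderive_const]. }
  assert (E := local_max_Re_derive_0 _ _ _ (r - Cmod (m - a)) ltac:(lra) Hder).
  assert (E0 : (0 * (k m - b) - (k m - b) * (lm - 0)) / ((k m - b) * (k m - b)) = 0).
  { apply E. intros y Hy.
    assert (Hya : Cmod (y - a) <= r).
    { replace (y - a) with ((y - m) + (m - a)) by ring. pose proof (Cmod_triangle (y - m) (m - a)). lra. }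
    specialize (Hmin y Hya).
    replace ((k m - b) / (k m - b)) with (RtoC 1) by (field; auto).
    change (Re 1) with 1%R.
    eapply Rle_trans; [apply Re_le_Cmod|].
    assert (Hyw : k y - b <> 0) by (apply Cmod_gt_0; lra).
    rewrite Cmod_div by exact Hyw. apply Rle_div_l; lra. }
  apply Hlm0.
  replace lm with (- (k m - b) * ((0 * (k m - b) - (k m - b) * (lm - 0)) / ((k m - b) * (k m - b))))
    by (field; auto).
  rewrite E0. ring.
Qed.

(** * Radial means and convexity *)

(** The function (1/z) int_0^z h, written so that it makes sense at 0. *)
Definition radial_mean (h : C -> C) (z : C) : C := CInt (fun t => h (segment_point 0 z t)) 0 1.

Lemma Cmod_0_lt rho z : Cmod z < rho -> Cmod 0 < rho.
Proof. rewrite Cmod_0. pose proof (Cmod_ge_0 z). lra. Qed.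

Lemma radial_mean_divided_difference rho h z : holomorphic rho h -> Cmod z < rho ->
  radial_mean h z = divided_difference (segment_integral h 0) 0 z.
Proof.
intros Hh Hz. apply (@RInt_ext C_R_CompleteNormedModule).
intros t Ht. rewrite Rmin_left, Rmax_right in Ht by lra.
symmetry. apply is_C_derive_unique. apply (has_primitive rho); [exact Hh|].
apply segment_in_disk; [now apply (Cmod_0_lt rho z)|exact Hz|lra].
Qed.

Lemma holomorphic_ext rho f g :
  (forall z, Cmod z < rho -> f z = g z) -> holomorphic rho f -> holomorphic rho g.
Proof.
intros H Hf z Hz. destruct (Hf z Hz) as [l Hl]. exists l.
apply (is_Cderive_ext_loc f g z l (rho - Cmod z)); [lra| |exact Hl].
intros y Hy. apply H. pose proof (Cmod_le_minus y z). lra.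
Qed.

Lemma holomorphic_segment_integral rho h : holomorphic rho h -> holomorphic rho (segment_integral h 0).
Proof. intros Hh z Hz. exists (h z). now apply (has_primitive rho). Qed.

Lemma holomorphic_radial_mean rho h : holomorphic rho h -> holomorphic rho (radial_mean h).
Proof.
intros Hh. destruct (Rlt_dec 0 rho) as [Hr|Hr].
- apply (holomorphic_ext rho (divided_difference (segment_integral h 0) 0)).
  + intros z Hz. symmetry. now apply (radial_mean_divided_difference rho).
  + apply holomorphic_divided_difference; [now apply holomorphic_segment_integral|now rewrite Cmod_0].
- intros z Hz. pose proof (Cmod_ge_0 z). lra.
Qed.

Lemma radial_mean_eq rho h z : holomorphic rho h -> Cmod z < rho ->
  radial_mean h z + z * C_derive (radial_mean h) z = h z.
Proof.
intros Hh Hz.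
assert (H1 := has_primitive rho h Hh z Hz).
assert (H2 : is_Cderive (segment_integral h 0) z (1 * radial_mean h z + z * C_derive (radial_mean h) z)).
{ apply (is_Cderive_ext (fun y => y * radial_mean h y)).
  - intros y. unfold segment_integral, radial_mean. ring.
  - apply (is_Cderive_mult (fun y => y)); [apply is_Cderive_id|].
    now apply ex_Cderive_C_derive, (holomorphic_radial_mean rho). }
apply is_C_derive_unique in H1. apply is_C_derive_unique in H2.
rewrite <- H1, H2. ring.
Qed.

Lemma radial_mean_0 h : radial_mean h 0 = h 0.
Proof.
apply CInt_unique. replace (h 0) with (RtoC (1 - 0) * h 0) by (rewrite Rminus_0_r; ring).
eapply is_CInt_ext; [|apply is_CInt_const]. intros t _. simpl. f_equal.
unfold segment_point. ring.
Qed.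

Lemma primitive0_radial_mean rho h z : holomorphic rho h -> Cmod z < rho ->
  primitive0 h z = z * radial_mean h z.
Proof.
intros Hh Hz. apply CInt_unique. unfold radial_mean.
apply (is_CInt_ext (fun t => z * h (segment_point 0 z t))).
- intros t _. simpl. do 2 f_equal. unfold segment_point. ring.
- apply is_CInt_mult_l. apply (is_CInt_segment h 0 z 0 1); try lra.
  intros u Hu. apply (holomorphic_continuous_at rho); [exact Hh|].
  apply segment_in_disk; auto. now apply (Cmod_0_lt rho z).
Qed.

Lemma is_Cderive_unique f z l m : is_Cderive f z l -> is_Cderive f z m -> l = m.
Proof.
intros H1 H2. apply is_C_derive_unique in H1. apply is_C_derive_unique in H2. congruence.
Qed.

(** The classical analytic condition for k to map the disk onto a convex
    domain.  Injectivity is a consequence. *)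
Definition convex_map (k : C -> C) : Prop :=
  holomorphic 1 k /\ forall z, Cmod z < 1 ->
    C_derive k z <> 0 /\ 0 < Re (1 + z * C_derive (C_derive k) z / C_derive k z).

Lemma Re_div_eq (x y : C) : y <> 0 -> (Re (x / y) * (Cmod y * Cmod y) = Re (x * Cconj y))%R.
Proof.
intros Hy. rewrite Rmult_comm, <- re_scal_l. f_equal.
replace (RtoC (Cmod y * Cmod y)) with (y * Cconj y).
- field. exact Hy.
- rewrite <- Cmod2_conj. f_equal. ring.
Qed.

(** Schwarz's lemma for the Cayley transform (Q - c)/(Q + c). *)
Lemma positive_Re_strict (Q : C -> C) (c : R) : holomorphic 1 Q -> Q 0 = RtoC c -> 0 < c ->
  (forall z, Cmod z < 1 -> 0 <= Re (Q z)) -> forall z, Cmod z < 1 -> 0 < Re (Q z).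
Proof.
intros HQ H0 Hc Hpos z Hz.
assert (Hden : forall x, Cmod x < 1 -> 0 < Cmod (Q x + RtoC c)).
{ intros x Hx. specialize (Hpos x Hx). pose proof (Re_le_Cmod (Q x + RtoC c)) as A.
  change (Re (Q x + RtoC c)) with (Re (Q x) + c)%R in A. lra. }
assert (Hsq : forall x, (Cmod (Q x - RtoC c) * Cmod (Q x - RtoC c) =
  Cmod (Q x + RtoC c) * Cmod (Q x + RtoC c) - 4 * c * Re (Q x))%R).
{ intros x. rewrite !Cmod_sqr_Re_Im. simpl. unfold Re, Im. ring. }
set (w := fun x => (Q x - RtoC c) / (Q x + RtoC c)).
assert (E : Cmod (w z) * 1 <= 1 * Cmod z).
{ apply (Schwarz_lemma 1); [| | |exact Hz].
  - intros x Hx. destruct (HQ x Hx) as [l Hl]. eexists. apply is_Cderive_div.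
    + apply Cmod_gt_0. auto.
    + apply is_Cderive_minus; [exact Hl|apply is_Cderive_const].
    + apply is_Cderive_plus; [exact Hl|apply is_Cderive_const].
  - unfold w. rewrite H0. unfold Cdiv. ring.
  - intros x Hx. unfold w. specialize (Hden x Hx). specialize (Hpos x Hx). specialize (Hsq x).
    rewrite Cmod_div by (now apply Cmod_gt_0). apply Rle_div_l; [exact Hden|].
    pose proof (Cmod_ge_0 (Q x - RtoC c)). nra. }
specialize (Hden z Hz). specialize (Hpos z Hz). specialize (Hsq z).
unfold w in E. rewrite Cmod_div in E by (now apply Cmod_gt_0).
destruct Hpos as [Hp|Hp]; [exact Hp|]. rewrite <- Hp in Hsq.
assert (E2 : Cmod (Q z - RtoC c) = Cmod (Q z + RtoC c)).
{ pose proof (Cmod_ge_0 (Q z - RtoC c)). nra. }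
rewrite E2 in E. unfold Rdiv in E. rewrite Rinv_r in E by lra. lra.
Qed.

Lemma Re_inv_1_minus_le (u : C) : u <> 1 -> 1 <= Cmod u -> Re (/ (1 - u)) <= 1 / 2.
Proof.
intros Hu1 Hu. assert (Hne : 1 - u <> 0) by (intros E; apply Hu1; symmetry; now apply Ceq_minus).
assert (Hp := proj1 (Cmod_gt_0 _) Hne).
assert (E := Re_div_eq 1 (1 - u) Hne).
replace (1 / (1 - u)) with (/ (1 - u)) in E by (field; auto).
replace (Re (1 * Cconj (1 - u))) with (1 - Re u)%R in E by (simpl; unfold Re; ring).
assert (A : (Cmod (1 - u) * Cmod (1 - u) = 1 - 2 * Re u + Cmod u * Cmod u)%R).
{ rewrite !Cmod_sqr_Re_Im. simpl. unfold Re, Im. ring. }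
apply (Rmult_le_reg_r (Cmod (1 - u) * Cmod (1 - u))); [nra|]. rewrite E. nra.
Qed.

Lemma Re_inv_1_minus_gt (u : C) : Cmod u < 1 -> 1 / 2 < Re (/ (1 - u)).
Proof.
intros Hu. assert (Hne : 1 - u <> 0).
{ intros E. apply Ceq_minus in E. rewrite <- E, Cmod_1 in Hu. lra. }
assert (Hp := proj1 (Cmod_gt_0 _) Hne).
assert (E := Re_div_eq 1 (1 - u) Hne).
replace (1 / (1 - u)) with (/ (1 - u)) in E by (field; auto).
replace (Re (1 * Cconj (1 - u))) with (1 - Re u)%R in E by (simpl; unfold Re; ring).
assert (A : (Cmod (1 - u) * Cmod (1 - u) = 1 - 2 * Re u + Cmod u * Cmod u)%R).
{ rewrite !Cmod_sqr_Re_Im. simpl. unfold Re, Im. ring. }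
pose proof (Cmod_ge_0 u).
apply (Rmult_lt_reg_r (Cmod (1 - u) * Cmod (1 - u))); [nra|]. rewrite E. nra.
Qed.

Lemma Cmod_max_on_disk rho f r : holomorphic rho f -> 0 <= r < rho ->
  exists m, Cmod m <= r /\ forall z, Cmod z <= r -> Cmod (f z) <= Cmod (f m).
Proof.
intros Hf Hr. apply (closed_disk_extreme r (fun z => Cmod (f z))); [lra|].
intros x Hx eps He.
destruct (holomorphic_continuous_at rho f Hf x ltac:(lra) eps He) as [d' [Hd' H]].
exists d'. split; [exact Hd'|]. intros y Hy. eapply Rle_lt_trans; [|apply (H y Hy)].
apply Rabs_le. pose proof (Cmod_le_minus (f y) (f x)). pose proof (Cmod_le_minus (f x) (f y)) as E.
rewrite (Cmod_minus_sym (f x)) in E. lra.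
Qed.

(** With u = 1 - 2 k'/h', the relation h' = 2 k' + z k'' becomes
    (1 - u) z h''/h' = 2 u + z u'.  Where |u| is maximal the right side is
    (2 + n) u with n >= 1.  If |u| >= 1 there, then Re (1/(1 - u)) <= 1/2, and
    1 + z h''/h' = -1 - n + (2 + n)/(1 - u) has real part at most -n/2, whereas
    the hypothesis gives more than -1/2 by [positive_Re_strict].  So |u| < 1,
    and 1 + z k''/k' = (1 + u)/(1 - u) has positive real part. *)
Theorem radial_mean_convex (h : C -> C) : holomorphic 1 h ->
  (forall z, Cmod z < 1 -> C_derive h z <> 0 /\
     - (1 / 2) <= Re (1 + z * C_derive (C_derive h) z / C_derive h z)) ->
  convex_map (radial_mean h).
Proof.
intros Hh Hre. set (k := radial_mean h).
assert (Hk : holomorphic 1 k) by (now apply holomorphic_radial_mean).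
assert (Hh1 := holomorphic_C_derive 1 h Hh). assert (Hk1 := holomorphic_C_derive 1 k Hk).
assert (Hhk : forall z, Cmod z < 1 -> C_derive h z = 2 * C_derive k z + z * C_derive (C_derive k) z).
{ intros z Hz. apply (is_Cderive_unique h z); [now apply ex_Cderive_C_derive, Hh|].
  apply (is_Cderive_ext_loc (fun y => k y + y * C_derive k y) h z _ (1 - Cmod z)); [lra| |].
  - intros y Hy. apply (radial_mean_eq 1); [exact Hh|]. pose proof (Cmod_le_minus y z). lra.
  - eapply is_Cderive_eq.
    + apply is_Cderive_plus; [apply ex_Cderive_C_derive, Hk, Hz|].
      apply is_Cderive_mult; [apply is_Cderive_id|apply ex_Cderive_C_derive, Hk1, Hz].
    + simpl. ring. }
assert (Hstrict : forall z, Cmod z < 1 ->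
  - (1 / 2) < Re (1 + z * C_derive (C_derive h) z / C_derive h z)).
{ (* The real part of Q is nonnegative and Q(0) = 3/2, so it is positive. *)
  set (Q := fun z => RtoC (3 / 2) + z * C_derive (C_derive h) z / C_derive h z).
  assert (HQ : forall z, Re (Q z) = (Re (1 + z * C_derive (C_derive h) z / C_derive h z) + 1 / 2)%R)
    by (intros z; unfold Q; simpl; lra).
  intros z Hz. enough (0 < Re (Q z)) by (rewrite HQ in H; lra).
  apply (positive_Re_strict Q (3 / 2)); [| |lra| |exact Hz].
  - intros x Hx. unfold Q. eexists. apply is_Cderive_plus; [apply is_Cderive_const|].
    apply is_Cderive_div; [now apply Hre| |now apply ex_Cderive_C_derive, Hh1].
    apply is_Cderive_mult; [apply is_Cderive_id|].
    now apply ex_Cderive_C_derive, (holomorphic_C_derive 1).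
  - unfold Q, Cdiv. ring.
  - intros x Hx. rewrite HQ. destruct (Hre x Hx) as [_ A]. lra. }
set (u := fun z => 1 - 2 * C_derive k z / C_derive h z).
assert (Hku : forall z, Cmod z < 1 -> 2 * C_derive k z = C_derive h z * (1 - u z)).
{ intros z Hz. unfold u. field. now apply Hre. }
assert (Hu : holomorphic 1 u).
{ intros z Hz. unfold u. eexists. apply is_Cderive_minus; [apply is_Cderive_const|].
  apply is_Cderive_div; [now apply Hre| |now apply ex_Cderive_C_derive, Hh1].
  apply is_Cderive_mult; [apply is_Cderive_const|now apply ex_Cderive_C_derive, Hk1]. }
assert (Hu0 : u 0 = 0).
{ assert (H0 : Cmod 0 < 1) by (rewrite Cmod_0; lra).
  unfold u. destruct (Hre 0 H0) as [A _]. revert A. rewrite (Hhk 0 H0). intros A.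
  replace (2 * C_derive k 0 + 0 * C_derive (C_derive k) 0) with (2 * C_derive k 0) in * by ring.
  field. intros E. apply A. rewrite E. ring. }
assert (Hu1 : forall z, Cmod z < 1 -> Cmod (u z) < 1).
{ intros z Hz. apply Rnot_le_lt. intros Hge.
  destruct (Cmod_max_on_disk 1 u (Cmod z) Hu) as [m [Hm Hmax]].
  { split; [apply Cmod_ge_0|exact Hz]. }
  assert (Hum : 1 <= Cmod (u m)) by (eapply Rle_trans; [exact Hge|apply Hmax; lra]).
  assert (Hm1 : Cmod m < 1) by lra.
  destruct (Jack_lemma 1 u m Hu Hu0 Hm1) as [n [Hn Hnu]].
  { apply Cmod_gt_0. lra. }
  { intros y Hy. apply Hmax. lra. }
  destruct (Hre m Hm1) as [Hh'0 _]. specialize (Hstrict m Hm1).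
  assert (Hd : 2 * C_derive (C_derive k) m =
    C_derive (C_derive h) m * (1 - u m) + C_derive h m * (0 - C_derive u m)).
  { apply (is_Cderive_unique (fun z => C_derive h z * (1 - u z)) m).
    - apply (is_Cderive_ext_loc (fun z => 2 * C_derive k z) _ m _ (1 - Cmod m)); [lra| |].
      + intros y Hy. apply Hku. pose proof (Cmod_le_minus y m). lra.
      + eapply is_Cderive_eq.
        * apply is_Cderive_mult; [apply is_Cderive_const|now apply ex_Cderive_C_derive, Hk1].
        * simpl. ring.
    - apply (is_Cderive_mult (C_derive h) (fun z => 1 - u z)); [now apply ex_Cderive_C_derive, Hh1|].
      apply is_Cderive_minus; [apply is_Cderive_const|now apply ex_Cderive_C_derive, Hu]. }
  assert (Hkey : m * C_derive (C_derive h) m * (1 - u m) = (2 + RtoC n) * u m * C_derive h m).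
  { assert (E1 := Hhk m Hm1). assert (E2 := Hku m Hm1).
    assert (E3 : m * (2 * C_derive (C_derive k) m) = 2 * C_derive h m * u m).
    { replace (m * (2 * C_derive (C_derive k) m)) with (2 * C_derive h m - 2 * (2 * C_derive k m))
        by (rewrite E1; ring). rewrite E2. ring. }
    rewrite Hd in E3.
    replace (m * C_derive (C_derive h) m * (1 - u m)) with
      (m * (C_derive (C_derive h) m * (1 - u m) + C_derive h m * (0 - C_derive u m))
       + C_derive h m * (m * C_derive u m)) by ring.
    rewrite E3, Hnu. ring. }
  assert (Hn2 : 2 + RtoC n <> 0).
  { intros E. apply (f_equal Re) in E. simpl in E. lra. }
  assert (Hu1 : u m <> 1).
  { intros E. rewrite E in Hkey.
    replace (m * C_derive (C_derive h) m * (1 - 1)) with (RtoC 0) in Hkey by ring.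
    symmetry in Hkey. revert Hkey.
    replace ((2 + RtoC n) * 1 * C_derive h m) with ((2 + RtoC n) * C_derive h m) by ring.
    now apply Cmult_neq_0. }
  assert (Hne : 1 - u m <> 0) by (intros E; apply Hu1; symmetry; now apply Ceq_minus).
  assert (A := Re_inv_1_minus_le (u m) Hu1 Hum).
  replace (1 + m * C_derive (C_derive h) m / C_derive h m) with
    (RtoC (- 1 - n) + RtoC (2 + n) * / (1 - u m)) in Hstrict.
  - replace (Re (RtoC (- 1 - n) + RtoC (2 + n) * / (1 - u m))) with
      (- 1 - n + (2 + n) * Re (/ (1 - u m)))%R in Hstrict
      by (simpl Re at 2; rewrite <- re_scal_l; reflexivity).
    nra.
  - replace (m * C_derive (C_derive h) m) with ((2 + RtoC n) * u m * C_derive h m / (1 - u m))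
      by (rewrite <- Hkey; field; auto).
    rewrite !RtoC_plus, RtoC_minus. field. auto. }
split; [exact Hk|]. intros z Hz.
assert (Hk'0 : C_derive k z <> 0).
{ intros E. assert (A := Hku z Hz). rewrite E in A.
  assert (B : C_derive h z * (1 - u z) <> 0).
  { apply Cmult_neq_0; [now apply Hre|]. intros E'. apply Ceq_minus in E'.
    specialize (Hu1 z Hz). rewrite <- E', Cmod_1 in Hu1. lra. }
  apply B. rewrite <- A. ring. }
split; [exact Hk'0|].
assert (Hne : 1 - u z <> 0).
{ intros E'. apply Ceq_minus in E'. specialize (Hu1 z Hz). rewrite <- E', Cmod_1 in Hu1. lra. }
replace (1 + z * C_derive (C_derive k) z / C_derive k z) with (RtoC (- (1)) + RtoC 2 * / (1 - u z)).
- change (0 < - (1) + Re (RtoC 2 * / (1 - u z))). rewrite re_scal_l.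
  pose proof (Re_inv_1_minus_gt (u z) (Hu1 z Hz)). lra.
- replace (z * C_derive (C_derive k) z) with (C_derive h z - 2 * C_derive k z)
    by (rewrite (Hhk z Hz); ring).
  replace (C_derive h z) with (2 * C_derive k z / (1 - u z)) by (rewrite (Hku z Hz); field; auto).
  rewrite RtoC_opp. field. auto.
Qed.

(** * Geometry of convex maps *)

Lemma cis_surjective (c : C) : Cmod c = 1%R -> exists t, 0 <= t < 2 * PI /\ c = cis t.
Proof.
intros Hc. destruct c as [u v].
assert (E : (u * u + v * v = 1)%R).
{ pose proof (Cmod_sqr_Re_Im (u, v)) as A. rewrite Hc in A. simpl in A. lra. }
assert (Hu : -1 <= u <= 1) by nra.
assert (Hs : sin (acos u) = Rabs v).
{ rewrite sin_acos by exact Hu. rewrite <- sqrt_Rsqr_abs. f_equal. unfold Rsqr. lra. }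
pose proof (acos_bound u) as Hb. pose proof PI_RGT_0.
assert (Hcos := cos_acos u Hu).
destruct (Rle_lt_dec 0 v) as [Hv|Hv].
- exists (acos u). split; [lra|]. unfold cis. rewrite Hcos, Hs, Rabs_pos_eq; auto.
- exists (2 * PI - acos u)%R. split.
  + split; [lra|]. destruct Hb as [Hb _]. destruct (Rle_lt_or_eq_dec _ _ Hb) as [H0|H0]; [lra|].
    rewrite <- H0, sin_0 in Hs. rewrite Rabs_left in Hs by exact Hv. lra.
  + unfold cis. rewrite cos_minus, sin_minus, cos_2PI, sin_2PI, Hcos, Hs, Rabs_left by exact Hv.
    f_equal; ring.
Qed.

Lemma strictly_decreasing_of_derive (f df : R -> R) a b : a < b ->
  (forall s, is_derive f s (df s)) -> (forall s, a < s < b -> df s < 0) -> f b < f a.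
Proof.
intros Hab Hf Hneg.
destruct (MVT_cor2 f df a b Hab) as [c [Hc1 Hc2]].
{ intros c _. apply is_derive_Reals, Hf. }
specialize (Hneg c Hc2). nra.
Qed.

(** With W = x + iy and n = n1 + i n2 the system is W' = i n W, so that
    W = exp(B + iA). *)
Lemma linear_system_solution (x y n1 n2 A B : R -> R) :
  (forall s, is_derive x s (- (n2 s * x s + n1 s * y s))%R) ->
  (forall s, is_derive y s (n1 s * x s - n2 s * y s)%R) ->
  (forall s, is_derive A s (n1 s)) -> (forall s, is_derive B s (- n2 s)%R) ->
  A 0%R = 0%R -> B 0%R = 0%R -> x 0%R = 1%R -> y 0%R = 0%R ->
  forall s, y s = (exp (B s) * sin (A s))%R.
Proof.
intros Hx Hy HA HB A0 B0 x0 y0.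
set (p := fun s => (exp (- B s) * (x s * cos (A s) + y s * sin (A s)))%R).
set (q := fun s => (exp (- B s) * (y s * cos (A s) - x s * sin (A s)))%R).
assert (Hconst : forall f : R -> R, (forall s, is_derive f s 0%R) -> forall s, f s = f 0%R).
{ intros f Hf s. destruct (Rtotal_order s 0) as [H|[->|H]].
  - apply (eq_is_derive f s 0); [intros; apply Hf|exact H].
  - reflexivity.
  - symmetry. apply (eq_is_derive f 0 s); [intros; apply Hf|exact H]. }
assert (Dx : forall s, Derive (fun t : R => x t) s = (- (n2 s * x s + n1 s * y s))%R)
  by (intros s; apply is_derive_unique, Hx).
assert (Dy : forall s, Derive (fun t : R => y t) s = (n1 s * x s - n2 s * y s)%R)
  by (intros s; apply is_derive_unique, Hy).
assert (DA : forall s, Derive (fun t : R => A t) s = n1 s)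
  by (intros s; apply is_derive_unique, HA).
assert (DB : forall s, Derive (fun t : R => B t) s = (- n2 s)%R)
  by (intros s; apply is_derive_unique, HB).
assert (Hp : forall s, is_derive p s 0%R).
{ intros s. unfold p. auto_derive.
  - repeat split; eexists; eauto.
  - rewrite (Dx s), (Dy s), (DA s), (DB s). ring. }
assert (Hq : forall s, is_derive q s 0%R).
{ intros s. unfold q. auto_derive.
  - repeat split; eexists; eauto.
  - rewrite (Dx s), (Dy s), (DA s), (DB s). ring. }
intros s. assert (P := Hconst p Hp s). assert (Q := Hconst q Hq s).
unfold p, q in P, Q. rewrite A0, B0, x0, y0, cos_0, sin_0, Ropp_0, exp_0 in P, Q.
assert (Hexp : (exp (B s) * exp (- B s) = 1)%R) by (rewrite <- exp_plus, Rplus_opp_r; apply exp_0).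
assert (Hcs := sin2_cos2 (A s)). unfold Rsqr in Hcs.
assert (P' : (x s * cos (A s) + y s * sin (A s) = exp (B s))%R).
{ transitivity (exp (B s) * (exp (- B s) * (x s * cos (A s) + y s * sin (A s))))%R.
  - rewrite <- Rmult_assoc, Hexp. ring.
  - rewrite P. ring. }
assert (Q' : (y s * cos (A s) - x s * sin (A s) = 0)%R).
{ transitivity (exp (B s) * (exp (- B s) * (y s * cos (A s) - x s * sin (A s))))%R.
  - rewrite <- Rmult_assoc, Hexp. ring.
  - rewrite Q. ring. }
rewrite <- P'.
replace (y s) with (y s * (sin (A s) * sin (A s) + cos (A s) * cos (A s)))%R at 1
  by (rewrite Hcs; ring).
replace (y s * cos (A s))%R with (x s * sin (A s))%R by lra.
replace (y s * (sin (A s) * sin (A s) + cos (A s) * cos (A s)))%R with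
  (y s * sin (A s) * sin (A s) + y s * cos (A s) * cos (A s))%R by ring.
replace (y s * cos (A s))%R with (x s * sin (A s))%R by lra. ring.
Qed.

Lemma is_Rderive_Re (g : R -> C) t l : is_Rderive g t l -> is_derive (fun s => Re (g s)) t (Re l).
Proof.
intros H. rewrite is_Rderive_eps in H. apply is_derive_Reals. intros eps He.
destruct (H (eps / 2)%R ltac:(lra)) as [d [Hd Hd']].
exists (mkposreal d Hd). intros x Hx Hxd. simpl in Hxd.
assert (E := Hd' (t + x)%R). replace (t + x - t)%R with x in E by ring. specialize (E Hxd).
assert (Hxp : 0 < Rabs x) by (now apply Rabs_pos_lt).
assert (E2 := re_le_Cmod (g (t + x)%R - g t - l * RtoC x)).
replace ((Re (g (t + x)%R) - Re (g t)) / x - Re l)%R with (Re (g (t + x)%R - g t - l * RtoC x) / x)%R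
  by (simpl; unfold Re; field; auto).
unfold Rdiv at 1. rewrite Rabs_mult, Rabs_inv. apply Rlt_div_l; [exact Hxp|].
apply Rle_lt_trans with (eps / 2 * Rabs x)%R; [lra|]. nra.
Qed.

Lemma is_Rderive_Im (g : R -> C) t l : is_Rderive g t l -> is_derive (fun s => Im (g s)) t (Im l).
Proof.
intros H.
assert (E : is_derive (fun s => Re (- Ci * g s)) t (Re (- Ci * l))).
{ apply is_Rderive_Re. now apply is_Rderive_mult_l. }
replace (Im l) with (Re (- Ci * l)) by (simpl; unfold Im; ring).
eapply is_derive_ext; [|exact E]. intros s. simpl. unfold Im. ring.
Qed.

(** Here N = 1 + z k''/k', which is also the derivative of z k' with respect to k:
    (z k')' = N k'. *)
Section ConvexMap.
Context (k : C -> C).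
Hypothesis Hk : convex_map k.

Let N (z : C) : C := 1 + z * C_derive (C_derive k) z / C_derive k z.

Lemma convex_holomorphic : holomorphic 1 k.
Proof. apply Hk. Qed.

Lemma convex_holomorphic_derive : holomorphic 1 (C_derive k).
Proof. apply holomorphic_C_derive, convex_holomorphic. Qed.

Lemma convex_derive z : Cmod z < 1 -> is_Cderive k z (C_derive k z).
Proof. intros Hz. now apply ex_Cderive_C_derive, convex_holomorphic. Qed.

Lemma convex_derive_neq_0 z : Cmod z < 1 -> C_derive k z <> 0.
Proof. intros Hz. now apply Hk. Qed.

Lemma convex_N_pos z : Cmod z < 1 -> 0 < Re (N z).
Proof. intros Hz. now apply Hk. Qed.

Lemma convex_zderive_derive z : Cmod z < 1 ->
  is_Cderive (fun w => w * C_derive k w) z (N z * C_derive k z).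
Proof.
intros Hz. eapply is_Cderive_eq.
- apply is_Cderive_mult; [apply is_Cderive_id|]. now apply ex_Cderive_C_derive, convex_holomorphic_derive.
- unfold N. field. now apply convex_derive_neq_0.
Qed.

Lemma convex_holomorphic_N : holomorphic 1 N.
Proof.
intros z Hz. eexists. apply is_Cderive_plus; [apply is_Cderive_const|].
apply is_Cderive_div; [now apply convex_derive_neq_0| |now apply ex_Cderive_C_derive, convex_holomorphic_derive].
apply is_Cderive_mult; [apply is_Cderive_id|].
apply ex_Cderive_C_derive. apply (holomorphic_C_derive 1); [apply convex_holomorphic_derive|exact Hz].
Qed.

(** The tangent of the curve s |-> k(z e^{is}), divided by its value at s = 0, has
    the argument A(s) = int_0^s Re N, which increases from 0 to 2 pi by the mean
    value property.  So the component of the curve along the outer normal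
    z k'(z) decreases as long as A < pi and increases afterwards; being 0 at both
    ends, it is negative in between. *)
Lemma convex_support_arc (z : C) (t : R) : z <> 0 -> Cmod z < 1 -> 0 < t < 2 * PI ->
  Re ((k (z * cis t) - k z) / (z * C_derive k z)) < 0.
Proof.
intros Hz0 Hz Ht.
set (c := z * C_derive k z).
assert (Hc : c <> 0) by (apply Cmult_neq_0; [exact Hz0|now apply convex_derive_neq_0]).
set (w := fun s => z * cis s).
assert (Hw : forall s, Cmod (w s) < 1) by (intros s; unfold w; rewrite Cmod_mult, Cmod_cis; lra).
assert (Hw' : forall s, is_Rderive w s (z * (Ci * cis s))).
{ intros s. apply is_Rderive_mult_l, is_Rderive_cis. }
set (P := fun s => w s * C_derive k (w s) / c).
assert (HP : forall s, is_Rderive P s (Ci * (N (w s) * P s))).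
{ intros s.
  replace (Ci * (N (w s) * P s)) with
    (((N (w s) * C_derive k (w s)) * / c + w s * C_derive k (w s) * 0) * (z * (Ci * cis s)))
    by (unfold P, w, Cdiv; ring).
  apply (is_Rderive_comp (fun x => x * C_derive k x * / c) w); [|apply Hw'].
  apply (is_Cderive_mult (fun x => x * C_derive k x) (fun _ => / c));
    [apply convex_zderive_derive, Hw|apply is_Cderive_const]. }
set (X := fun s => Re ((k (w s) - k z) / c)).
assert (HX : forall s, is_derive X s (- Im (P s))%R).
{ intros s. replace (- Im (P s))%R with (Re (Ci * P s)) by (simpl; unfold Im; ring).
  apply (is_Rderive_Re (fun s => (k (w s) - k z) / c)).
  replace (Ci * P s) with (((C_derive k (w s) - 0) * / c + (k (w s) - k z) * 0) * (z * (Ci * cis s)))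
    by (unfold P, w, Cdiv; ring).
  apply (is_Rderive_comp (fun x => (k x - k z) * / c) w); [|apply Hw'].
  apply (is_Cderive_mult (fun x => k x - k z) (fun _ => / c)); [|apply is_Cderive_const].
  apply is_Cderive_minus; [apply convex_derive, Hw|apply is_Cderive_const]. }
assert (HNw : forall s, path_continuous (fun s => N (w s)) s).
{ intros s. apply path_continuous_comp; [apply convex_holomorphic_N, Hw|]. exact (is_Rderive_continuous _ _ _ (Hw' s)). }
assert (Hint : forall g : R -> R, (forall s, continuous g s) -> forall s, is_derive (fun s => RInt g 0 s) s (g s)).
{ intros g Hg s. apply (is_derive_RInt g (fun s => RInt g 0 s) 0 s); [|apply Hg].
  apply filter_forall. intros x. apply (@RInt_correct R_CompleteNormedModule).
  apply (@ex_RInt_continuous R_CompleteNormedModule). intros; apply Hg. }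
set (n1 := fun s => Re (N (w s))). set (n2 := fun s => Im (N (w s))).
assert (Hn1 : forall s, continuous n1 s) by (intros s; apply path_continuous_Re, HNw).
assert (Hn2 : forall s, continuous (fun s => (- n2 s)%R) s).
{ intros s. apply (continuous_opp (V:=R_NormedModule) n2). apply path_continuous_Im, HNw. }
set (A := fun s => RInt n1 0 s : R). set (B := fun s => RInt (fun s => (- n2 s)%R) 0 s : R).
assert (HA : forall s, is_derive A s (n1 s)) by (intros s; now apply Hint).
assert (HB : forall s, is_derive B s (- n2 s)%R) by (intros s; now apply (Hint (fun s => (- n2 s)%R))).
assert (A0 : A 0%R = 0%R) by exact (RInt_point 0 n1).
assert (B0 : B 0%R = 0%R) by exact (RInt_point 0 (fun s => (- n2 s)%R)).
assert (Hn1p : forall s, 0 < n1 s) by (intros s; apply convex_N_pos, Hw).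
assert (Hw0 : w 0%R = z) by (unfold w; rewrite cis_0; ring).
assert (HP0 : P 0%R = 1) by (unfold P; rewrite Hw0; unfold c; field; split; [now apply convex_derive_neq_0|exact Hz0]).
assert (HImP : forall s, Im (P s) = (exp (B s) * sin (A s))%R).
{ apply (linear_system_solution (fun s => Re (P s)) (fun s => Im (P s)) n1 n2 A B); auto.
  - intros s. replace (- (n2 s * Re (P s) + n1 s * Im (P s)))%R with (Re (Ci * (N (w s) * P s)))
      by (unfold n1, n2; simpl; unfold Re, Im; ring).
    now apply is_Rderive_Re.
  - intros s. replace (n1 s * Re (P s) - n2 s * Im (P s))%R with (Im (Ci * (N (w s) * P s)))
      by (unfold n1, n2; simpl; unfold Re, Im; ring).
    now apply is_Rderive_Im.
  - now rewrite HP0.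
  - now rewrite HP0. }
assert (A2PI : A (2 * PI)%R = (2 * PI)%R).
{ assert (M := mean_value_property 1 N 0 z convex_holomorphic_N ltac:(rewrite Cmod_0; lra)).
  apply is_CInt_components in M. destruct M as [M _].
  replace (2 * PI)%R with (Re (RtoC (2 * PI) * N 0)) at 2.
  - apply (@is_RInt_unique R_CompleteNormedModule).
    eapply (is_RInt_ext (V:=R_NormedModule)); [|exact M]. intros s _.
    unfold n1, w. cbv beta. rewrite Cplus_0_l. reflexivity.
  - rewrite re_scal_l. unfold N. replace (1 + 0 * C_derive (C_derive k) 0 / C_derive k 0) with (RtoC 1)
      by (unfold Cdiv; ring). rewrite re_RtoC. ring. }
assert (Aincr : forall s s', s < s' -> A s < A s').
{ intros s s' Hs. enough (- A s' < - A s) by lra.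
  apply (strictly_decreasing_of_derive (fun s => - A s)%R (fun s => - n1 s)%R s s' Hs).
  - intros x. apply (is_derive_opp (V:=R_NormedModule)), HA.
  - intros x _. specialize (Hn1p x). lra. }
assert (X0 : X 0%R = 0%R).
{ unfold X. rewrite Hw0. replace ((k z - k z) / c) with (RtoC 0) by (unfold Cdiv; ring). reflexivity. }
assert (X2PI : X (2 * PI)%R = 0%R).
{ unfold X. replace (w (2 * PI)%R) with z by (unfold w; rewrite cis_2PI; ring).
  replace ((k z - k z) / c) with (RtoC 0) by (unfold Cdiv; ring). reflexivity. }
(* X decreases on [0, t] if A(t) <= pi, and increases on [t, 2 pi] if not. *)
change (X t < 0). destruct (Rle_lt_dec (A t) PI) as [HAt|HAt].
- rewrite <- X0. apply (strictly_decreasing_of_derive X (fun s => - Im (P s))%R); [apply Ht|exact HX|].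
  intros s Hs. rewrite HImP. assert (S1 := Aincr 0%R s ltac:(lra)). assert (S2 := Aincr s t ltac:(lra)).
  rewrite A0 in S1. assert (0 < sin (A s)) by (apply sin_gt_0; lra).
  pose proof (exp_pos (B s)). nra.
- enough (- X (2 * PI)%R < - X t) by lra.
  apply (strictly_decreasing_of_derive (fun s => - X s)%R (fun s => - (- Im (P s)))%R); [apply Ht| |].
  + intros x. apply (is_derive_opp (V:=R_NormedModule)), HX.
  + intros s Hs. rewrite HImP. assert (S1 := Aincr t s ltac:(lra)). assert (S2 := Aincr s (2 * PI)%R ltac:(lra)).
    rewrite A2PI in S2. assert (sin (A s) < 0) by (apply sin_lt_0; lra).
    pose proof (exp_pos (B s)). nra.
Qed.

Lemma convex_support_circle (z y : C) : Cmod z < 1 -> Cmod y = Cmod z -> y <> z ->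
  Re ((k y - k z) / (z * C_derive k z)) < 0.
Proof.
intros Hz Hy Hne.
assert (Hz0 : z <> 0).
{ intros E. apply Hne. rewrite E in *. rewrite Cmod_0 in Hy. now apply Cmod_eq_0. }
destruct (cis_surjective (y / z)) as [t [Ht E]].
{ rewrite Cmod_div by exact Hz0. rewrite Hy. field. apply Rgt_not_eq, Cmod_gt_0, Hz0. }
assert (Ey : y = z * cis t) by (rewrite <- E; field; exact Hz0).
rewrite Ey. apply convex_support_arc; auto. split; [|apply Ht].
destruct Ht as [[Ht|Ht] _]; [exact Ht|]. exfalso. apply Hne.
rewrite Ey, <- Ht, cis_0. ring.
Qed.

(** The maximum principle carries the inequality from the circle into the disk.  A
    zero inside would be a local maximum, and k' would vanish there. *)
Lemma convex_support (z y : C) : Cmod z < 1 -> Cmod y < Cmod z ->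
  Re ((k y - k z) / (z * C_derive k z)) < 0.
Proof.
intros Hz Hy.
assert (Hz0 : z <> 0) by (intros E; rewrite E, Cmod_0 in Hy; pose proof (Cmod_ge_0 y); lra).
set (c := z * C_derive k z).
assert (Hc : c <> 0) by (apply Cmult_neq_0; [exact Hz0|now apply convex_derive_neq_0]).
assert (HT : forall x, Cmod x < 1 -> is_Cderive (fun x => (k x - k z) * / c) x
  ((C_derive k x - 0) * / c + (k x - k z) * 0)).
{ intros x Hx. apply (is_Cderive_mult (fun x => k x - k z) (fun _ => / c)); [|apply is_Cderive_const].
  apply is_Cderive_minus; [now apply convex_derive|apply is_Cderive_const]. }
assert (Hle : forall x, Cmod x <= Cmod z -> Re ((k x - k z) * / c) <= 0).
{ apply maximum_principle_Re.
  - intros x Hx. eexists. apply HT. lra.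
  - intros x Hx. destruct (classic (x = z)) as [->|Hne].
    + replace ((k z - k z) * / c) with (RtoC 0) by ring. simpl. lra.
    + left. now apply convex_support_circle. }
apply Rnot_le_lt. intros Hge.
assert (E := local_max_Re_derive_0 _ y _ (Cmod z - Cmod y) ltac:(lra) (HT y ltac:(lra))).
apply (convex_derive_neq_0 y); [lra|].
replace (C_derive k y) with (((C_derive k y - 0) * / c + (k y - k z) * 0) * c) by (field; auto).
rewrite E; [ring|]. intros x Hx. eapply Rle_trans; [|exact Hge]. apply Hle.
pose proof (Cmod_le_minus x y). lra.
Qed.

Theorem convex_injective (z y : C) : Cmod z < 1 -> Cmod y < 1 -> k y = k z -> y = z.
Proof.
intros Hz Hy E. apply NNPP. intros Hne.
assert (Hk0 : forall x c, Re ((k x - k x) / c) = 0%R).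
{ intros x c. replace ((k x - k x) / c) with (RtoC 0) by (unfold Cdiv; ring). reflexivity. }
destruct (Rtotal_order (Cmod y) (Cmod z)) as [H|[H|H]].
- assert (A := convex_support z y Hz H). rewrite E, Hk0 in A. lra.
- assert (A := convex_support_circle z y Hz H Hne). rewrite E, Hk0 in A. lra.
- assert (A := convex_support y z Hy H). rewrite E, Hk0 in A. lra.
Qed.

Lemma Re_inv_neg (x : C) : Re x < 0 -> Re (/ x) < 0.
Proof.
intros Hx. assert (Hx0 : x <> 0) by (intros E; rewrite E in Hx; simpl in Hx; lra).
assert (Hp := proj1 (Cmod_gt_0 _) Hx0).
assert (E := Re_div_eq 1 x Hx0). replace (1 / x) with (/ x) in E by (field; auto).
replace (Re (1 * Cconj x)) with (Re x) in E by (simpl; unfold Re; ring).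
apply (Rmult_lt_reg_r (Cmod x * Cmod x)); [nra|]. rewrite E. lra.
Qed.

(** Divide y k'(y) - z k'(z) and k(y) - k(z) by y - z: the quotient becomes
    holomorphic in y up to the circle |y| = |z|.  On this circle it splits into
    y k'(y)/(k(y) - k(z)) and z k'(z)/(k(z) - k(y)), whose real parts are positive
    by the support property at y and at z; for y = z it is N(z). *)
Lemma convex_difference_quotient (z y : C) : Cmod z < 1 -> Cmod y < Cmod z ->
  0 <= Re ((y * C_derive k y - z * C_derive k z) / (k y - k z)).
Proof.
intros Hz Hy.
set (zdk := fun w => w * C_derive k w).
assert (Hzk' : holomorphic 1 zdk) by (intros x Hx; eexists; now apply convex_zderive_derive).
set (kap := divided_difference k z). set (lam := divided_difference zdk z).
assert (Hkap : holomorphic 1 kap) by (apply holomorphic_divided_difference; [apply convex_holomorphic|exact Hz]).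
assert (Hlam : holomorphic 1 lam) by (apply holomorphic_divided_difference; [exact Hzk'|exact Hz]).
assert (Ekap : forall x, Cmod x < 1 -> k x - k z = (x - z) * kap x).
{ intros x Hx. rewrite (divided_difference_spec 1 k z x convex_holomorphic Hz Hx). unfold kap. ring. }
assert (Elam : forall x, Cmod x < 1 -> zdk x - zdk z = (x - z) * lam x).
{ intros x Hx. rewrite (divided_difference_spec 1 zdk z x Hzk' Hz Hx). unfold lam. ring. }
assert (Hkz : kap z = C_derive k z) by apply divided_difference_diag.
assert (Hlz : lam z = N z * C_derive k z).
{ unfold lam. rewrite divided_difference_diag. apply is_C_derive_unique. now apply convex_zderive_derive. }
assert (Hne : forall x, Cmod x < 1 -> x <> z -> x - z <> 0) by (intros; now apply Cminus_eq_contra).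
assert (Hkne : forall x, Cmod x < 1 -> x <> z -> k x - k z <> 0).
{ intros x Hx Hxz. apply Cminus_eq_contra. intros E. apply Hxz. now apply convex_injective. }
assert (Hkap0 : forall x, Cmod x < 1 -> kap x <> 0).
{ intros x Hx. destruct (classic (x = z)) as [->|Hxz].
  - rewrite Hkz. now apply convex_derive_neq_0.
  - intros E. apply (Hkne x Hx Hxz). rewrite Ekap, E by exact Hx. ring. }
assert (Hquot : forall x, Cmod x < 1 -> x <> z -> (zdk x - zdk z) / (k x - k z) = lam x / kap x).
{ intros x Hx Hxz. rewrite Ekap, Elam by exact Hx. field. split; auto. }
assert (Hyz : y <> z) by (intros E; rewrite E in Hy; lra).
change (0 <= Re ((zdk y - zdk z) / (k y - k z))). rewrite Hquot by (auto; lra).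
enough (Re (- (1) * (lam y / kap y)) <= 0).
{ replace (Re (- (1) * (lam y / kap y))) with (- Re (lam y / kap y))%R in H by (simpl; unfold Re, Im; ring). lra. }
apply (maximum_principle_Re (Cmod z) (fun x => - (1) * (lam x / kap x))); [| |lra].
- intros x Hx. apply ex_Cderive_mult_l. eexists. apply is_Cderive_div; [apply Hkap0; lra| |].
  + apply ex_Cderive_C_derive, Hlam. lra.
  + apply ex_Cderive_C_derive, Hkap. lra.
- intros x Hx.
  replace (Re (- (1) * (lam x / kap x))) with (- Re (lam x / kap x))%R by (simpl; unfold Re, Im; ring).
  destruct (classic (x = z)) as [->|Hxz].
  + rewrite Hkz, Hlz. replace (N z * C_derive k z / C_derive k z) with (N z)
      by (field; now apply convex_derive_neq_0).
    pose proof (convex_N_pos z Hz). lra.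
  + assert (Hx1 : Cmod x < 1) by lra.
    rewrite <- Hquot by assumption.
    assert (S1 := convex_support_circle z x Hz Hx Hxz).
    assert (S2 := convex_support_circle x z Hx1 (eq_sym Hx) (fun E => Hxz (eq_sym E))).
    assert (Hx0 : x <> 0 /\ z <> 0).
    { split; intros E; apply Hxz; rewrite E in *; rewrite Cmod_0 in Hx.
      - symmetry. now apply Cmod_eq_0.
      - now apply Cmod_eq_0. }
    destruct Hx0 as [Hx0 Hz0].
    apply Re_inv_neg in S1. apply Re_inv_neg in S2.
    assert (D1 := convex_derive_neq_0 z Hz). assert (D2 := convex_derive_neq_0 x Hx1).
    assert (K1 := Hkne x Hx1 Hxz).
    assert (K2 : k z - k x <> 0).
    { intros E. apply K1. replace (k x - k z) with (- (k z - k x)) by ring. rewrite E. ring. }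
    replace ((zdk x - zdk z) / (k x - k z)) with
      (- (/ ((k x - k z) / (z * C_derive k z)) + / ((k z - k x) / (x * C_derive k x)))).
    * change (- - (Re (/ ((k x - k z) / (z * C_derive k z))) + Re (/ ((k z - k x) / (x * C_derive k x)))) <= 0).
      lra.
    * unfold zdk. replace (k z - k x) with (- (k x - k z)) by ring. field.
      repeat split; auto.
Qed.

(** Divided by k(y) - k(z), such an equation would read 1 + D = (m - 1)/T, where D
    is the quotient of [convex_difference_quotient] and T is the quotient of
    [convex_support].  The left side has real part at least 1 and the right side
    at most 0. *)
Theorem convex_ray_avoids (z y : C) (m : R) : Cmod z < 1 -> Cmod y < Cmod z -> 1 <= m ->
  k y + y * C_derive k y <> k z + RtoC m * (z * C_derive k z).
Proof.
intros Hz Hy Hm E.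
assert (S1 := convex_support z y Hz Hy). assert (S2 := convex_difference_quotient z y Hz Hy).
assert (Hz0 : z <> 0) by (intros E'; rewrite E', Cmod_0 in Hy; pose proof (Cmod_ge_0 y); lra).
assert (Hc := convex_derive_neq_0 z Hz).
assert (Hne : k y - k z <> 0).
{ intros E'. rewrite E' in S1. replace (0 / (z * C_derive k z)) with (RtoC 0) in S1 by (unfold Cdiv; ring).
  simpl in S1. lra. }
apply Re_inv_neg in S1.
assert (E' : 1 + (y * C_derive k y - z * C_derive k z) / (k y - k z) =
  RtoC (m - 1) * / ((k y - k z) / (z * C_derive k z))).
{ replace (y * C_derive k y) with (k z + RtoC m * (z * C_derive k z) - k y) by (rewrite <- E; ring).
  rewrite RtoC_minus. field. auto. }
apply (f_equal Re) in E'. rewrite re_scal_l in E'.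
change (1 + Re ((y * C_derive k y - z * C_derive k z) / (k y - k z)) = (m - 1) * Re (/ ((k y - k z) / (z * C_derive k z))))%R in E'.
nra.
Qed.
End ConvexMap.

(** * Subordination to a convex map *)

Lemma continuous_at_comp f g z : continuous_at g z -> continuous_at f (g z) ->
  continuous_at (fun x => f (g x)) z.
Proof.
intros Hg Hf eps He. destruct (Hf eps He) as [d [Hd H]].
destruct (Hg d Hd) as [d' [Hd' H']]. exists d'. auto.
Qed.

Lemma Caratheodory_derive (f Psi : C -> C) z d : 0 < d ->
  (forall y, Cmod (y - z) < d -> f y = f z + Psi y * (y - z)) ->
  continuous_at Psi z -> is_Cderive f z (Psi z).
Proof.
intros Hd Hf HPsi. rewrite is_Cderive_eps. intros eps He.
destruct (HPsi eps He) as [d' [Hd' H]].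
exists (Rmin d d'). split; [now apply Rmin_pos|]. intros y Hy.
rewrite (Hf y) by (eapply Rlt_le_trans; [exact Hy|apply Rmin_l]).
replace (f z + Psi y * (y - z) - f z - Psi z * (y - z)) with ((Psi y - Psi z) * (y - z)) by ring.
rewrite Cmod_mult. apply Rmult_le_compat_r; [apply Cmod_ge_0|].
left. apply H. eapply Rlt_le_trans; [exact Hy|apply Rmin_r].
Qed.

Section Inverse.
Context (k g : C -> C).
Hypothesis Hk : convex_map k.
Hypothesis Hg : forall a, Cmod a < 1 -> g (k a) = a.

Lemma convex_open (a : C) (eps : R) : Cmod a < 1 -> 0 < eps ->
  exists e, 0 < e /\ forall b, Cmod (b - k a) < e ->
    exists y, Cmod y < 1 /\ Cmod (y - a) < eps /\ k y = b.
Proof.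
intros Ha He.
destruct (local_open_mapping k a (Rmin eps (1 - Cmod a))) as [e [He' H]].
- apply Rmin_pos; lra.
- intros y Hy. assert (Hy2 := Rlt_le_trans _ _ _ Hy (Rmin_r _ _)).
  assert (Hy1 : Cmod y < 1) by (pose proof (Cmod_le_minus y a); lra).
  exists (C_derive k y). split; [now apply convex_derive_neq_0|now apply convex_derive].
- exists e. split; [exact He'|]. intros b Hb. destruct (H b Hb) as [y [Hy E]].
  assert (Hy1 := Rlt_le_trans _ _ _ Hy (Rmin_l _ _)).
  assert (Hy2 := Rlt_le_trans _ _ _ Hy (Rmin_r _ _)).
  exists y. repeat split; auto. pose proof (Cmod_le_minus y a). lra.
Qed.

(** The difference quotient of g at k(a) is 1/kap(g(b)) with kap the divided
    difference of k at a, and g is continuous because k is open. *)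
Lemma inverse_derive (a : C) : Cmod a < 1 -> ex_Cderive g (k a).
Proof.
intros Ha.
set (kap := divided_difference k a).
assert (Hkap : holomorphic 1 kap) by (apply holomorphic_divided_difference; [now apply convex_holomorphic|exact Ha]).
assert (Hgc : continuous_at g (k a)).
{ intros eps He. destruct (convex_open a eps Ha He) as [e [He' H]]. exists e. split; [exact He'|].
  intros b Hb. destruct (H b Hb) as [y [Hy1 [Hy2 E]]]. rewrite <- E, !Hg by assumption. exact Hy2. }
destruct (convex_open a 1 Ha Rlt_0_1) as [e [He H]].
exists (/ kap (g (k a))).
apply (Caratheodory_derive g (fun b => / kap (g b)) (k a) e He).
- intros b Hb. destruct (H b Hb) as [y [Hy1 [_ E]]]. rewrite <- E, !Hg by assumption.
  destruct (classic (y = a)) as [->|Hne]; [ring|].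
  assert (E' := divided_difference_spec 1 k a y (convex_holomorphic k Hk) Ha Hy1). fold kap in E'.
  assert (Hk0 : kap y <> 0).
  { intros E0. apply Hne. apply (convex_injective k Hk); auto. rewrite E', E0. ring. }
  rewrite E'. field. exact Hk0.
- apply (continuous_at_comp (fun x => / kap x) g); [exact Hgc|]. rewrite Hg by exact Ha.
  apply ex_Cderive_continuous_at. eexists.
  apply (is_Cderive_comp (fun x => / x) kap); [|apply ex_Cderive_C_derive, Hkap, Ha].
  apply is_Cderive_inv. unfold kap. rewrite divided_difference_diag. now apply convex_derive_neq_0.
Qed.
End Inverse.

Lemma exists_left_inverse (k : C -> C) : convex_map k ->
  exists g : C -> C, forall a, Cmod a < 1 -> g (k a) = a.
Proof.
intros Hk.
set (P := fun b y => Cmod y < 1 /\ k y = b).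
exists (fun b => match excluded_middle_informative (exists y, P b y) with
  | left H => proj1_sig (constructive_indefinite_description _ H) | right _ => 0 end).
intros a Ha. destruct (excluded_middle_informative _) as [H|H].
- destruct (constructive_indefinite_description _ H) as [y [Hy1 Hy2]]. simpl.
  now apply (convex_injective k Hk).
- exfalso. apply H. exists a. now split.
Qed.

(** On a disk whose image under p lies in the range of k, v = k^{-1}(p) satisfies
    |v(z)| <= |z|: otherwise Jack's lemma at a maximum of |v| contradicts
    [convex_ray_avoids].  If p left the range of k, there would be a point z0 of
    smallest modulus r where this happens.  As z tends to z0 from inside, the
    points v(z) stay in the compact disk of radius r < 1, so p(z0) would be a
    value of k after all. *)
Theorem convex_subordination (k p w : C -> C) : convex_map k -> holomorphic 1 p -> p 0 = k 0 ->
  holomorphic 1 w -> w 0 = 0 -> (forall z, Cmod z < 1 -> Cmod (w z) < 1) ->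
  (forall z, Cmod z < 1 -> p z + z * C_derive p z = k (w z) + w z * C_derive k (w z)) ->
  exists v, holomorphic 1 v /\ v 0 = 0 /\ (forall z, Cmod z < 1 -> Cmod (v z) < 1) /\
    forall z, Cmod z < 1 -> p z = k (v z).
Proof.
intros Hk Hp Hp0 Hw Hw0 Hw1 Heq.
destruct (exists_left_inverse k Hk) as [g Hg].
set (v := fun z => g (p z)).
set (good := fun z => exists y, Cmod y < 1 /\ k y = p z).
assert (H01 : Cmod 0 < 1) by (rewrite Cmod_0; lra).
assert (Hgood : forall z, good z -> Cmod (v z) < 1 /\ p z = k (v z)).
{ intros z [y [Hy E]]. unfold v. rewrite <- E, Hg by exact Hy. auto. }
assert (Hv : forall z, Cmod z < 1 -> good z -> is_Cderive v z (C_derive v z)).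
{ intros z Hz Hgz. apply ex_Cderive_C_derive. destruct Hgz as [y [Hy E]].
  destruct (inverse_derive k g Hk Hg y Hy) as [l Hl]. rewrite E in Hl.
  eexists. apply (is_Cderive_comp g p); [exact Hl|apply ex_Cderive_C_derive, Hp, Hz]. }
assert (Hv0 : v 0 = 0) by (unfold v; rewrite Hp0; now apply Hg).
assert (Hdisk : forall r, r <= 1 -> (forall z, Cmod z < r -> good z) ->
  forall z, Cmod z < r -> Cmod (v z) <= Cmod z).
{ intros r Hr Hgr z Hz. apply Rnot_lt_le. intros Hlt.
  assert (Hvr : holomorphic r v) by (intros x Hx; exists (C_derive v x); apply Hv; auto; lra).
  destruct (Cmod_max_on_disk r v (Cmod z) Hvr) as [m [Hm Hmax]].
  { split; [apply Cmod_ge_0|exact Hz]. }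
  assert (Hzm : Cmod (v z) <= Cmod (v m)) by (apply Hmax; lra).
  assert (Hmr : Cmod m < r) by lra. assert (Hm1 : Cmod m < 1) by lra.
  pose proof (Cmod_ge_0 z) as Hz0.
  destruct (Jack_lemma r v m Hvr Hv0 Hmr) as [n [Hn En]].
  { apply Cmod_gt_0. lra. }
  { intros y Hy. apply Hmax. lra. }
  destruct (Hgood m (Hgr m Hmr)) as [Hvm1 Hvm2].
  assert (Hwm : Cmod (w m) <= Cmod m).
  { assert (E := Schwarz_lemma 1 w 1 Hw Hw0 (fun x Hx => Rlt_le _ _ (Hw1 x Hx)) m Hm1). lra. }
  apply (convex_ray_avoids k Hk (v m) (w m) n Hvm1 ltac:(lra) Hn).
  rewrite <- (Heq m Hm1), Hvm2. f_equal.
  assert (Ep : C_derive p m = C_derive v m * C_derive k (v m)).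
  { apply is_C_derive_unique.
    apply (is_Cderive_ext_loc (fun x => k (v x)) p m _ (r - Cmod m)); [lra| |].
    - intros y Hy. symmetry. apply Hgood, Hgr. pose proof (Cmod_le_minus y m). lra.
    - apply (is_Cderive_comp k v); [now apply convex_derive|apply Hv; auto]. }
  rewrite Ep, !Cmult_assoc, En. ring. }
assert (Hall : forall z, Cmod z < 1 -> good z).
{ intros z1 Hz1. apply NNPP. intros Hbad.
  destruct (extreme_value (fun z => Cmod z <= Cmod z1 /\ ~ good z) (Cmod z1) (fun z => (- Cmod z)%R) z1)
    as [z0 [[Hz0 Hz0bad] Hmin]].
  - intros z HzK. destruct (Rlt_dec (Cmod z1) (Cmod z)) as [Hlt|Hnlt].
    + exists (Cmod z - Cmod z1)%R. split; [lra|]. intros y Hy [HyK _].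
      pose proof (Cmod_le_minus z y) as E. rewrite Cmod_minus_sym in E. lra.
    + assert (Hgz : good z) by (apply NNPP; intros Hb; apply HzK; split; [lra|exact Hb]).
      destruct Hgz as [a [Ha E]].
      destruct (convex_open k Hk a 1 Ha Rlt_0_1) as [e [He H]].
      destruct (holomorphic_continuous_at 1 p Hp z ltac:(lra) e He) as [d [Hd Hc]].
      exists d. split; [exact Hd|]. intros y Hy [_ Hyb]. apply Hyb.
      specialize (Hc y Hy). rewrite <- E in Hc. destruct (H _ Hc) as [x [Hx1 [_ Hx2]]].
      now exists x.
  - tauto.
  - split; [lra|exact Hbad].
  - intros z _ eps He. exists eps. split; [exact He|]. intros y _ Hy.
    eapply Rle_lt_trans; [|exact Hy]. apply Rabs_le.
    pose proof (Cmod_le_minus y z). pose proof (Cmod_le_minus z y) as E.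
    rewrite (Cmod_minus_sym z) in E. lra.
  - simpl in Hmin. set (r := Cmod z0) in *.
    assert (Hr1 : r < 1) by lra.
    assert (Hinside : forall z, Cmod z < r -> good z).
    { intros z Hz. apply NNPP. intros Hb. specialize (Hmin z).
      assert (- Cmod z <= - r) by (apply Hmin; split; [lra|exact Hb]). lra. }
    assert (Hr0 : 0 <= r) by apply Cmod_ge_0.
    assert (Hkd : holomorphic 1 (fun y => k y - p z0)).
    { intros y Hy. eexists. apply is_Cderive_minus; [now apply convex_derive|apply is_Cderive_const]. }
    (* p(z0) is not a value of k on the closed disk of radius r, so it has a
       positive distance mu from these values. *)
    destruct (closed_disk_extreme r (fun y => (- Cmod (k y - p z0))%R) Hr0) as [y [Hy Hymin]].
    { intros x Hx eps He.
      destruct (holomorphic_continuous_at 1 _ Hkd x ltac:(lra) eps He) as [d [Hd Hc]].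
      exists d. split; [exact Hd|]. intros y Hy. eapply Rle_lt_trans; [|apply (Hc y Hy)].
      apply Rabs_le. pose proof (Cmod_le_minus (k y - p z0) (k x - p z0)).
      pose proof (Cmod_le_minus (k x - p z0) (k y - p z0)) as E.
      rewrite (Cmod_minus_sym (k x - p z0) (k y - p z0)) in E. lra. }
    simpl in Hymin.
    assert (Hne : k y - p z0 <> 0).
    { intros E. apply Hz0bad. exists y. split; [lra|]. now apply Ceq_minus. }
    assert (Hmu := proj1 (Cmod_gt_0 _) Hne). set (mu := Cmod (k y - p z0)) in *.
    destruct (holomorphic_continuous_at 1 p Hp z0 Hr1 mu Hmu) as [d [Hd Hc]].
    assert (Hrp : 0 < r).
    { destruct Hr0 as [Hr0|Hr0]; [exact Hr0|]. exfalso. apply Hz0bad.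
      symmetry in Hr0. apply Cmod_eq_0 in Hr0. rewrite Hr0. exists 0. rewrite Hp0. auto. }
    (* A point z = (1 - t) z0 with |p(z) - p(z0)| < mu. *)
    set (t := Rmin (1 / 2) (d / (2 * r))).
    assert (Ht0 : 0 < t) by (apply Rmin_pos; [lra|apply Rdiv_lt_0_compat; lra]).
    assert (Ht1 : t <= 1 / 2) by apply Rmin_l.
    assert (Ht2 : t * r < d).
    { apply Rle_lt_trans with (d / (2 * r) * r)%R.
      - apply Rmult_le_compat_r; [lra|apply Rmin_r].
      - replace (d / (2 * r) * r)%R with (d / 2)%R by (field; lra). lra. }
    set (z := RtoC (1 - t) * z0).
    assert (Hzr : Cmod z < r).
    { unfold z. rewrite Cmod_mult, Cmod_R, Rabs_pos_eq by lra. fold r. nra. }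
    assert (Hzz0 : Cmod (z - z0) < d).
    { replace (z - z0) with (- (RtoC t * z0)) by (unfold z; rewrite RtoC_minus; ring).
      rewrite Cmod_opp, Cmod_mult, Cmod_R, Rabs_pos_eq by lra. exact Ht2. }
    specialize (Hc z Hzz0). destruct (Hgood z (Hinside z Hzr)) as [_ E]. rewrite E in Hc.
    assert (Hvz : Cmod (v z) <= r).
    { assert (A := Hdisk r ltac:(lra) Hinside z Hzr). lra. }
    specialize (Hymin (v z) Hvz). lra. }
exists v. split; [|split; [exact Hv0|split]].
- intros z Hz. exists (C_derive v z). apply Hv; auto.
- intros z Hz. apply Hgood. auto.
- intros z Hz. apply Hgood. auto.
Qed.

(** * From the differential subordination to starlikeness *)

Lemma sum_n_Re (u : nat -> C) n :
  Re (@sum_n C_NormedModule u n) = @sum_n R_AbelianMonoid (fun i => Re (u i)) n.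
Proof.
induction n as [|n IH].
- rewrite !sum_O. reflexivity.
- rewrite !sum_Sn, <- IH. reflexivity.
Qed.

Lemma pseries_Re (a : nat -> C) (x : R) (l : C) :
  @is_pseries C_AbsRing C_NormedModule a (RtoC x) l ->
  is_pseries (fun n => Re (a n)) x (Re l).
Proof.
intros H. unfold is_pseries, is_series in *.
apply (filterlim_ext (fun n => Re (@sum_n C_NormedModule
  (fun k => @scal C_AbsRing C_NormedModule (pow_n (RtoC x) k) (a k)) n))).
- intros n. rewrite sum_n_Re. apply sum_n_ext. intros i.
  assert (E : @pow_n C_AbsRing (RtoC x) i = RtoC (x ^ i)).
  { induction i as [|i IH]; [reflexivity|]. simpl. rewrite IH.
    change (RtoC x * RtoC (x ^ i) = RtoC (x * x ^ i)). now rewrite RtoC_mult. }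
  etransitivity; [exact (f_equal (fun q => Re (q * a i)) E)|].
  rewrite re_scal_l. exact (f_equal (fun q => q * Re (a i))%R (eq_sym (pow_n_pow x i))).
- eapply filterlim_comp; [exact H|]. apply (continuous_fst (U:=R_UniformSpace) (V:=R_UniformSpace)).
Qed.

(** On the real axis Re f is a real power series with linear coefficient 1, so
    that Re f'(0) = 1. *)
Lemma class_A_values (f : C -> C) : class_A f -> f 0 = 0 /\ C_derive f 0 <> 0.
Proof.
intros [Hf [a [a0 [a1 Ha]]]].
assert (H01 : unit_disk 0) by (unfold unit_disk; rewrite Cmod_0; lra).
split.
- assert (H := Ha 0 H01). transitivity (a 0%nat); [|exact a0].
  assert (H2 := @is_pseries_0 C_AbsRing C_NormedModule a).
  exact (@filterlim_locally_unique nat C_AbsRing C_NormedModule eventually _ _ _ _ H H2).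
- set (b := fun n => Re (a n)).
  assert (Hb : forall x, Rabs x < 1 -> is_pseries b x (Re (f (RtoC x)))).
  { intros x Hx. apply pseries_Re, Ha. unfold unit_disk. now rewrite Cmod_R. }
  assert (Hcv : Rbar_lt (Rabs 0) (CV_radius b)).
  { rewrite Rabs_R0. apply Rbar_not_le_lt. intros Hle.
    apply (CV_disk_outside b (1 / 2)).
    - eapply Rbar_le_lt_trans; [exact Hle|]. simpl. rewrite Rabs_pos_eq; lra.
    - apply ex_series_lim_0.
      assert (E := Hb (1/2)%R ltac:(rewrite Rabs_pos_eq; lra)).
      apply (ex_series_ext (fun n => scal (pow_n (1/2)%R n) (b n))).
      + intros n. rewrite pow_n_pow. apply Rmult_comm.
      + now exists (Re (f (RtoC (1/2)))). }
  assert (H1 := is_derive_PSeries b 0 Hcv).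
  assert (H2 : is_derive (fun x => Re (f (RtoC x))) 0 (Re (C_derive f 0 * 1))).
  { apply is_Rderive_Re. apply (is_Rderive_comp f RtoC).
    - apply ex_Cderive_C_derive. apply Hf, H01.
    - assert (E := is_Rderive_line 0 1 0).
      refine (is_derive_ext _ _ _ _ _ E). intros t. simpl. ring. }
  assert (H3 : is_derive (PSeries b) 0 (Re (C_derive f 0 * 1))).
  { eapply is_derive_ext_loc; [|exact H2]. exists (mkposreal 1 Rlt_0_1).
    intros x Hx. symmetry. apply is_pseries_unique, Hb.
    change (Rabs (x - 0) < 1) in Hx. now rewrite Rminus_0_r in Hx. }
  apply is_derive_unique in H1. apply is_derive_unique in H3. rewrite H1 in H3.
  rewrite PSeries_0 in H3. unfold PS_derive, b in H3. rewrite a1 in H3.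
  intros E. rewrite E in H3. simpl in H3. lra.
Qed.

Lemma holomorphic_comp rho f g : holomorphic 1 f -> holomorphic rho g ->
  (forall z, Cmod z < rho -> Cmod (g z) < 1) -> holomorphic rho (fun z => f (g z)).
Proof.
intros Hf Hg Hg1 z Hz. eexists. apply (is_Cderive_comp f g).
- apply ex_Cderive_C_derive, Hf, Hg1, Hz.
- apply ex_Cderive_C_derive, Hg, Hz.
Qed.

(** The difference E of the two sides vanishes at 0 and satisfies (E/f')' = 0 near
    0, because (z (1 - p))' = 1 - F and F f'^2 = f f''.  The identity theorem
    extends E = 0 to the disk, whatever the zeros of f'. *)
Lemma factor_through_quotient (f F : C -> C) : holomorphic 1 f -> holomorphic 1 F ->
  f 0 = 0 -> C_derive f 0 <> 0 ->
  (forall z, Cmod z < 1 -> C_derive f z <> 0 ->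
     F z * (C_derive f z * C_derive f z) = f z * C_derive (C_derive f) z) ->
  forall z, Cmod z < 1 -> f z = C_derive f z * (z * (1 - radial_mean F z)).
Proof.
intros Hf HF Hf0 Hf'0 HFf.
assert (Hf1 := holomorphic_C_derive 1 f Hf). assert (Hp := holomorphic_radial_mean 1 F HF).
assert (H01 : Cmod 0 < 1) by (rewrite Cmod_0; lra).
set (E := fun z => C_derive f z * (z * (1 - radial_mean F z)) - f z).
assert (HE : forall z, Cmod z < 1 -> is_Cderive E z
  (C_derive (C_derive f) z * (z * (1 - radial_mean F z)) - C_derive f z * F z)).
{ intros z Hz. eapply is_Cderive_eq.
  - apply is_Cderive_minus; [|apply ex_Cderive_C_derive, Hf, Hz].
    apply (is_Cderive_mult (C_derive f)); [apply ex_Cderive_C_derive, Hf1, Hz|].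
    apply (is_Cderive_mult (fun z => z)); [apply is_Cderive_id|].
    apply is_Cderive_minus; [apply is_Cderive_const|apply ex_Cderive_C_derive, Hp, Hz].
  - rewrite <- (radial_mean_eq 1 F z HF Hz). simpl. ring. }
destruct (holomorphic_continuous_at 1 _ Hf1 0 H01 (Cmod (C_derive f 0))) as [d [Hd Hnz]].
{ now apply Cmod_gt_0. }
assert (Hnz' : forall z, Cmod z < d -> C_derive f z <> 0).
{ intros z Hz. apply (Cmod_lt_neq (C_derive f 0)). apply Hnz. now replace (z - 0) with z by ring. }
assert (HE0 : forall z, Cmod z < 1 -> E z = 0).
{ apply (identity_theorem 1 E d); [|exact Hd|].
  - intros z Hz. eexists. now apply HE.
  - intros z Hzd Hz.
    assert (Q : E 0 / C_derive f 0 = E z / C_derive f z).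
    { apply (derive_zero_segment (fun x => E x / C_derive f x)). intros t Ht.
      assert (Ht1 : Cmod (segment_point 0 z t) < 1) by (now apply segment_in_disk).
      assert (Htd : Cmod (segment_point 0 z t) < d)
        by (apply segment_in_disk; auto; rewrite Cmod_0; exact Hd).
      set (x := segment_point 0 z t) in *. assert (Hx := Hnz' x Htd).
      eapply is_Cderive_eq.
      - apply is_Cderive_div; [exact Hx|now apply HE|apply ex_Cderive_C_derive, Hf1, Ht1].
      - unfold E. assert (EF := HFf x Ht1 Hx).
        replace ((C_derive (C_derive f) x * (x * (1 - radial_mean F x)) - C_derive f x * F x) * C_derive f x -
          (C_derive f x * (x * (1 - radial_mean F x)) - f x) * C_derive (C_derive f) x)
          with (f x * C_derive (C_derive f) x - F x * (C_derive f x * C_derive f x)) by ring.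
        rewrite EF. field. exact Hx. }
    assert (E0 : E 0 = 0) by (unfold E; rewrite Hf0; ring).
    replace (E z) with (E z / C_derive f z * C_derive f z) by (field; auto).
    rewrite <- Q, E0. unfold Cdiv. ring. }
intros z Hz. specialize (HE0 z Hz). unfold E in HE0. symmetry. now apply Ceq_minus.
Qed.

Theorem theorem3p4 (psi h f : C -> C)
  (Hpsi : ma_minda psi)
  (Hh : analytic h)
  (Hh0 : h 0 = 0)
  (Hh'0 : C_derive h 0 <> 0)
  (Hh_re : forall z : C, unit_disk z ->
     C_derive h z <> 0 /\
     (- (1 / 2) <= Re (1 + z * C_derive (C_derive h) z / C_derive h z))%R)
  (Hh_psi : quotient_subordinate (primitive0 h) (fun z : C => z)
     (fun z : C => (psi z - 1) / psi z))
  (Hf : class_A f)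
  (Hf_h : quotient_subordinate
     (fun z : C => f z * C_derive (C_derive f) z)
     (fun z : C => C_derive f z * C_derive f z) h) :
  starlike_class psi f.
Proof.
destruct (class_A_values f Hf) as [Hf0 Hf'0].
split; [exact Hf|]. destruct Hf as [Hfa _].
destruct Hpsi as [Hpsia [_ [Hpsipos [Hpsi0 _]]]].
destruct Hf_h as [F [[HF HFq] [w [Hw [Hw0 [Hw1 HFw]]]]]].
destruct Hh_psi as [Q [[HQ HQq] [s [Hs [Hs0 [Hs1 HQs]]]]]].
assert (H01 : Cmod 0 < 1) by (rewrite Cmod_0; lra).
assert (Hpsine : forall z, Cmod z < 1 -> psi z <> 0).
{ intros z Hz E. specialize (Hpsipos z Hz). rewrite E in Hpsipos. simpl in Hpsipos. lra. }
assert (Hk : convex_map (radial_mean h)) by (now apply radial_mean_convex).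
assert (Hks : forall z, Cmod z < 1 -> radial_mean h z = (psi (s z) - 1) / psi (s z)).
{ intros z Hz. destruct (classic (z = 0)) as [->|Hz0].
  (* The quotient primitive0 h z / z says nothing at 0; there both sides are 0
     because h(0) = 0 and psi(s(0)) = psi(0) = 1. *)
  - rewrite radial_mean_0, Hh0, Hs0, Hpsi0. unfold Cdiv. ring.
  - rewrite <- (HQs z Hz), (HQq z Hz Hz0), (primitive0_radial_mean 1 h z Hh Hz). field. exact Hz0. }
destruct (convex_subordination (radial_mean h) (radial_mean F) w Hk) as [v [Hv [Hv0 [Hv1 Hpv]]]]; auto.
{ now apply holomorphic_radial_mean. }
{ now rewrite !radial_mean_0, (HFw 0 H01), Hw0. }
{ intros z Hz. rewrite (radial_mean_eq 1 F z HF Hz), (radial_mean_eq 1 h (w z) Hh (Hw1 z Hz)).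
  now apply HFw. }
assert (Hsv : holomorphic 1 (fun z => s (v z))) by (now apply holomorphic_comp).
assert (Hsv1 : forall z, Cmod z < 1 -> Cmod (s (v z)) < 1) by (intros z Hz; now apply Hs1, Hv1).
assert (Hfac := factor_through_quotient f F Hfa HF Hf0 Hf'0).
exists (fun z => psi (s (v z))). split.
- split.
  + exact (holomorphic_comp 1 psi (fun z => s (v z)) Hpsia Hsv Hsv1).
  + intros z Hz Hfz.
    assert (E : f z = C_derive f z * z / psi (s (v z))).
    { rewrite Hfac at 1; [| |exact Hz].
      - rewrite (Hpv z Hz), (Hks (v z) (Hv1 z Hz)). field. apply Hpsine. auto.
      - intros x Hx Hx0. rewrite (HFq x Hx) by (now apply Cmult_neq_0). field. exact Hx0. }
    assert (Hp := Hpsine _ (Hsv1 z Hz)).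
    assert (Hne : C_derive f z <> 0 /\ z <> 0).
    { split; intros E0; apply Hfz; rewrite E, E0; unfold Cdiv; ring. }
    rewrite E. field. repeat split; try apply Hne. exact Hp.
- exists (fun z => s (v z)). repeat split.
  + exact Hsv.
  + now rewrite Hv0.
  + exact Hsv1.
Qed.
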